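(* Assume the network assumption, the stochastic gradient assumption, the unbiased compressor assumption (with parameter $C>0$) and the smoothness assumption (with constant $L$) stated in the context. Assume further that for some $q>0$, $$\|\mathbf{x}_{-1}\|^2=\|H_0\|^2=\mathcal{O}(n^2),\qquad\|\nabla F(\mathbf{x}_{-1})\|^2=\mathcal{O}(n^2),\qquad\frac{1}{1-\lambda_2}=\mathcal{O}(n^q).$$ Let $\alpha=\frac{1}{4(C+1)}$ and $\gamma=\frac{\alpha^2(1-\lambda_2)}{\beta_0C}$ with $\beta_0=15872$, where these satisfy $\gamma\le\min\{\frac12,\frac{\alpha^2(1-\lambda_2)}{15872C},\frac\alpha2\}$; let $\Delta_0=f(\bar x_{-1})-f^{\inf}$ and run CEDAS with the constant stepsize $$\eta_k=\eta=\frac{1}{\sqrt{\frac{L\sigma^2K}{n\Delta_0}}+\frac{32L}{\gamma(1-\lambda_2)}}.$$ Then the transient time of CEDAS (defined in the context) becomes $$K_T^{(ncvx)}=\mathcal{O}\left(\frac{n^3C^6}{(1-\lambda_2)^4}\right).$$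
   Context: Notation. There are $n\ge2$ agents; $f_i:\mathbb{R}^p\to\mathbb{R}$ is differentiable, $f=\frac1n\sum_{i=1}^nf_i$, and $f^{\inf}=\inf_{x\in\mathbb{R}^p}f(x)$ (finite). For $\mathbf{x}\in\mathbb{R}^{n\times p}$ with $i$-th row $x_i^\top$, $\bar x=\frac1n\sum_ix_i$, and $\nabla F(\mathbf{x})\in\mathbb{R}^{n\times p}$ has $i$-th row $\nabla f_i(x_i)^\top$. $\mathbf{1}\in\mathbb{R}^n$ is the all-ones vector. $\|\cdot\|$ is the Euclidean norm of vectors and the Frobenius norm of matrices. Transient time. $K_T^{(ncvx)}=\inf\{K:\ \frac1k\sum_{t=0}^{k-1}\mathbb{E}[\|\nabla f(\bar x_t)\|^2]\le\mathcal{O}(1/\sqrt{nk})\ \text{for all }k\ge K\}$, where for each $k$ the iterates are those produced with the stepsize $\eta$ computed with horizon $K=k$. $\mathcal{O}(\cdot)$ hides factors independent of $n$, $1-\lambda_2$, the iteration count and all other displayed quantities such as $C$ (they may depend on e.g. $L,\sigma,\Delta_0$); the dependence on $C$ is asymptotic, for $C$ bounded away from $0$. An equality $K_T=\mathcal{O}(\cdot)$ is an upper bound in this sense. Network assumption. The communication graph on the agents is undirected and connected; $W=(w_{ij})\in\mathbb{R}^{n\times n}$ is symmetric, entrywise nonnegative, positive semidefinite, $W\mathbf{1}=\mathbf{1}$, and for $i\ne j$ one has $w_{ij}=w_{ji}>0$ if $i,j$ are linked and $w_{ij}=w_{ji}=0$ otherwise. Its eigenvalues are $1=\lambda_1>\lambda_2\ge\cdots\ge\lambda_n\ge0$.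 CEDAS. Given stepsizes $\eta_k>0$ ($k\ge-1$), parameters $\alpha,\gamma>0$, a (possibly random) compression operator $\mathcal{C}:\mathbb{R}^p\to\mathbb{R}^p$ applied row by row, and deterministic $\mathbf{x}_{-1},H_0\in\mathbb{R}^{n\times p}$, set $D_0=0$, $\mathbf{x}_0=\mathbf{x}_{-1}-\eta_{-1}G_{-1}$, and for $k\ge0$: $\mathbf{y}_k=\mathbf{x}_k-\eta_kG_k-D_k$; $Q_k=\mathcal{C}(\mathbf{y}_k-H_k)$; $D_{k+1}=D_k+\frac\gamma2(I-W)(H_k+Q_k)$; $H_{k+1}=H_k+\alpha Q_k$; $\mathbf{x}_{k+1}=\mathbf{x}_k-\eta_kG_k-D_{k+1}$. Here $G_k$ has rows $g_{i,k}^\top$ with $g_{i,k}=\nabla f_i(x_{i,k};\xi_{i,k})$ the stochastic gradient, and $x_{i,k}^\top$ is the $i$-th row of $\mathbf{x}_k$. Stochastic gradient assumption. For all $k\ge-1$, conditionally on all randomness generated before the samples $\xi_{1,k},\dots,\xi_{n,k}$ are drawn, these samples are independent across $i$, $g_{i,k}$ has mean $\nabla f_i(x_{i,k})$, and $\|g_{i,k}-\nabla f_i(x_{i,k})\|^2$ has expectation at most $\sigma^2$ ($\sigma>0$). Unbiased compressor assumption. $\mathbb{E}[\mathcal{C}(x)\mid x]=x$ and $\mathbb{E}[\|\mathcal{C}(x)-x\|^2\mid x]\le C\|x\|^2$ for all $x\in\mathbb{R}^p$, with $C>0$; at each use these hold conditionally on all randomness preceding the compression. Smoothness assumption. Each $\nabla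 f_i$ is $L$-Lipschitz. *)

(* Defs.v *)
From HB Require Import structures.
From mathcomp Require Export all_boot all_order all_algebra.
From mathcomp Require Export all_classical all_reals all_analysis.
From mathcomp Require Export measurable_realfun.
Export Order.TTheory GRing.Theory Num.Theory.
Export numFieldNormedType.Exports.

Set Implicit Arguments.
Unset Strict Implicit.
Unset Printing Implicit Defensive.

Local Open Scope classical_set_scope.
Local Open Scope ring_scope.

(* Frobenius norm; on row vectors it is the Euclidean norm.  (The library's
   norm on matrices, `|A|, is the sup norm.) *)
Definition frob (R : realType) (m n : nat) (A : 'M[R]_(m, n)) : R :=
  Num.sqrt (\sum_i \sum_j A i j ^+ 2).

Definition grad (R : realType) (p : nat) (f : 'rV[R]_p -> R) (x : 'rV[R]_p) :
  'rV[R]_p := \row_j 'D_(delta_mx 0 j) f x.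

Definition avg_fun (R : realType) (n p : nat) (f : 'I_n -> 'rV[R]_p -> R)
  (x : 'rV[R]_p) : R := n%:R^-1 * \sum_i f i x.

Definition avg_row (R : realType) (n p : nat) (x : 'M[R]_(n, p)) : 'rV[R]_p :=
  n%:R^-1 *: \sum_i row i x.

Definition grad_rows (R : realType) (n p : nat) (f : 'I_n -> 'rV[R]_p -> R)
  (x : 'M[R]_(n, p)) : 'M[R]_(n, p) :=
  \matrix_(i, j) grad (f i) (row i x) 0 j.

(* The sequence lam lists the eigenvalues with their multiplicities, so that
   lam`_0 is lambda_1 and lam`_1 is lambda_2. *)
Record network (R : realType) (n : nat) (link : rel 'I_n) (W : 'M[R]_n)
    (lam : seq R) : Prop := Network {
  link_undirected : symmetric link;
  link_connected : forall i j, connect link i j;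
  W_sym : W^T = W;
  W_ge0 : forall i j, 0 <= W i j;
  W_psd : forall v : 'cV[R]_n, 0 <= (v^T *m W *m v) 0 0;
  W_stochastic : W *m const_mx 1 = const_mx 1 :> 'cV[R]_n;
  W_link : forall i j, i != j -> link i j -> 0 < W i j;
  W_nolink : forall i j, i != j -> ~~ link i j -> W i j = 0;
  lam_eigen : char_poly W = \prod_(a <- lam) ('X - a%:P);
  lam_sorted : sorted >=%R lam;
  lam_first : lam`_0 = 1;
  lam_second : lam`_1 < 1;
  lam_ge0 : forall a, a \in lam -> 0 <= a }.

Definition smooth (R : realType) (n p : nat) (L : R)
  (f : 'I_n -> 'rV[R]_p -> R) : Prop :=
  (forall i x, differentiable (f i) x) /\
  (forall i x y,
     frob (grad (f i) x - grad (f i) y) <= L * frob (x - y)).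

Definition borel_rV (R : realType) (p : nat) :=
  g_sigma_algebraType (@open 'rV[R]_p).

(* Conditional expectations given a sub-sigma-algebra G of the events. *)
Section conditional.
Context (R : realType) (d : measure_display) (Omega : measurableType d)
  (P : probability Omega R).
Implicit Types (G : set (set Omega)).

Definition sub_sigma_algebra_of G : Prop :=
  sigma_algebra setT G /\ G `<=` measurable.

Definition measurable_wrt (d' : measure_display) (T : measurableType d') G
  (X : Omega -> T) : Prop := forall B, measurable B -> G (X @^-1` B).

(* Y is a version of E[X | G]. *)
Definition cond_exp G (X Y : Omega -> \bar R) : Prop :=
  measurable_wrt G Y /\
  forall A, G A -> (\int[P]_(w in A) X w = \int[P]_(w in A) Y w)%E.

(* E[X | G] = m, for random vectors. *)
Definition cond_mean (p : nat) G (X m : Omega -> 'rV[R]_p) : Prop :=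
  forall j, P.-integrable setT (fun w => (X w 0 j)%:E) /\
    cond_exp G (fun w => (X w 0 j)%:E) (fun w => (m w 0 j)%:E).

(* E[ |X - m|^2 | G] <= b almost surely. *)
Definition cond_sqdist_le (p : nat) G (X m : Omega -> 'rV[R]_p)
    (b : Omega -> R) : Prop :=
  exists2 V : Omega -> \bar R,
    cond_exp G (fun w => (frob (X w - m w) ^+ 2)%:E) V &
    {ae P, forall w, (V w <= (b w)%:E)%E}.

Definition cond_indep (d' : measure_display) (T : measurableType d') (n : nat)
    G (X : 'I_n -> Omega -> T) : Prop :=
  forall B : 'I_n -> set T, (forall i, measurable (B i)) ->
  exists2 Z : 'I_n -> Omega -> R,
    (forall i, cond_exp G (fun w => (\1_(X i @^-1` B i) w)%:E)
                          (fun w => (Z i w)%:E)) &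
    cond_exp G (fun w => (\1_(\bigcap_i (X i @^-1` B i)) w)%:E)
               (fun w => (\prod_i Z i w)%:E).

End conditional.

(* Sources of randomness of one run.  The index k >= -1 of the samples is
   shifted: sample i 0 is xi_{i,-1} and sample i k.+1 is xi_{i,k}.  Likewise
   before_sample k.+1 consists of the events generated before the xi_{i,k} are
   drawn, whereas before_comp k consists of those preceding the compressions of
   iteration k, which use the seeds seed i k. *)
Record randomness (R : realType) (n : nat) (dXi dZ : measure_display)
    (Xi : measurableType dXi) (Z : measurableType dZ) := Randomness {
  disp : measure_display;
  Omega : measurableType disp;
  Pr : probability Omega R;
  sample : 'I_n -> nat -> Omega -> Xi;
  seed : 'I_n -> nat -> Omega -> Z;
  before_sample : nat -> set (set Omega);
  before_comp : nat -> set (set Omega);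
  before_sample_sub : forall k, sub_sigma_algebra_of (before_sample k);
  before_comp_sub : forall k, sub_sigma_algebra_of (before_comp k);
  before_sample_01 : before_sample 0 `<=` before_sample 1;
  sample_comp_sub : forall k, before_sample k.+1 `<=` before_comp k;
  comp_sample_sub : forall k, before_comp k `<=` before_sample k.+2;
  sample0_measurable :
    forall i, measurable_wrt (before_sample 1) (sample i 0);
  sample_measurable :
    forall i k, measurable_wrt (before_comp k) (sample i k.+1);
  seed_measurable :
    forall i k, measurable_wrt (before_sample k.+2) (seed i k) }.
Arguments before_sample {R n dXi dZ Xi Z} r k.
Arguments before_comp {R n dXi dZ Xi Z} r k.

(* Pointwise in the randomness: s i k and z i k are the samples and seeds, with
   the same index shift as above; eta 0 is eta_{-1} and eta k.+1 is eta_k. *)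
Section algorithm.
Context (R : realType) (n p : nat) (Xi Z : Type).
Variables (sgrad : 'I_n -> Xi -> 'rV[R]_p -> 'rV[R]_p)
  (comp : Z -> 'rV[R]_p -> 'rV[R]_p) (W : 'M[R]_n) (alpha gamma : R)
  (eta : nat -> R) (xm1 H0 : 'M[R]_(n, p))
  (s : 'I_n -> nat -> Xi) (z : 'I_n -> nat -> Z).

Definition sgrad_rows (k : nat) (x : 'M[R]_(n, p)) : 'M[R]_(n, p) :=
  \matrix_(i, j) sgrad i (s i k) (row i x) 0 j.

Definition comp_rows (k : nat) (y : 'M[R]_(n, p)) : 'M[R]_(n, p) :=
  \matrix_(i, j) comp (z i k) (row i y) 0 j.

Record state := State {
  st_x : 'M[R]_(n, p); st_D : 'M[R]_(n, p); st_H : 'M[R]_(n, p) }.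

(* y_k - H_k *)
Definition comp_input (k : nat) (st : state) : 'M[R]_(n, p) :=
  let: State x D H := st in
  (x - eta k.+1 *: sgrad_rows k.+1 x - D) - H.

Definition cedas_step (k : nat) (st : state) : state :=
  let: State x D H := st in
  let Q := comp_rows k (comp_input k st) in
  let D' := D + (gamma / 2) *: ((1%:M - W) *m (H + Q)) in
  let H' := H + alpha *: Q in
  State (x - eta k.+1 *: sgrad_rows k.+1 x - D') D' H'.

Fixpoint cedas (k : nat) : state :=
  if k is k'.+1 then cedas_step k' (cedas k')
  else State (xm1 - eta 0 *: sgrad_rows 0 xm1) 0 H0.

(* With the shift: cedas_point 0 is x_{-1} and cedas_point k.+1 is x_k. *)
Definition cedas_point (k : nat) : 'M[R]_(n, p) :=
  if k is k'.+1 then st_x (cedas k') else xm1.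

End algorithm.

Section assumptions.
Context (R : realType) (n p : nat) (dXi dZ : measure_display)
  (Xi : measurableType dXi) (Z : measurableType dZ).
Variables (f : 'I_n -> 'rV[R]_p -> R)
  (sgrad : 'I_n -> Xi -> 'rV[R]_p -> 'rV[R]_p)
  (comp : Z -> 'rV[R]_p -> 'rV[R]_p) (W : 'M[R]_n) (alpha gamma : R)
  (eta : nat -> R) (xm1 H0 : 'M[R]_(n, p)) (r : randomness R n Xi Z).

Definition run_state (k : nat) (w : Omega r) : state R n p :=
  cedas sgrad comp W alpha gamma eta xm1 H0
    (fun i l => sample i l w) (fun i l => seed i l w) k.

Definition run_point (k : nat) (w : Omega r) : 'M[R]_(n, p) :=
  cedas_point sgrad comp W alpha gamma eta xm1 H0
    (fun i l => sample i l w) (fun i l => seed i l w) k.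

Definition run_comp_input (k : nat) (w : Omega r) : 'M[R]_(n, p) :=
  comp_input sgrad eta (fun i l => sample i l w) k (run_state k w).

Definition stoch_grad (sigma : R) : Prop :=
  (forall i, measurable_fun setT
     (fun u : Xi * borel_rV R p => sgrad i u.1 u.2 : borel_rV R p)) /\
  forall k,
    cond_indep (Pr r) (before_sample r k) (fun i => sample i k) /\
    forall i,
      let x w := row i (run_point k w) in
      let g w := sgrad i (sample i k w) (x w) in
      cond_mean (Pr r) (before_sample r k) g (fun w => grad (f i) (x w)) /\
      cond_sqdist_le (Pr r) (before_sample r k) g
        (fun w => grad (f i) (x w)) (fun=> sigma ^+ 2).

(* The two conditions at the possibly random input u of the k-th compression
   performed by agent i. *)
Definition unbiased_at (C : R) (i : 'I_n) (k : nat)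
    (u : Omega r -> 'rV[R]_p) : Prop :=
  let Cu w := comp (seed i k w) (u w) in
  cond_mean (Pr r) (before_comp r k) Cu u /\
  cond_sqdist_le (Pr r) (before_comp r k) Cu u
    (fun w => C * frob (u w) ^+ 2).

Definition unbiased_compressor (C : R) : Prop :=
  measurable_fun setT
    (fun u : Z * borel_rV R p => comp u.1 u.2 : borel_rV R p) /\
  forall i k,
    (forall x : 'rV[R]_p, unbiased_at C i k (fun=> x)) /\
    unbiased_at C i k (fun w => row i (run_comp_input k w)).

(* 1/K sum_(t < K) E |grad f (xbar_t)|^2 *)
Definition avg_sq_grad (K : nat) : \bar R :=
  ((K%:R^-1)%:E * \sum_(t < K)
     'E_(Pr r)[fun w =>
       (frob (grad (avg_fun f) (avg_row (st_x (run_state t w)))) ^+ 2)%R])%E.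

End assumptions.

Definition cedas_eta (R : realType) (L sigma Delta0 gamma lam2 : R)
  (n K : nat) : R :=
  (Num.sqrt (L * sigma ^+ 2 * K%:R / (n%:R * Delta0))
   + 32 * L / (gamma * (1 - lam2)))^-1.

(* Here m k is the value of avg_sq_grad for the run with horizon k, and c is the
   constant hidden in the threshold O(1 / sqrt(n k)); the infimum is +oo if no K
   qualifies. *)
Definition transient_time (R : realType) (c : R) (n : nat) (m : nat -> \bar R) :
  \bar R :=
  ereal_inf [set (K%:R : R)%:E | K in [set K : nat | (0 < K)%N /\
    forall k, (K <= k)%N -> (m k <= (c / Num.sqrt (n * k)%:R)%:E)%E]].

(* Main.v *)
From mathcomp Require Import ring lra complex finmap.
Require Import Defs.

Set Implicit Arguments.
Unset Strict Implicit.
Unset Printing Implicit Defensive.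

Local Open Scope classical_set_scope.
Local Open Scope ring_scope.

(** The proof follows one potential along the run and sums its decrease.

    Let P be the averaging matrix, B = (I - W) / 2, M = gamma B and
    t = gamma (1 - lambda_2) / 2; on the vectors orthogonal to the ones, B has
    its spectrum between (1 - lambda_2) / 2 and 1/2 ([spectral_gap]).  As the
    columns of I - W sum to zero, P D_k = 0 throughout, so the average of the
    iterates makes a plain stochastic gradient step.  Smoothness then gives the
    descent of n f(xbar) in [avg_descent], with eta L^2 / 2 |x - P x|^2 as the
    only error besides the noise.

    The consensus error |x - P x|^2 is controlled by the function [lyapunov],
    |x - P x|^2 + <d, J d> / gamma + kappa |x - H|^2, where J inverts B
    orthogonally to the ones and d is the distance of D from the value
    - eta (I - P) grad F(P x) at which it cancels the heterogeneity of the
    gradients.  With v = (I - P) y_k one has x_{k+1} - P x_{k+1} = v - M v - M e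
    and d_{k+1} = d + M v + M e + O(eta) for the compression noise e; in the
    first two squares the cross terms in v and d combine to |v + d|^2, up to
    a negative multiple of |d|^2, and v + d is the old consensus error up to the
    gradient noise ([dual_step]).  The third square contracts because H tracks
    the compressed points ([tracking_step]); its decrease pays for the
    compression variance C |y - H|^2, which is what gamma C << alpha^2 (1 -
    lambda_2) is for.  In total the function loses t/10 |x - P x|^2 per step
    ([lyapunov_step]), and with the weight 5 eta L^2 / t this loss pays for the
    error of the descent ([potential_step]).

    All these inequalities hold pathwise, with explicit noise terms.  Those that
    are linear in the noise have a coefficient determined by the past, hence
    mean zero ([centred_pull_out]); the quadratic ones are bounded by n sigma^2,
    or by sigma^2 for the averaged noise, since samples that are conditionally
    independent have uncorrelated noises ([cond_indep_uncorrelated]).  The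
    inequalities are summed over the horizon and the expectation is taken once.

    Division by eta n K / 2 gives a bound ([avg_sq_grad_le]) that consists, for
    the prescribed stepsize, of a term of order 1 / sqrt(n K) and of terms of
    order at most n / (t K).  The latter are dominated as soon as
    K >= n^3 / t^2 ([rate_bound]), and 1 / t is a constant multiple of
    C (C + 1)^2 / (1 - lambda_2)^2. *)

(** * The Frobenius inner product *)

Definition dot (R : realType) (m n : nat) (A B : 'M[R]_(m, n)) : R :=
  \tr (A^T *m B).

Notation sq A := (dot A A).

(** Closes an identity between linear combinations of matrices. *)
Ltac mxring := apply/matrixP => ? ?; rewrite !mxE; ring.

Section dot_theory.
Context (R : realType).

Lemma dotE m n (A B : 'M[R]_(m, n)) :
  dot A B = \sum_i \sum_j A i j * B i j.
Proof.
rewrite /dot /mxtrace exchange_big /=; apply: eq_bigr => j _.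
by rewrite mxE; apply: eq_bigr => i _; rewrite !mxE.
Qed.

Section fixed_size.
Context (m n : nat).
Implicit Types (A B D : 'M[R]_(m, n)) (a : R).

Lemma dotC A B : dot A B = dot B A.
Proof. by rewrite /dot -mxtrace_tr trmx_mul trmxK. Qed.

Lemma dotDr A B D : dot A (B + D) = dot A B + dot A D.
Proof. by rewrite /dot mulmxDr raddfD. Qed.

Lemma dotDl A B D : dot (A + B) D = dot A D + dot B D.
Proof. by rewrite dotC dotDr !(dotC D). Qed.

Lemma dotZr a A B : dot A (a *: B) = a * dot A B.
Proof. by rewrite /dot -scalemxAr mxtraceZ. Qed.

Lemma dotZl a A B : dot (a *: A) B = a * dot A B.
Proof. by rewrite dotC dotZr dotC. Qed.

Lemma dotNr A B : dot A (- B) = - dot A B.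
Proof. by rewrite -scaleN1r dotZr mulN1r. Qed.

Lemma dotNl A B : dot (- A) B = - dot A B.
Proof. by rewrite dotC dotNr dotC. Qed.

Lemma dot0r A : dot A 0 = 0.
Proof. by rewrite -(scale0r 0) dotZr mul0r. Qed.

Definition dotlin := (dotDl, dotDr, dotNl, dotNr, dotZl, dotZr).

Lemma sq_ge0 A : 0 <= sq A.
Proof.
by rewrite dotE; apply: sumr_ge0 => i _; apply: sumr_ge0 => j _; rewrite -expr2 sqr_ge0.
Qed.

Lemma frob_sqr A : frob A ^+ 2 = sq A.
Proof.
rewrite /frob sqr_sqrtr; last by do 2!apply: sumr_ge0 => ? _; exact: sqr_ge0.
by rewrite dotE; do 2!apply: eq_bigr => ? _; rewrite expr2.
Qed.

Lemma frob_ge0 A : 0 <= frob A.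
Proof. exact: sqrtr_ge0. Qed.

Lemma sqN A : sq (- A) = sq A.
Proof. by rewrite !dotlin opprK. Qed.

Lemma sqZ a A : sq (a *: A) = a ^+ 2 * sq A.
Proof. by rewrite !dotlin mulrA expr2. Qed.

Lemma sqD A B : sq (A + B) = sq A + 2 * dot A B + sq B.
Proof. by rewrite !dotlin (dotC B A); ring. Qed.

Lemma sqB A B : sq (A - B) = sq A - 2 * dot A B + sq B.
Proof. by rewrite !dotlin (dotC B A); ring. Qed.

Lemma young a A B : 0 < a -> 2 * dot A B <= a * sq A + a^-1 * sq B.
Proof.
move=> a0; have := sq_ge0 (a *: A - B).
rewrite sqB sqZ dotZl => /(mulr_ge0 (ltW (eqbRL (invr_gt0 a) a0))).
have -> : a^-1 * (a ^+ 2 * sq A - 2 * (a * dot A B) + sq B) =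
  a * sq A - 2 * dot A B + a^-1 * sq B by field; exact: lt0r_neq0.
lra.
Qed.

Lemma sqD_le a A B : 0 < a -> sq (A + B) <= (1 + a) * sq A + (1 + a^-1) * sq B.
Proof. by move=> a0; have := young A B a0; rewrite sqD; lra. Qed.

Lemma sqD2_le A B : sq (A + B) <= 2 * sq A + 2 * sq B.
Proof. by have := @sqD_le 1 A B ltr01; rewrite invr1; lra. Qed.

Lemma sqB2_le A B : sq (A - B) <= 2 * sq A + 2 * sq B.
Proof. by have := sqD2_le A (- B); rewrite sqN. Qed.

Lemma sqD3_le A B D : sq (A + B + D) <= 3 * sq A + 3 * sq B + 3 * sq D.
Proof.
have := @sqD_le (2^-1) (A + B) D ltac:(lra); rewrite invrK.
have := sqD2_le A B; lra.
Qed.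

(** Cauchy-Schwarz, in the form in which it bounds the solution A of a coercive
    linear system with right-hand side B. *)
Lemma sq_le_of_dot a A B : 0 < a -> a * sq A <= dot B A -> a ^+ 2 * sq A <= sq B.
Proof.
move=> a0; have := sq_ge0 (a *: A - B); rewrite sqB sqZ dotZl (dotC A B) => h1 h2.
have := ler_wpM2l (ltW a0) h2; rewrite expr2 in h1 *; lra.
Qed.

End fixed_size.

Lemma dot_mulmxl m n p (M : 'M[R]_(m, n)) (A : 'M[R]_(n, p)) B :
  dot (M *m A) B = dot A (M^T *m B).
Proof. by rewrite /dot trmx_mul mulmxA. Qed.

Lemma dot_sym_expand3 n p (J : 'M[R]_n) (A1 A2 A3 : 'M[R]_(n, p)) : J^T = J ->
  dot (A1 + A2 + A3) (J *m (A1 + A2 + A3)) =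
  dot A1 (J *m A1) + dot A2 (J *m A2) + dot A3 (J *m A3) +
  2 * dot A1 (J *m A2) + 2 * dot A1 (J *m A3) + 2 * dot A3 (J *m A2).
Proof.
move=> J_sym; have Jsym A B : dot (J *m A) B = dot A (J *m B).
  by rewrite dot_mulmxl J_sym.
rewrite !mulmxDr !dotDl !dotDr (dotC A2 (J *m A1)) (dotC A3 (J *m A1)).
by rewrite (dotC A2 (J *m A3)) !Jsym; ring.
Qed.

Lemma dot_row m n (A B : 'M[R]_(m, n)) :
  dot A B = \sum_i dot (row i A) (row i B).
Proof.
rewrite dotE; apply: eq_bigr => i _; rewrite dotE big_ord1.
by apply: eq_bigr => j _; rewrite !mxE.
Qed.

Lemma dot_col m n (A B : 'M[R]_(m, n)) :
  dot A B = \sum_j dot (col j A) (col j B).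
Proof.
rewrite dotE exchange_big; apply: eq_bigr => i _; rewrite dotE.
by apply: eq_bigr => j _; rewrite big_ord1 !mxE.
Qed.

End dot_theory.

(** * Descent of the consensus error *)

(** What the analysis uses of the averaging matrix P and of B = (I - W) / 2.
    The matrix J inverts B on the kernel of P and is the identity on the range
    of P; mu is half the spectral gap. *)
Record mixing (R : realType) (n : nat) (P B J : 'M[R]_n) (mu : R) : Prop := Mixing {
  mix_mu_gt0 : 0 < mu;
  mix_mu_le : mu <= 2^-1;
  mix_P_sym : P^T = P;
  mix_P_idem : P *m P = P;
  mix_B_sym : B^T = B;
  mix_BP : B *m P = 0;
  mix_J_sym : J^T = J;
  mix_JB : J *m B = 1%:M - P;
  mix_JP : J *m P = P;
  mix_B_low : forall p (A : 'M[R]_(n, p)), P *m A = 0 -> mu * sq A <= dot A (B *m A);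
  mix_B_upp : forall p (A : 'M[R]_(n, p)), dot A (B *m A) <= 2^-1 * sq A }.

Section consensus.
Context (R : realType) (n p : nat).
Variables (P B J : 'M[R]_n) (mu : R).
Hypothesis mix : mixing P B J mu.
Implicit Types A d v e x : 'M[R]_(n, p).

Let mu_gt0 : 0 < mu. Proof. by case: mix. Qed.
Let mu_le : mu <= 2^-1. Proof. by case: mix. Qed.
Let P_sym : P^T = P. Proof. by case: mix. Qed.
Let P_idem : P *m P = P. Proof. by case: mix. Qed.
Let B_sym : B^T = B. Proof. by case: mix. Qed.
Let BP : B *m P = 0. Proof. by case: mix. Qed.
Let J_sym : J^T = J. Proof. by case: mix. Qed.
Let JB : J *m B = 1%:M - P. Proof. by case: mix. Qed.
Let B_low A : P *m A = 0 -> mu * sq A <= dot A (B *m A).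
Proof. exact: (mix_B_low mix). Qed.
Let B_upp A : dot A (B *m A) <= 2^-1 * sq A.
Proof. exact: (mix_B_upp mix). Qed.

Lemma mulP_perp A : (1%:M - P) *m A = A - P *m A.
Proof. by rewrite mulmxBl mul1mx. Qed.

Lemma perpP A : P *m (A - P *m A) = 0.
Proof. by rewrite mulmxBr mulmxA P_idem subrr. Qed.

Lemma sq_perp A : sq (A - P *m A) <= sq A.
Proof.
have := sq_ge0 (P *m A); rewrite sqB.
by rewrite dot_mulmxl P_sym mulmxA P_idem; lra.
Qed.

Lemma sq_proj A : sq (P *m A) <= sq A.
Proof.
have := sq_ge0 (A - P *m A); rewrite sqB.
by rewrite (dotC A) [dot (P *m A) A]dot_mulmxl [dot (P *m A) _]dot_mulmxl P_sym mulmxA P_idem; lra.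
Qed.

Lemma mulB_perp A : B *m (A - P *m A) = B *m A.
Proof. by rewrite mulmxBr mulmxA BP mul0mx subr0. Qed.

Lemma PB : P *m B = 0.
Proof. by rewrite -[P *m B]trmxK trmx_mul P_sym B_sym BP trmx0. Qed.

Lemma dot_B A1 A2 : dot (B *m A1) A2 = dot A1 (B *m A2).
Proof. by rewrite dot_mulmxl B_sym. Qed.

Lemma B_ge0 A : 0 <= dot A (B *m A).
Proof.
have -> : dot A (B *m A) = dot (A - P *m A) (B *m (A - P *m A)).
  rewrite mulB_perp [RHS]dotDl dotNl (dotC (P *m A)) dot_B.
  by rewrite mulmxA BP mul0mx dot0r subr0.
by apply: le_trans (B_low (perpP A)); rewrite mulr_ge0 ?sq_ge0 // ltW.
Qed.

(** The form of B is nonnegative at A - 2 B A; expand it and bound the cubic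
    term with B <= 1/2. *)
Lemma B_high A : sq (B *m A) <= 2^-1 * dot A (B *m A).
Proof.
have := B_ge0 (A - 2 *: (B *m A)); have := B_upp (B *m A).
rewrite mulmxBr -scalemxAr !dotlin !dot_B.
by rewrite (dotC A (B *m (B *m A))) !dot_B; lra.
Qed.

Lemma J_solves A : P *m A = 0 ->
  P *m (J *m A) = 0 /\ B *m (J *m A) = A.
Proof.
move=> PA; split.
  rewrite mulmxA -[P *m J]trmxK trmx_mul P_sym J_sym (mix_JP mix) P_sym.
  exact: PA.
rewrite mulmxA -[B *m J]trmxK trmx_mul B_sym J_sym JB linearB /= trmx1 P_sym.
by rewrite mulP_perp PA subr0.
Qed.

Lemma J_sq A : P *m A = 0 -> sq (J *m A) <= mu ^- 2 * sq A.
Proof.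
move=> PA; have [PJ BJ] := J_solves PA.
have := B_low PJ; rewrite BJ dotC => /(sq_le_of_dot mu_gt0).
by rewrite mulrC -ler_pdivlMr ?exprn_gt0 // [_ / _]mulrC.
Qed.

Lemma J_upp A : P *m A = 0 -> dot A (J *m A) <= mu^-1 * sq A.
Proof.
move=> PA; have [PJ BJ] := J_solves PA.
have := B_low PJ; rewrite BJ dotC.
have mV : 0 < mu^-1 by rewrite invr_gt0.
have := young A (J *m A) mV; rewrite invrK; lra.
Qed.

Variables (gamma : R).
Hypotheses (gamma_gt0 : 0 < gamma) (gamma_le : gamma <= 2^-1).

Let M := gamma *: B.
Let t := gamma * mu.
Let Q d := gamma^-1 * dot d (J *m d).

(** Here v is the consensus part of y_k, d the deviation of the dual variable
    from its ideal value, eta dl the drift of that value and e the compression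
    noise.  Since J B = I - P, the form of J expands to 2 <d, v> + <v, M v>,
    while the square of v - M v gives sq v - 2 <v, M v>.  The sum is
    sq (v + d) - sq d - <v, M v> up to higher order, and <v, M v> >= t sq v by
    the spectral gap.  The drift is multiplied by J, whence the factor
    (eta / t)^2. *)
Lemma dual_step d v e dl eta : P *m d = 0 -> P *m v = 0 -> P *m dl = 0 ->
  sq (v - M *m v - M *m e) + Q (d + M *m v + M *m e + eta *: dl) <=
  Q d + (1 - t / 4) * sq (v + d) - 5 / 8 * sq d - t / 3 * sq v
  + 12 * (eta / t) ^+ 2 * sq dl + 5 / 8 * gamma * sq e
  + 2 * dot (d + M *m v + eta *: dl - M *m (v - M *m v)) e.
Proof.
move=> Pd Pv Pdl.
have gn0 : gamma != 0 by exact: lt0r_neq0.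
have mn0 : mu != 0 by exact: lt0r_neq0.
have t0 : 0 < t by exact: mulr_gt0.
have t4 : t <= 4^-1.
  by have := ler_pM (ltW gamma_gt0) (ltW mu_gt0) gamma_le mu_le; rewrite /t; lra.
have tn0 : t != 0 by exact: lt0r_neq0.
have M_sym A1 A2 : dot (M *m A1) A2 = dot A1 (M *m A2).
  by rewrite dot_mulmxl linearZ /= B_sym.
have JM A : P *m A = 0 -> J *m (M *m A) = gamma *: A.
  by move=> PA; rewrite -scalemxAl -scalemxAr mulmxA JB mulP_perp PA subr0.
have JMe A1 A2 : P *m A1 = 0 -> dot A1 (J *m (M *m A2)) = gamma * dot A1 A2.
  move=> PA; rewrite -scalemxAl -scalemxAr mulmxA JB mulP_perp dotZr.
  by rewrite dotDr dotNr (dotC A1 (P *m A2)) dot_mulmxl P_sym PA dot0r subr0.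
have Jsym A1 A2 : dot (J *m A1) A2 = dot A1 (J *m A2).
  by rewrite dot_mulmxl J_sym.
have PM A : P *m (M *m A) = 0.
  by rewrite -scalemxAl -scalemxAr mulmxA PB mul0mx scaler0.
pose r := d + M *m v + eta *: dl.
have Pr : P *m r = 0 by rewrite /r !mulmxDr Pd PM -scalemxAr Pdl scaler0 !addr0.
have -> : d + M *m v + M *m e + eta *: dl = r + M *m e by rewrite /r addrAC.
have Qr A : P *m A = 0 -> Q (A + M *m e) = Q A + 2 * dot A e + dot e (M *m e).
  move=> PA; rewrite /Q mulmxDr !dotDl !dotDr (dotC (M *m e) (J *m A)) Jsym !JMe //.
  by rewrite (dotC (M *m e) e); field.
have Qr' : Q r = Q d + 2 * dot d v + dot v (M *m v) +
   2 * eta / gamma * dot d (J *m dl) + 2 * eta * dot v dl + eta ^+ 2 * Q dl.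
  rewrite /Q /r dot_sym_expand3 // !JMe // -?scalemxAr ?Pdl ?scaler0 // !dotZl !dotZr.
  by rewrite (dotC (M *m v) v) (dotC dl v); field.
have sv : sq (v - M *m v - M *m e) = sq v - 2 * dot v (M *m v) + sq (M *m v)
   - 2 * dot (M *m (v - M *m v)) e + sq (M *m e).
  by rewrite sqB sqB -(M_sym _ e); ring.
rewrite Qr // sv Qr' -/r [dot (r - _) e]dotDl [dot (- _) e]dotNl.
have h1 : 2 * eta / gamma * dot d (J *m dl) <=
    8^-1 * sq d + 8 * (eta / t) ^+ 2 * sq dl.
  have := @young R n p 8^-1 d ((eta / gamma) *: (J *m dl)) ltac:(lra).
  rewrite sqZ dotZr invrK.
  have := ler_wpM2l (sqr_ge0 (eta / gamma)) (J_sq Pdl).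
  rewrite (_ : (eta / gamma) ^+ 2 * (mu ^- 2 * sq dl) = (eta / t) ^+ 2 * sq dl); last first.
    by rewrite /t; field; rewrite gn0 mn0.
  lra.
have h2 : 2 * eta * dot v dl <= t / 12 * sq v + 12 / t * eta ^+ 2 * sq dl.
  have := @young R n p (t / 12) v (eta *: dl) ltac:(lra).
  by rewrite sqZ dotZr invf_div; lra.
have h3 : eta ^+ 2 * Q dl <= t^-1 * eta ^+ 2 * sq dl.
  rewrite (_ : t^-1 * eta ^+ 2 * sq dl = eta ^+ 2 * (gamma^-1 * (mu^-1 * sq dl))).
    apply: ler_wpM2l; first exact: sqr_ge0.
    by apply: ler_wpM2l; [rewrite invr_ge0 ltW | exact: J_upp].
  by rewrite /t; field; rewrite gn0 mn0.
have h4 : t^-1 * eta ^+ 2 * sq dl <= 4^-1 * (eta / t) ^+ 2 * sq dl.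
  apply: ler_wpM2r; first exact: sq_ge0.
  have -> : t^-1 * eta ^+ 2 = t * (eta / t) ^+ 2 by field.
  by apply: ler_wpM2r => //; exact: sqr_ge0.
have h5 : sq (M *m v) <= 4^-1 * dot v (M *m v).
  have dv0 : 0 <= dot v (B *m v).
    by apply: le_trans (B_low Pv); exact: mulr_ge0 (ltW mu_gt0) (sq_ge0 _).
  rewrite /M -!scalemxAl sqZ dotZr.
  have := ler_wpM2l (sqr_ge0 gamma) (B_high v).
  have : gamma * (gamma * dot v (B *m v)) <= 2^-1 * (gamma * dot v (B *m v)).
    by apply: ler_wpM2r => //; exact: mulr_ge0 (ltW gamma_gt0) dv0.
  rewrite expr2; lra.
have h6 : t * sq v <= dot v (M *m v).
  rewrite /M -!scalemxAl dotZr /t -mulrA; apply: ler_wpM2l; first exact: ltW.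
  exact: B_low.
have h7 : sq (M *m e) <= gamma / 8 * sq e.
  rewrite /M -!scalemxAl sqZ.
  have := le_trans (B_high e) (ler_wpM2l (ltac:(lra) : 0 <= 2^-1 :> R) (B_upp e)).
  move=> /(ler_wpM2l (sqr_ge0 gamma)).
  have := ler_wpM2r (mulr_ge0 (ltW gamma_gt0) (sq_ge0 e)) gamma_le.
  rewrite expr2; lra.
have h8 : dot e (M *m e) <= gamma / 2 * sq e.
  rewrite /M -!scalemxAl dotZr -mulrA; apply: ler_wpM2l; first exact: ltW.
  exact: B_upp.
have h9 : sq (v + d) <= 4 / 3 * sq v + 4 * sq d.
  have := @sqD_le R n p 3^-1 v d ltac:(lra); rewrite invrK; lra.
have h10 := ler_wpM2l (ltW t0) h9.
have h11 : t * sq d <= 4^-1 * sq d by apply: ler_wpM2r => //; exact: sq_ge0.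
have h12 := sqD v d.
have h13 : 12 / t * eta ^+ 2 * sq dl = 12 * (t^-1 * eta ^+ 2 * sq dl) by ring.
have h14 : dot v d = dot d v by rewrite dotC.
have h15 : 0 <= (eta / t) ^+ 2 * sq dl by exact: mulr_ge0 (sqr_ge0 _) (sq_ge0 _).
move: (dot v (M *m v)) h5 h6 h8 => vMv h5 h6 h8.
lra.
Qed.

Lemma sq_mulM A : sq (M *m A) <= gamma ^+ 2 / 4 * sq A.
Proof.
rewrite -scalemxAl sqZ -mulrA; apply: ler_wpM2l; first exact: sqr_ge0.
by have := B_high A; have := B_upp A; lra.
Qed.

Lemma dot_mulM A1 A2 : dot (M *m A1) A2 = dot A1 (M *m A2).
Proof. by rewrite dot_mulmxl linearZ /= B_sym. Qed.

(** The input h = y_k - H_k of the compression differs from the tracking error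
    tau = x_k - H_k by the displacement rho = x_k - y_k.  Moving H_k by alpha h
    contracts h by 1 - alpha; half of the gain absorbs the displacement, and the
    noise enters with the small factor alpha^2. *)
Lemma tracking_step alpha h v e tau rho :
  0 < alpha -> alpha <= 4^-1 -> gamma <= alpha / 2 -> h = tau - rho ->
  sq ((1 - alpha) *: h - M *m v - (alpha *: e + M *m e)) <=
  sq tau - alpha / 2 * sq h + 2 / alpha * sq rho + 5 / 32 * gamma * sq v
  + 25 / 16 * alpha ^+ 2 * sq e
  - 2 * dot (alpha *: ((1 - alpha) *: h - M *m v) +
             M *m ((1 - alpha) *: h - M *m v)) e.
Proof.
move=> a0 a4 ga hE; set a := (1 - alpha) *: h - M *m v.
have an0 : alpha != 0 by exact: lt0r_neq0.
have dE A : dot A (alpha *: e + M *m e) = dot (alpha *: A + M *m A) e.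
  by rewrite dotDl dot_mulM dotZl dotDr dotZr.
rewrite sqB dE.
have h1 : sq (alpha *: e + M *m e) <= 25 / 16 * alpha ^+ 2 * sq e.
  rewrite sqD sqZ dotZl.
  have e1 : dot e (M *m e) <= alpha / 4 * sq e.
    rewrite -scalemxAl dotZr.
    have := ler_wpM2l (ltW gamma_gt0) (B_upp e).
    have := ler_wpM2r (sq_ge0 e) ga; lra.
  have := ler_wpM2l (ltW a0) e1.
  have e2 : gamma ^+ 2 / 4 * sq e <= alpha ^+ 2 / 16 * sq e.
    apply: ler_wpM2r; first exact: sq_ge0.
    have := ler_pM (ltW gamma_gt0) (ltW gamma_gt0) ga ga.
    by rewrite -!expr2 expr_div_n; lra.
  have := sq_mulM e; rewrite expr2 in e2 *; lra.
have h2 : sq a <= (1 - alpha) * sq h + 5 / 32 * gamma * sq v.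
  have := @sqD_le R n p alpha ((1 - alpha) *: h) (- (M *m v)) a0.
  rewrite sqN sqZ -/a => /le_trans; apply; apply: lerD.
    rewrite mulrA; apply: ler_wpM2r; first exact: sq_ge0.
    have := mulr_ge0 (sqr_ge0 alpha) (ltac:(lra) : 0 <= 1 - alpha :> R).
    rewrite expr2; lra.
  have e1 : (1 + alpha^-1) <= 5 / (4 * alpha).
    rewrite ler_pdivlMr; last by lra.
    by rewrite (_ : (1 + alpha^-1) * (4 * alpha) = 4 * alpha + 4); [lra | field].
  have e0 : 0 <= 1 + alpha^-1 by rewrite addr_ge0 // invr_ge0 ltW.
  have := ler_pM e0
     (sq_ge0 (M *m v)) e1 (sq_mulM v).
  move=> /le_trans; apply; rewrite mulrA; apply: ler_wpM2r; first exact: sq_ge0.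
  have -> : 5 / (4 * alpha) * (gamma ^+ 2 / 4) =
     (5 / 16 * gamma) * (gamma / alpha) by field.
  have : gamma / alpha <= 2^-1 by rewrite ler_pdivrMr //; lra.
  have e2 : 0 <= 5 / 16 * gamma by apply: mulr_ge0 (ltW gamma_gt0); lra.
  by move=> /(ler_wpM2l e2); lra.
have h3 : (1 - alpha / 2) * sq h <= sq tau + 2 / alpha * sq rho.
  have := @sqD_le R n p (alpha / 2) tau (- rho) ltac:(lra).
  rewrite sqN -hE invf_div.
  have e2 : 0 <= 1 - alpha / 2 by lra.
  move=> /(ler_wpM2l e2) /le_trans; apply.
  rewrite mulrDr; apply: lerD; rewrite mulrA.
    rewrite -[leRHS]mul1r; apply: ler_wpM2r; first exact: sq_ge0.
    have := sqr_ge0 alpha; rewrite expr2; lra.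
  apply: ler_wpM2r; first exact: sq_ge0.
  rewrite (_ : (1 - alpha / 2) * (1 + 2 / alpha) = 2 / alpha - alpha / 2); [lra | by field].
lra.
Qed.

(** The dual error is measured in the metric of J / gamma because its cross
    terms then cancel those of the consensus error. *)
Definition lyapunov (kappa eta : R) (x D H gP : 'M[R]_(n, p)) : R :=
  sq (x - P *m x) + Q (D + eta *: (gP - P *m gP)) + kappa * sq (x - H).

Section step.
Variables (alpha C kappa L eta : R).
Hypotheses (alpha_gt0 : 0 < alpha) (alpha_le : alpha <= 4^-1)
  (gamma_alpha : gamma <= alpha / 2) (C_gt0 : 0 < C) (alphaC : alpha * C <= 4^-1)
  (gammaC : gamma * C <= alpha ^+ 2 * mu / 300)
  (kappaE : kappa = 6 * gamma * C / alpha)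
  (L_gt0 : 0 < L) (eta_gt0 : 0 < eta) (eta_le : eta * L <= t / 16).
Variables (x D H g S e gP gP' : 'M[R]_(n, p)).

Let y := x - eta *: (g + S) - D.
Let h := y - H.
Let v := y - P *m y.

(** The coefficient of the compression noise involves the gradient noise S of the
    same step, which is known when the compression takes place;
    [grad_noise_coef] depends on the iterates alone. *)
Definition comp_noise_coef : 'M[R]_(n, p) :=
  2 *: (D + eta *: (gP - P *m gP) + M *m v +
        eta *: ((gP' - gP) - P *m (gP' - gP)) - M *m (v - M *m v))
  - (2 * kappa) *: (alpha *: ((1 - alpha) *: h - M *m v) +
                   M *m ((1 - alpha) *: h - M *m v)).

Definition grad_noise_coef : 'M[R]_(n, p) :=
  - (2 * eta * (1 - t / 4)) *:
  ((x - P *m x) - eta *: ((g - gP) - P *m (g - gP))).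

(** The matrices gP and gP' stand for the gradients at P x_k and P x_{k+1}, which
    differ little because the average moves by eta P (g + S) only.  The weight
    kappa is such that its gain of order alpha dominates C times the coefficient
    of sq e; the condition on gamma C then makes kappa so small that the terms
    in rho and v produced by the tracking are absorbed by [dual_step]. *)
Lemma lyapunov_step : P *m D = 0 ->
  sq (g - gP) <= L ^+ 2 * sq (x - P *m x) ->
  sq (gP' - gP) <= L ^+ 2 * (eta ^+ 2 * sq (P *m (g + S))) ->
  lyapunov kappa eta (y - M *m (y + e)) (D + M *m (y + e)) (H + alpha *: (h + e)) gP'
  <= lyapunov kappa eta x D H gP - t / 10 * sq (x - P *m x)
   + 2 * eta ^+ 2 * sq S + eta ^+ 2 / 10 * sq (P *m (g + S))
   + (5 / 8 * gamma + 25 / 16 * kappa * alpha ^+ 2) * (sq e - C * sq h)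
   + dot comp_noise_coef e + dot grad_noise_coef S.
Proof.
move=> PD lipg lipP.
have t0 : 0 < t by exact: mulr_gt0.
have t4 : t <= 4^-1.
  by have := ler_pM (ltW gamma_gt0) (ltW mu_gt0) gamma_le mu_le; rewrite /t; lra.
have t16 : t / 16 <= 1 by lra.
have tn0 : t != 0 by exact: lt0r_neq0.
have an0 : alpha != 0 by exact: lt0r_neq0.
set u := x - P *m x.
set eps := (g - gP) - P *m (g - gP).
set d := D + eta *: (gP - P *m gP).
set dl := (gP' - gP) - P *m (gP' - gP).
set s := S - P *m S.
have Pd : P *m d = 0 by rewrite mulmxDr PD -scalemxAr perpP scaler0 addr0.
have Pv : P *m v = 0 by exact: perpP.
have Pdl : P *m dl = 0 by exact: perpP.
have My : M *m y = M *m v.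
  have -> : M *m v = M *m y - M *m (P *m y) by rewrite -mulmxBr.
  have MP : M *m P = 0 by rewrite /M -scalemxAl BP scaler0.
  by rewrite [M *m (P *m y)]mulmxA MP mul0mx subr0.
have PM A : P *m (M *m A) = 0.
  by rewrite -scalemxAl -scalemxAr mulmxA PB mul0mx scaler0.
have vd : v + d = u - eta *: eps - eta *: s.
  rewrite /v /y /d /u /eps /s !(mulmxBr, mulmxDr, PD) -?scalemxAr ?mulmxDr.
  move: (P *m x) (P *m g) (P *m S) (P *m gP) => a1 a2 a3 a4; mxring.
(* The arguments of the three parts of the new Lyapunov function. *)
have E1 : (y - M *m (y + e)) - P *m (y - M *m (y + e)) = v - M *m v - M *m e.
  rewrite [P *m (_ - M *m _)]mulmxBr PM subr0 [M *m (y + e)]mulmxDr My .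
  by rewrite /v; move: (M *m (y - P *m y)) (P *m y) (M *m e) y => a1 a2 a3 a4; mxring.
have E2 : D + M *m (y + e) + eta *: (gP' - P *m gP') =
    d + M *m v + M *m e + eta *: dl.
  rewrite [M *m (y + e)]mulmxDr My /d /dl [P *m (gP' - gP)]mulmxBr.
  by move: (P *m gP') (P *m gP) (M *m v) (M *m e) => a1 a2 a3 a4; mxring.
have E3 : (y - M *m (y + e)) - (H + alpha *: (h + e)) =
    (1 - alpha) *: h - M *m v - (alpha *: e + M *m e).
  rewrite [M *m (y + e)]mulmxDr My /h.
  by move: (M *m v) (M *m e) y => a1 a2 a3; mxring.
have hE : h = (x - H) - (D + eta *: (g + S)).
  by rewrite /h /y; mxring.
have := dual_step e eta Pd Pv Pdl.
have := @tracking_step alpha h v e _ _ alpha_gt0 alpha_le gamma_alpha hE.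
rewrite /lyapunov E1 E2 E3 /comp_noise_coef -/d -/dl -/v -/h -/u.
rewrite [dot (2 *: _ - _) e]dotDl [dot (- _) e]dotNl !(dotZl _ _ e).
set ylin1 := dot (d + M *m v + eta *: dl - M *m (v - M *m v)) e.
set ylin2 := dot (alpha *: ((1 - alpha) *: h - M *m v) +
                  M *m ((1 - alpha) *: h - M *m v)) e.
rewrite /grad_noise_coef -/u -/eps dotZl vd.
set rho := D + eta *: (g + S).
have epsP : P *m eps = 0 by exact: perpP.
have uP : P *m u = 0 by exact: perpP.
have slin : dot (u - eta *: eps) s = dot (u - eta *: eps) S.
  rewrite [LHS]dotDr dotNr (dotC _ (P *m S)) dot_mulmxl P_sym mulmxBr uP.
  by rewrite -scalemxAr epsP scaler0 subr0 dot0r subr0.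
have -> : sq (u - eta *: eps - eta *: s) = sq (u - eta *: eps)
   - 2 * eta * dot (u - eta *: eps) S + eta ^+ 2 * sq s.
  by rewrite sqB dotZr slin sqZ; ring.
have ss := sq_perp S; rewrite -/s in ss.
have seps : sq eps <= L ^+ 2 * sq u by apply: le_trans (sq_perp _) lipg.
have eL : eta ^+ 2 * L ^+ 2 <= (t / 16) ^+ 2.
  have := ler_pM _ _ eta_le eta_le; rewrite -!expr2 exprMn.
  by apply; exact: mulr_ge0 (ltW eta_gt0) (ltW L_gt0).
have seps2 : eta ^+ 2 * sq eps <= (t / 16) ^+ 2 * sq u.
  apply: le_trans (ler_wpM2l (sqr_ge0 eta) seps) _.
  by rewrite mulrA; apply: ler_wpM2r => //; exact: sq_ge0.
have su : sq (u - eta *: eps) <= (1 + t / 16) ^+ 2 * sq u.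
  have := @sqD_le R n p (t / 16) u (- (eta *: eps)) ltac:(lra).
  rewrite sqN sqZ invf_div => /le_trans; apply.
  have e0 : 0 <= 1 + 16 / t by rewrite addr_ge0 // divr_ge0 // ltW.
  have := ler_wpM2l e0 seps2.
  have -> : (1 + 16 / t) * ((t / 16) ^+ 2 * sq u) = (t / 16 + (t / 16) ^+ 2) * sq u.
    by field.
  rewrite sqrrD; move: (t / 16) (sq u) => a b; lra.
have su2 : (1 - t / 4) * sq (u - eta *: eps) <= (1 - t / 8) * sq u.
  have e2 : 0 <= 1 - t / 4 by lra.
  apply: le_trans (ler_wpM2l e2 su) _.
  rewrite mulrA; apply: ler_wpM2r; first exact: sq_ge0.
  have t3 : 0 <= t ^+ 2 * t by exact: mulr_ge0 (sqr_ge0 _) (ltW t0).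
  move: t3 (sqr_ge0 t) (ltW t0); move: (t) => a h1 h2 h3; lra.
have sdl : 12 * (eta / t) ^+ 2 * sq dl <= 3 / 64 * (eta ^+ 2 * sq (P *m (g + S))).
  have w0 : 0 <= eta ^+ 2 * sq (P *m (g + S)) by exact: mulr_ge0 (sqr_ge0 _) (sq_ge0 _).
  have q0 : 0 <= 12 * (eta / t) ^+ 2 by rewrite mulr_ge0 ?sqr_ge0.
  apply: le_trans (ler_wpM2l q0 (le_trans (sq_perp _) lipP)) _.
  have q1 : 0 <= 12 / t ^+ 2 by rewrite divr_ge0 ?sqr_ge0.
  have q2 := ler_wpM2r w0 (ler_wpM2l q1 eL).
  rewrite (_ : 12 / t ^+ 2 * (t / 16) ^+ 2 = 3 / 64) in q2; last by field.
  rewrite (_ : _ * (L ^+ 2 * _) = 12 / t ^+ 2 * (eta ^+ 2 * L ^+ 2) *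
    (eta ^+ 2 * sq (P *m (g + S)))) //.
  by move: (eta ^+ 2 * sq (P *m (g + S))) => w; field.
(* The average of rho is eta times that of g + S and is orthogonal to the rest,
   which consists of d and of the consensus parts of the gradient errors. *)
have srho : sq rho <= 3 * sq d + 3 * (eta ^+ 2 * sq eps) + 3 * (eta ^+ 2 * sq S)
    + eta ^+ 2 * sq (P *m (g + S)).
  have -> : rho = (d + eta *: eps + eta *: s) + eta *: (P *m (g + S)).
    rewrite /rho /d /eps /s !mulmxBr mulmxDr.
    by move: (P *m gP) (P *m g) (P *m S) => a1 a2 a3; mxring.
  have PA : P *m (d + eta *: eps + eta *: s) = 0.
    by rewrite (mulmxDr P (d + _)) (mulmxDr P d) Pd -!scalemxAr epsP perpP !scaler0 !addr0.
  have := sqD3_le d (eta *: eps) (eta *: s).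
  move: (d + eta *: eps + eta *: s) PA => A PA.
  rewrite sqD (dotZr eta A) (dotC A (P *m _)) dot_mulmxl P_sym PA dot0r !mulr0 addr0 !sqZ.
  have := ler_wpM2l (sqr_ge0 eta) ss; lra.
have k0 : 0 < kappa by rewrite kappaE divr_gt0 // !mulr_gt0.
have kE : kappa <= alpha * mu / 50.
  rewrite kappaE ler_pdivrMr // -mulrA.
  apply: le_trans (ler_wpM2l (_ : 0 <= 6) gammaC) _ => //.
  by rewrite (_ : 6 * (alpha ^+ 2 * mu / 300) = alpha * mu / 50 * alpha) //; field.
have kr : kappa * (2 / alpha * sq rho) <= 1 / 50 * sq rho.
  rewrite mulrA; apply: ler_wpM2r; first exact: sq_ge0.
  rewrite mulrA ler_pdivrMr //; have := ler_wpM2l (ltW alpha_gt0) mu_le.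
  move: kE; move: (kappa) => k h1 h2; lra.
have kv : kappa * (5 / 32 * gamma * sq v) <= t / 3 * sq v.
  rewrite mulrA; apply: ler_wpM2r; first exact: sq_ge0.
  have := ler_wpM2r (ltW gamma_gt0) kE; have := ler_wpM2r (ltW t0) alpha_le.
  rewrite (_ : alpha * mu / 50 * gamma = alpha * t / 50); last by rewrite /t; field.
  rewrite (_ : kappa * (5 / 32 * gamma) = 5 / 32 * (kappa * gamma)); last by ring.
  move: (ltW t0); move: (t) (kappa * gamma) => a b; lra.
have wC : (5 / 8 * gamma + 25 / 16 * kappa * alpha ^+ 2) * C * sq h <=
    kappa * (alpha / 2 * sq h).
  rewrite [leRHS]mulrA; apply: ler_wpM2r; first exact: sq_ge0.
  have -> : (5 / 8 * gamma + 25 / 16 * kappa * alpha ^+ 2) * C =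
    kappa * alpha * (5 / 48 + 25 / 16 * (alpha * C)).
    by rewrite kappaE; field.
  rewrite -[leLHS]mulrA.
  apply: ler_wpM2l; first exact: ltW.
  apply: ler_wpM2l; first exact: ltW.
  by move: alphaC; move: (alpha * C) => a ha; lra.
move=> H1 H2.
have K1 := ler_wpM2l (ltW k0) H1.
have {H1 K1 kr kv wC}K2 : kappa * sq ((1 - alpha) *: h - M *m v - (alpha *: e + M *m e)) <=
    kappa * sq (x - H) + 1 / 50 * sq rho + t / 3 * sq v
    + 25 / 16 * kappa * alpha ^+ 2 * sq e
    - (5 / 8 * gamma + 25 / 16 * kappa * alpha ^+ 2) * C * sq h - 2 * kappa * ylin2.
  move: K1 kr kv wC => {H1 H2 su su2 sdl srho seps2 lipg lipP seps ss eL kE k0}.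
  clear PD an0 Pd Pv Pdl My PM vd E1 E2 E3 hE epsP uP slin tn0 t4 t0.
  set X1 := sq _; set X2 := sq _; set X3 := sq _; set X4 := sq _; set X5 := sq _.
  set X6 := sq _; move: X1 X2 X3 X4 X5 X6 ylin2 => X1 X2 X3 X4 X5 X6 Y.
  set X7 := 2 / alpha * _; set X8 := 5 / 32 * _ * _; set X9 := _ * C * _.
  set Z := alpha / 2 * _.
  move: X7 X8 X9 Z => X7 X8 X9 Z; lra.
have su0 := sq_ge0 u.
have tu : (t / 16) ^+ 2 * sq u <= t / 16 * sq u.
  apply: ler_wpM2r => //; rewrite -[leRHS]mulr1 expr2; apply: ler_wpM2l.
    by rewrite divr_ge0 // ltW.
  exact: t16.
have ss0 : 0 <= eta ^+ 2 * sq S by exact: mulr_ge0 (sqr_ge0 _) (sq_ge0 _).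
have ssE : (1 - t / 4) * (eta ^+ 2 * sq s) <= eta ^+ 2 * sq S.
  apply: le_trans (ler_wpM2l (sqr_ge0 eta) ss).
  rewrite mulrBl mul1r gerBl; apply: mulr_ge0; first by rewrite divr_ge0 // ltW.
  exact: mulr_ge0 (sqr_ge0 _) (sq_ge0 _).
have sp0 : 0 <= eta ^+ 2 * sq (P *m (g + S)) by exact: mulr_ge0 (sqr_ge0 _) (sq_ge0 _).
have sd0 := sq_ge0 d.
have tu0 := mulr_ge0 (ltW t0) su0.
clear su lipg lipP seps ss eL kE k0 PD an0 Pd Pv Pdl My PM vd E1 E2 E3.
clear hE epsP uP slin tn0 t4 t0.
move: H2 K2 su2 ssE srho seps2 sdl tu ss0 sp0 sd0 tu0.
move: (sq (u - eta *: eps)) (sq s) (sq S) (sq eps) (sq (P *m (g + S))).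
move=> a1 a2 a3 a4 a5.
move: (sq u) (sq d) (sq rho) (sq v) (sq dl) (sq e) => a6 a7 a8 a9 a10 a11.
move: (sq (x - H)) (sq h) (sq (_ - _ - _)) (sq (_ - (_ + _))) => a12 a13 a14 a15.
move: (dot _ S) ylin1 ylin2 (Q _) (Q d) => b1 b2 b3 b4 b5.
rewrite -/t; move: (t) (kappa) => T K.
lra.
Qed.

End step.
End consensus.

(** * The spectral gap and the averaging matrix *)

Lemma char_poly_conjugate (F : comUnitRingType) n (P D : 'M[F]_n) :
  P \in unitmx -> char_poly (invmx P *m D *m P) = char_poly D.
Proof.
move=> uP; set Q := map_mx polyC P; set Q' := map_mx polyC (invmx P).
have QQ : Q' *m Q = 1%:M by rewrite -map_mxM mulVmx // map_mx1.
rewrite /char_poly (_ : char_poly_mx _ = Q' *m char_poly_mx D *m Q).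
  by rewrite !det_mulmx mulrAC -det_mulmx QQ det1 mul1r.
rewrite /char_poly_mx mulmxBr mulmxBl scalar_mxC -[_%:M *m _ *m Q]mulmxA QQ mulmx1.
by rewrite !map_mxM.
Qed.

Section spectral_gap.
Context (R : realType) (n : nat) (W : 'M[R]_n) (lam : seq R).
Hypotheses (W_symm : W^T = W) (W_one : W *m const_mx 1 = const_mx 1 :> 'cV[R]_n)
  (lamE : char_poly W = \prod_(a <- lam) ('X - a%:P))
  (lam_sort : sorted >=%R lam) (lam0 : lam`_0 = 1) (lam1 : lam`_1 < 1).

Local Notation toC := (@real_complex_def R (Phant R)).
Local Open Scope sesquilinear_scope.

Lemma le_lam1 a : a \in lam -> a != 1 -> a <= lam`_1.
Proof.
case: lam lam_sort lam0 => [//|b [|c s]] /= srt b1.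
  by rewrite inE b1 => ->.
rewrite inE b1; case/orP=> [->//|].
rewrite inE => /orP[/eqP-> //|sa] _.
case/andP: srt => _ /order_path_min/allP.
by apply => //; exact: ge_trans.
Qed.

Lemma count_lam1 : (count_mem (1%R : R) lam <= 1)%N.
Proof.
case: lam lam_sort lam0 lam1 => [//|b [|c s]] /= srt b1 c1.
  by case: eqP.
rewrite b1 eqxx (lt_eqF c1) add0n.
suff -> : count_mem (1%R : R) s = 0%N by rewrite addn0.
apply/count_memPn/negP => s1; case/andP: srt => _ /order_path_min/allP.
by move=> /(_ (@ge_trans _ R) 1 s1) /=; rewrite leNgt c1.
Qed.

(** Over the complex numbers W is unitarily diagonalisable, with the entries of
    lam as eigenvalues.  As the eigenvalue 1 is simple, a vector orthogonal to
    the ones has no component along its eigenvectors, and all other eigenvalues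
    are at most lambda_2. *)
Lemma spectral_gap (v : 'rV[R]_n) : v *m const_mx 1 = 0 :> 'M[R]_1 ->
  (v *m W *m v^T) 0 0 <= lam`_1 * (v *m v^T) 0 0.
Proof.
move=> v1.
pose A := map_mx toC W; pose P := spectralmx A; pose D := spectral_diag A.
have A_herm : A \is hermsymmx.
  apply: realsym_hermsym.
    apply/is_hermitianmxP; rewrite expr0 scale1r map_mx_id //.
    by apply/matrixP => i j; rewrite !mxE -{1}W_symm mxE.
  by apply/mxOverP => i j; rewrite mxE; apply/complex_realP; exists (W i j).
have Punit : P \is unitarymx by exact: spectral_unitarymx.
have PP : P^t* *m P = 1%:M.
  by rewrite -invmx_unitary // mulVmx // unitarymx_unit.
have AE : A = P^t* *m diag_mx D *m P.
  have /orthomx_spectralP := hermitian_normalmx A_herm.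
  by rewrite invmx_unitary.
have perm_D : perm_eq [seq D 0 i | i <- enum 'I_n] (map toC lam).
  apply: prod_XsubC_eq; rewrite big_map big_enum /=.
  have -> : \prod_(i in 'I_n) ('X - (D 0 i)%:P) = char_poly (diag_mx D).
    rewrite char_poly_trig ?diag_mx_is_trig //.
    by apply: eq_bigr => i _; rewrite mxE eqxx.
  rewrite -(@char_poly_conjugate _ _ P) ?unitarymx_unit //.
  rewrite invmx_unitary // -AE -map_char_poly lamE rmorph_prod /= big_map.
  by apply: eq_bigr => a _; rewrite map_polyXsubC.
have D_le i : D 0 i != 1 -> D 0 i <= toC lam`_1.
  have : D 0 i \in [seq D 0 i | i <- enum 'I_n] by apply: map_f; rewrite mem_enum.
  rewrite (perm_mem perm_D) => /mapP[a a_lam ->] a1.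
  by rewrite lecR le_lam1 //; apply: contra a1 => /eqP ->.
(* The eigenvalue 1 is simple, since the first entry of lam is 1 and the second
   is smaller. *)
have D_uniq i j : D 0 i = 1 -> D 0 j = 1 -> i = j.
  move=> Di Dj; apply/eqP/negPn/negP => ij.
  have : (count_mem (1%R : R[i]) [seq D 0%R i | i <- enum 'I_n] <= 1)%N.
    rewrite (permP perm_D) count_map; apply: leq_trans count_lam1.
    by apply: sub_count => a /=; rewrite -[1]/(toC 1) => /eqP/complexI ->.
  rewrite count_map -size_filter leqNgt => /negP; apply.
  apply: (@leq_trans (size [:: i; j])) => //; apply: uniq_leq_size.
    by rewrite /= inE ij.
  move=> k; rewrite !inE mem_filter mem_enum /= andbT.
  by case/orP=> /eqP ->; rewrite ?Di ?Dj.
pose w := map_mx toC v; pose c := w *m P^t*.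
pose ones : 'rV[R[i]]_n := const_mx 1; pose b := ones *m P^t*.
have conjw : w^t* = map_mx toC v^T.
  by apply/matrixP => i j; rewrite !mxE conj_Creal //; apply/complex_realP; exists (v j i).
have oA : ones *m A = ones.
  have : (W *m const_mx 1)^T = (const_mx 1 : 'cV[R]_n)^T by rewrite W_one.
  rewrite trmx_mul W_symm trmx_const => /(congr1 (map_mx toC)).
  by rewrite map_mxM map_const_mx rmorph1.
have bD : b *m diag_mx D = b.
  rewrite /b -{2}oA AE !mulmxA -[X in _ = X]mulmxA.
  by move/unitarymxP: Punit => ->; rewrite mulmx1.
have b0 i : D 0 i != 1 -> b 0 i = 0.
  move=> Di; have /rowP/(_ i) := bD; rewrite mul_mx_diag [X in X = _]mxE.
  move: (b 0 i) => bi /eqP; rewrite -subr_eq0 -{2}(mulr1 bi) -mulrBr mulf_eq0 subr_eq0.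
  by rewrite (negPf Di) orbF => /eqP.
have bc : \sum_i b 0 i * (c 0 i)^* = 0.
  have : b *m c^t* = 0.
    rewrite /b /c trmx_mul map_mxM trmxCK mulmxA -[ones *m _ *m P]mulmxA PP mulmx1 conjw.
    have -> : ones = map_mx toC (const_mx 1) by rewrite map_const_mx rmorph1.
    rewrite -map_mxM -[_ *m v^T]trmxK trmx_mul trmxK trmx_const v1.
    by rewrite trmx0 map_mx0.
  move=> /matrixP/(_ 0 0); rewrite !mxE => bc0; rewrite -[RHS]bc0.
  by apply: eq_bigr => i _; rewrite !mxE.
have c0 i : D 0 i = 1 -> c 0 i = 0.
  move=> Di; have bi : b 0 i != 0.
    apply/eqP => bi; suff /eqP : ones = 0.
      by apply/negP/eqP => /rowP/(_ i); rewrite !mxE => /eqP; rewrite oner_eq0.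
    rewrite -[ones]mulmx1 -PP mulmxA -/b (_ : b = 0) ?mul0mx //.
    apply/rowP => j; rewrite [RHS]mxE; have [Dj|/b0//] := eqVneq (D 0 j) 1.
    by rewrite (D_uniq _ _ Dj Di).
  move: bc; rewrite (bigD1 i) //= big1 ?addr0; last first.
    by move=> j ji; rewrite b0 ?mul0r //; apply: contra ji => /eqP Dj; rewrite (D_uniq _ _ Dj Di).
  by move=> /eqP; rewrite mulf_eq0 (negPf bi) /= conjC_eq0 => /eqP.
have wE : w = c *m P by rewrite /c -mulmxA PP mulmx1.
have conjc : P *m w^t* = c^t*.
  by rewrite /c trmx_mul map_mxM trmxCK.
have S1 : toC ((v *m v^T) 0 0) = \sum_i `|c 0 i| ^+ 2.
  have -> : toC ((v *m v^T) 0 0) = (w *m w^t*) 0 0 by rewrite conjw -map_mxM [RHS]mxE.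
  rewrite {1}wE -mulmxA conjc mxE; apply: eq_bigr => i _.
  by rewrite !mxE normCK.
have S2 : toC ((v *m W *m v^T) 0 0) = \sum_i D 0 i * `|c 0 i| ^+ 2.
  have -> : toC ((v *m W *m v^T) 0 0) = (w *m A *m w^t*) 0 0.
    by rewrite conjw -!map_mxM [RHS]mxE.
  rewrite AE !mulmxA -/c -[_ *m P *m _]mulmxA conjc mul_mx_diag mxE.
  by apply: eq_bigr => i _; rewrite !mxE normCK mulrCA mulrA.
rewrite -lecR rmorphM /= S1 S2 mulr_sumr; apply: ler_sum => i _.
have [/c0 ->|/D_le Di] := eqVneq (D 0 i) 1; first by rewrite normr0 expr0n !mulr0.
by apply: ler_wpM2r => //; exact: exprn_ge0.
Qed.

End spectral_gap.

Definition avg_mx (R : realType) (n : nat) : 'M[R]_n := const_mx n%:R^-1.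

Section average.
Context (R : realType) (n : nat).
Hypothesis n_gt0 : (0 < n)%N.
Local Notation P := (avg_mx R n).

Let n_neq0 : n%:R != 0 :> R.
Proof. by rewrite pnatr_eq0 -lt0n. Qed.

Lemma row_avg_mx p (x : 'M[R]_(n, p)) i : row i (P *m x) = avg_row x.
Proof.
apply/rowP => j; rewrite !mxE summxE mulr_sumr.
by apply: eq_bigr => k _; rewrite !mxE.
Qed.

Lemma avg_mx_sym : P^T = P.
Proof. exact: trmx_const. Qed.

Lemma avg_mx_idem : P *m P = P.
Proof.
apply/matrixP => i j; rewrite !mxE (eq_bigr (fun=> n%:R^-1 * n%:R^-1)).
  by rewrite sumr_const card_ord -[_ *+ n]mulr_natr mulfVK.
by move=> k _; rewrite !mxE.
Qed.

Lemma sq_avg_mx p (x : 'M[R]_(n, p)) : sq (P *m x) = n%:R * sq (avg_row x).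
Proof.
rewrite dot_row (eq_bigr (fun=> sq (avg_row x))); last by move=> i _; rewrite row_avg_mx.
by rewrite sumr_const card_ord mulr_natl.
Qed.

End average.

Section network.
Context (R : realType) (n : nat) (link : rel 'I_n) (W : 'M[R]_n) (lam : seq R).
Hypotheses (n_ge2 : (2 <= n)%N) (net : network link W lam).
Local Notation P := (avg_mx R n).
Local Notation B := (2^-1 *: (1%:M - W)).

Lemma size_lam : size lam = n.
Proof.
have := congr1 (fun q : {poly R} => size q) (lam_eigen net).
by rewrite size_char_poly size_prod_XsubC => - [].
Qed.

Lemma lam1_ge0 : 0 <= lam`_1.
Proof. by apply: (lam_ge0 net); rewrite mem_nth // size_lam. Qed.

(** The matrix B + P is invertible: it is coercive on the kernel of P by the
    spectral gap, and the identity on the range of P.  Its inverse serves as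
    J. *)
Lemma mixing_exists : exists J, mixing P B J ((1 - lam`_1) / 2).
Proof.
have n_gt0 : (0 < n)%N by exact: ltnW.
have lam1_lt1 := lam_second net.
pose mu : R := (1 - lam`_1) / 2.
have mu_gt0 : 0 < mu by rewrite divr_gt0 // subr_gt0.
have W1 : W *m const_mx 1 = const_mx 1 :> 'cV[R]_n by exact: W_stochastic net.
have P_sym := avg_mx_sym R n.
have P_idem := avg_mx_idem R n_gt0.
have W_symm : W^T = W by exact: W_sym net.
have B_symm : B^T = B by rewrite linearZ /= linearB /= trmx1 W_symm.
have WP : W *m P = P.
  apply/matrixP => i j; have /colP/(_ i) := W1; rewrite !mxE => W1i.
  rewrite -[RHS]mul1r -[X in _ = X * _]W1i mulr_suml; apply: eq_bigr => k _.
  by rewrite !mxE mulr1.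
have BP : B *m P = 0 by rewrite -scalemxAl mulmxBl mul1mx WP subrr scaler0.
have dotW p (A : 'M[R]_(n, p)) : dot A (W *m A) =
    \sum_j ((col j A)^T *m W *m col j A) 0 0.
  rewrite dot_col; apply: eq_bigr => j _.
  by rewrite /dot !colE !mulmxA /mxtrace big_ord1.
have dotB p (A : 'M[R]_(n, p)) : dot A (B *m A) = 2^-1 * (sq A - dot A (W *m A)).
  by rewrite -scalemxAl dotZr mulmxBl mul1mx dotDr dotNr.
have B_upp p (A : 'M[R]_(n, p)) : dot A (B *m A) <= 2^-1 * sq A.
  rewrite dotB ler_pM2l ?invr_gt0 // gerBl dotW.
  by apply: sumr_ge0 => j _; exact: (W_psd net).
have B_low p (A : 'M[R]_(n, p)) : P *m A = 0 -> mu * sq A <= dot A (B *m A).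
  move=> PA; rewrite dotB.
  suff : dot A (W *m A) <= lam`_1 * sq A by rewrite /mu; lra.
  rewrite dotW [sq A]dot_col mulr_sumr; apply: ler_sum => j _.
  have -> : dot (col j A) (col j A) = ((col j A)^T *m (col j A)^T^T) 0 0.
    by rewrite trmxK /dot /mxtrace big_ord1.
  rewrite -{2}[col j A]trmxK; apply: spectral_gap W_symm W1 (lam_eigen net)
    (lam_sorted net) (lam_first net) lam1_lt1 _ _.
  apply/matrixP => k l; rewrite !mxE.
  have /matrixP/(_ (Ordinal n_gt0) j) := PA; rewrite !mxE => /eqP.
  rewrite (eq_bigr (fun i => n%:R^-1 * A i j)); last by move=> i _; rewrite !mxE.
  rewrite -mulr_sumr mulf_eq0 invr_eq0 pnatr_eq0 -[_ == 0%N]negbK -lt0n n_gt0 /=.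
  move=> /eqP {2}<-; apply: eq_bigr => i _.
  by rewrite !mxE mulr1.
(* The coercivity of B on the kernel of P makes B + P injective. *)
pose N := B + P.
have N_sym : N^T = N by rewrite linearD /= B_symm P_sym.
have N_inj p (A : 'M[R]_(n, p)) : N *m A = 0 -> A = 0.
  move=> NA; have PA : P *m A = 0.
    have : P *m (N *m A) = 0 by rewrite NA mulmx0.
    rewrite mulmxA mulmxDr P_idem -[P *m B]trmxK trmx_mul P_sym B_symm BP.
    by rewrite trmx0 add0r.
  have := B_low _ A PA; move: NA; rewrite mulmxDl PA addr0 => ->.
  rewrite dot0r pmulr_rle0 // => sqA; apply/matrixP => i j; rewrite mxE.
  have /eqP : sq A = 0 by apply/le_anti; rewrite sqA sq_ge0.
  rewrite dotE psumr_eq0 => [/allP/(_ i)|k _]; last first.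
    by apply: sumr_ge0 => l _; rewrite -expr2 sqr_ge0.
  rewrite mem_index_enum => /(_ isT); rewrite psumr_eq0 => [/allP/(_ j)|l _].
    by rewrite mem_index_enum => /(_ isT) /=; rewrite mulf_eq0 orbb => /eqP.
  by rewrite -expr2 sqr_ge0.
have uN : N \in unitmx.
  rewrite -row_free_unit -kermx_eq0; apply/eqP.
  rewrite -[kermx N]trmxK; rewrite (N_inj _ (kermx N)^T) ?trmx0 //.
  by rewrite -[N in N *m _]N_sym -trmx_mul mulmx_ker trmx0.
pose J := invmx N.
have JP : J *m P = P.
  have NP : N *m P = P by rewrite mulmxDl BP P_idem add0r.
  by rewrite -{1}NP mulmxA mulVmx // mul1mx.
exists J; split=> //.
- by rewrite /mu ler_pdivrMr // mulVf // gerBl lam1_ge0.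
- by rewrite trmx_inv N_sym.
- have -> : B = N - P by rewrite /N addrK.
  by rewrite mulmxBr mulVmx // JP.
Qed.

End network.

(** * Smooth functions of the average *)

Section smooth_function.
Context (R : realType) (p : nat) (L : R) (f : 'rV[R]_p -> R).
Hypotheses (L_gt0 : 0 < L) (df : forall x, differentiable f x)
  (lip : forall x y, frob (grad f x - grad f y) <= L * frob (x - y)).

Lemma sq_grad_lip x y : sq (grad f x - grad f y) <= L ^+ 2 * sq (x - y).
Proof.
rewrite -!frob_sqr -exprMn ler_pXn2r // ?nnegrE ?frob_ge0 //.
by rewrite mulr_ge0 ?frob_ge0 // ltW.
Qed.

Lemma derive_grad x v : 'D_v f x = dot (grad f x) v.
Proof.
rewrite deriveE // {1}(row_sum_delta v) linear_sum /= dotE big_ord1.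
apply: eq_bigr => j _; rewrite linearZ /= !mxE -deriveE //.
by rewrite [LHS]mulrC.
Qed.

Lemma is_derive_line x v (t : R) :
  is_derive t (1 : R) (fun s : R => f (s *: v + x) : R) (dot (grad f (t *: v + x)) v).
Proof.
rewrite -derive_grad.
have E : (fun h : R => h^-1 *: (((fun s => f (s *: v + x)) \o shift t) (h *: (1 : R)) -
    f (t *: v + x))) =
  (fun h : R => h^-1 *: ((f \o shift (t *: v + x)) (h *: v) - f (t *: v + x))).
  apply/funext => h /=; congr (_ *: (f _ - _)).
  by rewrite -[h *: 1]/(h * 1) mulr1 scalerDl addrA.
apply: DeriveDef; last by rewrite /derive E.
rewrite /derivable E; exact: diff_derivable.
Qed.

(** The mean value theorem along the segment from x to y replaces integration, at
    the cost of a factor 2 in the last term. *)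
Lemma smooth_upper x y :
  f y <= f x + dot (grad f x) (y - x) + L * sq (y - x).
Proof.
pose phi (s : R) := f (s *: (y - x) + x).
have cont : {within `[0 : R, 1], continuous phi}.
  apply: continuous_subspaceT => t; apply: differentiable_continuous.
  by apply/derivable1_diffP; have [] := is_derive_line x (y - x) t.
have [c c01] := MVT ltr01 (fun t _ => is_derive_line x (y - x) t) cont.
rewrite /phi scale1r subrK scale0r add0r subr0 mulr1 => fE.
rewrite -[leLHS](subrK (f x)) fE.
set z := c *: (y - x) + x.
have zx : sq (grad f z - grad f x) <= L ^+ 2 * sq (y - x).
  apply: le_trans (sq_grad_lip _ _) _; rewrite ler_pM2l ?exprn_gt0 //.
  rewrite /z addrK sqZ -[leRHS]mul1r ler_wpM2r ?sq_ge0 // expr_le1 //.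
    by rewrite ltW // (itvP c01).
  by rewrite ltW // (itvP c01).
have LV : 0 < L^-1 by rewrite invr_gt0.
have := young (grad f z - grad f x) (y - x) LV.
have := ler_wpM2l (ltW LV) zx.
rewrite invrK expr2 !mulrA mulVf ?lt0r_neq0 // mul1r.
have -> : dot (grad f z) (y - x) =
    dot (grad f z - grad f x) (y - x) + dot (grad f x) (y - x).
  by rewrite -dotDl subrK.
move: (sq (y - x)) (sq (grad f z - grad f x)) => s s'; lra.
Qed.

End smooth_function.

Section average_gradient.
Context (R : realType) (n p : nat) (L : R) (f : 'I_n -> 'rV[R]_p -> R).
Hypotheses (n_gt0 : (0 < n)%N) (L_gt0 : 0 < L) (sm : smooth L f).
Local Notation P := (avg_mx R n).

Lemma row_grad_rows x i : row i (grad_rows f x) = grad (f i) (row i x).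
Proof. by apply/rowP => j; rewrite !mxE. Qed.

Lemma sq_grad_rows_lip x y :
  sq (grad_rows f x - grad_rows f y) <= L ^+ 2 * sq (x - y).
Proof.
rewrite !dot_row mulr_sumr; apply: ler_sum => i _.
rewrite !linearB /= !row_grad_rows.
exact: sq_grad_lip (sm.2 i) _ _.
Qed.

Lemma grad_avg_fun x : grad (avg_fun f) (avg_row x) = avg_row (grad_rows f (P *m x)).
Proof.
apply/rowP => j; rewrite !mxE.
have -> : avg_fun f = n%:R^-1 *: \sum_i f i.
  by apply/funext => z; rewrite /avg_fun -[RHS]/(_ *: _) fct_sumE.
rewrite deriveZ; last first.
  by apply: derivable_sum => i; exact/diff_derivable/(sm.1 i).
rewrite derive_sum; last by move=> i; exact/diff_derivable/(sm.1 i).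
rewrite summxE -[LHS]/(_ * _); congr (_ * _); apply: eq_bigr => i _.
by rewrite row_grad_rows row_avg_mx mxE.
Qed.

Lemma avg_rowD (x y : 'M[R]_(n, p)) : avg_row (x + y) = avg_row x + avg_row y.
Proof. by rewrite /avg_row -scalerDr -big_split; congr (_ *: _); apply: eq_bigr => i _; rewrite linearD. Qed.

Lemma avg_rowZ a (x : 'M[R]_(n, p)) : avg_row (a *: x) = a *: avg_row x.
Proof.
rewrite /avg_row scalerA mulrC -scalerA; congr (_ *: _).
by rewrite scaler_sumr; apply: eq_bigr => i _; rewrite linearZ.
Qed.

Lemma avg_rowN (x : 'M[R]_(n, p)) : avg_row (- x) = - avg_row x.
Proof. by rewrite -scaleN1r avg_rowZ scaleN1r. Qed.

(** The smoothness inequality of each f_i between the two averages, summed over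
    the agents. *)
Lemma avg_fun_upper x y :
  n%:R * avg_fun f (avg_row y) <= n%:R * avg_fun f (avg_row x)
  + dot (P *m grad_rows f (P *m x)) (y - x) + L * sq (P *m (y - x)).
Proof.
rewrite /avg_fun !mulrA mulfV ?pnatr_eq0 -?lt0n // !mul1r.
rewrite dot_mulmxl avg_mx_sym dot_row sq_avg_mx // mulrCA.
have -> : n%:R * (L * sq (avg_row (y - x))) = \sum_(i < n) L * sq (avg_row (y - x)).
  by rewrite sumr_const card_ord mulr_natl.
rewrite -!big_split /=; apply: ler_sum => i _.
rewrite row_avg_mx row_grad_rows row_avg_mx avg_rowD avg_rowN.
exact: smooth_upper L_gt0 (sm.1 i) (sm.2 i) _ _.
Qed.

End average_gradient.

(** * Decrease of the potential *)

(** The conditions under which all error terms of [potential_step] are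
    absorbed. *)
Record tuning (R : realType) (mu alpha gamma C L eta : R) : Prop := Tuning {
  tun_gamma_gt0 : 0 < gamma;
  tun_gamma_le : gamma <= 2^-1;
  tun_alpha_gt0 : 0 < alpha;
  tun_alpha_le : alpha <= 4^-1;
  tun_gamma_alpha : gamma <= alpha / 2;
  tun_C_gt0 : 0 < C;
  tun_alphaC : alpha * C <= 4^-1;
  tun_gammaC : gamma * C <= alpha ^+ 2 * mu / 300;
  tun_L_gt0 : 0 < L;
  tun_eta_gt0 : 0 < eta;
  tun_eta_le : eta * L <= gamma * mu / 16 }.

Section potential.
Context (R : realType) (n p : nat) (f : 'I_n -> 'rV[R]_p -> R).
Variables (B J : 'M[R]_n) (mu alpha gamma C L eta : R).
Local Notation P := (avg_mx R n).
Hypotheses (n_gt0 : (0 < n)%N) (mix : mixing P B J mu)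
  (tun : tuning mu alpha gamma C L eta) (sm : smooth L f).
Implicit Types x D H S e : 'M[R]_(n, p).

Let L_gt0 : 0 < L. Proof. by case: tun. Qed.
Let eta_gt0 : 0 < eta. Proof. by case: tun. Qed.

Let t := gamma * mu.
Let M := gamma *: B.

Lemma t_gt0 : 0 < gamma * mu.
Proof. by rewrite mulr_gt0 //; [case: tun | case: mix]. Qed.

Lemma t_le : gamma * mu <= 4^-1.
Proof.
have := ler_pM (ltW (tun_gamma_gt0 tun)) (ltW (mix_mu_gt0 mix))
  (tun_gamma_le tun) (mix_mu_le mix); lra.
Qed.

(** Polarising the product of the averaged gradients at x and at P x retains
    - eta / 2 times both squares and leaves their squared distance, which the
    Lipschitz condition turns into the consensus error. *)
Lemma avg_descent x y S : P *m (y - x) = - (eta *: (P *m (grad_rows f x + S))) ->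
  n%:R * avg_fun f (avg_row y) <= n%:R * avg_fun f (avg_row x)
  - eta / 2 * sq (P *m grad_rows f (P *m x)) - eta / 2 * sq (P *m grad_rows f x)
  + eta / 2 * L ^+ 2 * sq (x - P *m x) - eta * dot (P *m grad_rows f (P *m x)) S
  + L * eta ^+ 2 * sq (P *m (grad_rows f x + S)).
Proof.
set g := grad_rows f x; set gP := grad_rows f (P *m x) => yx.
have := avg_fun_upper n_gt0 L_gt0 sm x y.
rewrite dot_mulmxl avg_mx_sym yx sqN sqZ dotNr dotZr -/gP mulrA.
have P2 A A' : dot A (P *m A') = dot (P *m A) (P *m A').
  by rewrite dot_mulmxl avg_mx_sym mulmxA avg_mx_idem.
have -> : dot gP (P *m (g + S)) = dot (P *m gP) (P *m g) + dot (P *m gP) S.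
  by rewrite mulmxDr dotDr P2; congr (_ + _); rewrite dot_mulmxl avg_mx_sym.
have h1 := sqB (P *m g) (P *m gP).
have h2 : sq (P *m g - P *m gP) <= L ^+ 2 * sq (x - P *m x).
  apply: le_trans (sq_grad_rows_lip L_gt0 sm x (P *m x)).
  by rewrite -mulmxBr -/g -/gP; exact: (sq_proj mix).
rewrite h1 (dotC (P *m g) (P *m gP)) in h2.
have e2 : 0 <= eta / 2 by rewrite divr_ge0 // ltW.
have := ler_wpM2l e2 h2; clear h1 h2 yx.
move: (sq (P *m g)) (sq (P *m gP)) (dot (P *m gP) (P *m g)) (dot (P *m gP) S).
move: (sq (P *m (g + S))) (sq (x - P *m x)) => a1 a2 a3 a4 a5 a6.
lra.
Qed.

(** With this weight the loss t / 10 of the Lyapunov function equals the factor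
    eta L^2 / 2 of the consensus error in [avg_descent]. *)
Definition potential_weight : R := 5 * eta * L ^+ 2 / t.
Local Notation w := potential_weight.

Lemma potential_weight_gt0 : 0 < w.
Proof. by rewrite divr_gt0 ?t_gt0 // !mulr_gt0 // exprn_gt0. Qed.

(** The weight kappa of the tracking error required by [lyapunov_step]. *)
Definition tracking_weight : R := 6 * gamma * C / alpha.
Local Notation kappa := tracking_weight.

Definition potential x D H : R :=
  n%:R * avg_fun f (avg_row x) + w * lyapunov P J gamma kappa eta x D H (grad_rows f (P *m x)).

Definition comp_coef x D H S : 'M[R]_(n, p) :=
  w *: comp_noise_coef P B gamma alpha kappa eta x D H (grad_rows f x) S
    (grad_rows f (P *m x)) (grad_rows f (P *m (x - eta *: (grad_rows f x + S)))).

Definition grad_coef x : 'M[R]_(n, p) :=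
  w *: grad_noise_coef P mu gamma eta x (grad_rows f x) (grad_rows f (P *m x))
  - eta *: (P *m grad_rows f (P *m x)) + (4 * L * eta ^+ 2) *: (P *m grad_rows f x).

Definition comp_weight : R := w * (5 / 8 * gamma + 25 / 16 * kappa * alpha ^+ 2).

Lemma sq_avgD x S : sq (P *m (x + S)) = sq (P *m x) + 2 * dot (P *m x) S + sq (P *m S).
Proof.
rewrite mulmxDr sqD; congr (_ + _ * _ + _).
by rewrite [RHS]dot_mulmxl avg_mx_sym [LHS]dot_mulmxl avg_mx_sym mulmxA avg_mx_idem.
Qed.

(** The Lyapunov function produces a multiple of eta^2 times the square of the
    averaged stochastic gradient; as eta L is small, the deterministic part is
    absorbed by the retained square of the averaged gradient at x. *)
Lemma potential_step x D H S e y : P *m D = 0 ->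
  y = x - eta *: (grad_rows f x + S) - D ->
  potential (y - M *m (y + e)) (D + M *m (y + e)) (H + alpha *: (y - H + e)) <=
  potential x D H - eta / 2 * sq (P *m grad_rows f (P *m x))
  + 2 * L * eta ^+ 2 * sq (P *m S) + 2 * w * eta ^+ 2 * sq S
  + comp_weight * (sq e - C * sq (y - H))
  + dot (comp_coef x D H S) e + dot (grad_coef x) S.
Proof.
move=> PD yE; pose G := grad_rows f x + S; set g := grad_rows f x; set gP := grad_rows f (P *m x).
have PM A : P *m (M *m A) = 0.
  by rewrite -scalemxAl -scalemxAr mulmxA (PB mix) mul0mx scaler0.
have Px' : P *m (y - M *m (y + e)) = P *m (x - eta *: G).
  by rewrite mulmxBr PM subr0 yE mulmxBr PD subr0.
have PG : P *m (x - eta *: G) - P *m x = - (eta *: (P *m G)).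
  by rewrite mulmxBr -scalemxAr addrAC subrr add0r.
have Pdiff : P *m ((y - M *m (y + e)) - x) = - (eta *: (P *m G)).
  by rewrite mulmxBr Px' PG.
have lipP : sq (grad_rows f (P *m (x - eta *: G)) - gP) <=
    L ^+ 2 * (eta ^+ 2 * sq (P *m (g + S))).
  apply: le_trans (sq_grad_rows_lip L_gt0 sm _ _) _.
  by rewrite PG sqN sqZ.
have := lyapunov_step mix (tun_gamma_gt0 tun) (tun_gamma_le tun) (tun_alpha_gt0 tun)
  (tun_alpha_le tun) (tun_gamma_alpha tun) (tun_C_gt0 tun) (tun_alphaC tun)
  (tun_gammaC tun) (erefl kappa) L_gt0 eta_gt0 (tun_eta_le tun) H e PD
  (sq_grad_rows_lip L_gt0 sm x (P *m x)) lipP.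
rewrite -/g -/gP -/G -yE -/M => /(ler_wpM2l (ltW potential_weight_gt0)).
have := avg_descent Pdiff; rewrite -/g -/gP.
rewrite /potential Px' /comp_coef /grad_coef -/g -/gP -/G.
move: (comp_noise_coef _ _ _ _ _ _ _ _ _ _ _ _ _) => Yc.
move: (grad_noise_coef _ _ _ _ _ _ _) => Xc; rewrite (dotZl _ _ e).
rewrite [dot (_ + _ *: (P *m _)) S]dotDl [dot (_ - _) S]dotDl [dot (- _) S]dotNl.
rewrite !(dotZl _ _ S) /comp_weight /G sq_avgD.
set V0 := n%:R * _ ; set V1 := n%:R * _.
set L0 := lyapunov _ _ _ _ _ _ _ _ _; set L1 := lyapunov _ _ _ _ _ _ _ _ _.
set K := 5 / 8 * _ + _.
set Ye := dot Yc e; set XS := dot Xc S.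
have tn0 : t != 0 by rewrite lt0r_neq0 // t_gt0.
(* The loss of the Lyapunov function equals the error of the descent. *)
have wt : w * (gamma * mu / 10 * sq (x - P *m x)) = eta / 2 * L ^+ 2 * sq (x - P *m x).
  by rewrite /w -/t; field.
have le1 : eta * L <= 64^-1 by have := tun_eta_le tun; have := t_le; lra.
have le2 : w * (eta ^+ 2 / 10) <= L * eta ^+ 2 / 32.
  have -> : w * (eta ^+ 2 / 10) = L * eta ^+ 2 * (eta * L / (2 * t)).
    by rewrite /w -/t; field.
  rewrite -[leRHS]mulrA -[leLHS]mulrA; apply: ler_wpM2l; first exact: ltW.
  apply: ler_wpM2l; first exact: sqr_ge0.
  have t2 : 0 < 2 * t by rewrite mulr_gt0 // t_gt0.
  rewrite ler_pdivrMr // (_ : 32^-1 * (2 * t) = t / 16); last by field.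
  exact: (tun_eta_le tun).
have Le0 : 0 <= L * eta ^+ 2 by rewrite mulr_ge0 ?sqr_ge0 // ltW.
have Z0 : 0 <= sq (P *m g) + 2 * dot (P *m g) S + sq (P *m S).
  by rewrite -sq_avgD sq_ge0.
have h1 := ler_wpM2r Z0 le2.
have h2 := mulr_ge0 Le0 Z0.
have h3 : 2 * (L * eta ^+ 2) * sq (P *m g) <= eta / 2 * sq (P *m g).
  apply: ler_wpM2r; first exact: sq_ge0.
  by have := ler_wpM2l (ltW eta_gt0) le1; rewrite expr2; lra.
move=> H1 H2.
move: H1 H2 wt h1 h2 h3; clear PD yE PM Px' PG Pdiff lipP tn0 le1 le2 Le0 Z0.
move: (sq (P *m gP)) (sq (P *m g)) (sq (P *m S)) (sq S) (sq e) (sq (y - H)).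
move: (dot (P *m g) S) (dot (P *m gP) S) (sq (x - P *m x)) V0 V1 L0 L1 Ye XS K.
move: (w) => w' a1 a2 a3 a4 a5 a6 a7 a8 a9 a10 a11 a12 a13 a14 a15 a16.
lra.
Qed.

End potential.

(** * The initial potential and the rate *)

Section initial.
Context (R : realType) (n p : nat) (f : 'I_n -> 'rV[R]_p -> R).
Variables (B J : 'M[R]_n) (mu alpha gamma C L eta : R).
Local Notation P := (avg_mx R n).
Hypotheses (n_gt0 : (0 < n)%N) (mix : mixing P B J mu)
  (tun : tuning mu alpha gamma C L eta) (sm : smooth L f).
Local Notation kappa := (tracking_weight alpha gamma C).

Lemma tracking_weight_gt0 : 0 < kappa.
Proof.
case: tun => ? ? ? ? ? ? ? ? ? ? ?.
by rewrite /tracking_weight divr_gt0 // !mulr_gt0.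
Qed.

Lemma tracking_weight_le1 : kappa <= 1.
Proof.
case: tun => g0 g1 a0 a1 ga C0 aC gC _ _ _; have mu0 := mix_mu_gt0 mix.
have mu1 := mix_mu_le mix.
rewrite /tracking_weight ler_pdivrMr // mul1r -mulrA.
have : alpha ^+ 2 * mu <= alpha.
  rewrite expr2 -mulrA -[leRHS]mulr1 ler_pM2l //.
  by have := ler_pM (ltW a0) (ltW mu0) a1 mu1; lra.
by move: (gamma * C) (alpha ^+ 2 * mu) gC => u v; lra.
Qed.

(** If P d = 0 then <d, J d> = <J d, B J d>, which is nonnegative. *)
Lemma lyapunov_ge0 (x D H gP : 'M[R]_(n, p)) : P *m D = 0 -> 0 <= lyapunov P J gamma kappa eta x D H gP.
Proof.
move=> PD; rewrite /lyapunov.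
set d := D + _ *: _ : 'M[R]_(n, p).
have Pd : P *m d = 0 by rewrite /d mulmxDr PD -scalemxAr (perpP mix) scaler0 addr0.
have [PJ BJ] := J_solves mix Pd.
apply: addr_ge0; first apply: addr_ge0; first exact: sq_ge0.
  apply: mulr_ge0; first by rewrite invr_ge0 ltW // (tun_gamma_gt0 tun).
  by rewrite -{1}BJ dotC (B_ge0 mix).
by rewrite mulr_ge0 ?sq_ge0 // ltW // tracking_weight_gt0.
Qed.

(** The dual term is at most eta^2 / t times a squared gradient, and
    eta^2 / t <= L^-2 because eta L <= t / 16: the initial value contains no
    inverse power of the spectral gap. *)
Lemma lyapunov_init (x0 H0 S x : 'M[R]_(n, p)) :
  x = x0 - eta *: (grad_rows f x0 + S) ->
  lyapunov P J gamma kappa eta x 0 H0 (grad_rows f (P *m x)) <=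
  18 * sq x0 + 2 * sq H0 + 3 * L ^- 2 * sq (grad_rows f x0) + L ^- 2 * sq S.
Proof.
set g := grad_rows f x0 => xE; set gP := grad_rows f (P *m x).
have t0 := t_gt0 mix tun; have t4 := t_le mix tun.
have L0 := tun_L_gt0 tun; have e0 := tun_eta_gt0 tun; have g0 := tun_gamma_gt0 tun.
have mu0 := mix_mu_gt0 mix.
have Ln0 : L != 0 by exact: lt0r_neq0.
set l2 := L ^- 2; have l20 : 0 < l2 by rewrite invr_gt0 exprn_gt0.
have eL8 : eta * L <= 8^-1 by have := tun_eta_le tun; move: t4 t0; move: (gamma * mu) => u; lra.
have e2 : eta ^+ 2 <= l2 / 64.
  have -> : l2 / 64 = (8^-1 / L) ^+ 2 by rewrite /l2; field.
  have h : eta <= 8^-1 / L by rewrite ler_pdivlMr.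
  by rewrite !expr2; apply: ler_pM => //; exact: ltW.
have et : eta ^+ 2 / (gamma * mu) <= l2.
  have eLt : eta * L <= gamma * mu by have := tun_eta_le tun; move: t0; move: (gamma * mu) => u; lra.
  have -> : eta ^+ 2 / (gamma * mu) = l2 * (eta * L * (eta * L / (gamma * mu))).
    by rewrite /l2; field; rewrite Ln0 !lt0r_neq0.
  rewrite -[leRHS]mulr1 ler_pM2l // -[leRHS]mulr1; apply: ler_pM.
  - by rewrite mulr_ge0 // ltW.
  - by rewrite divr_ge0 ?mulr_ge0 // ltW.
  - by move: eL8; move: (eta * L) => u; lra.
  by rewrite ler_pdivrMr // mul1r.
have sx : sq x <= 2 * sq x0 + 4 * eta ^+ 2 * sq g + 4 * eta ^+ 2 * sq S.
  rewrite xE; apply: le_trans (sqB2_le _ _) _; rewrite sqZ.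
  have := ler_wpM2l (sqr_ge0 eta) (sqD2_le g S).
  by move: (eta ^+ 2) (sq (g + S)) (sq g) (sq S) (sq x0) => u1 u2 u3 u4 u5; lra.
have sgP : sq gP <= 2 * sq g + L ^+ 2 * (4 * sq x + 4 * sq x0).
  have h1 := sqD2_le (gP - g) g; rewrite subrK in h1.
  have h2 := sq_grad_rows_lip L0 sm (P *m x) x0.
  have h3 := sqB2_le (P *m x) x0; have h4 := sq_proj mix x.
  have h5 := le_trans h2 (ler_wpM2l (sqr_ge0 L) h3).
  have h6 := ler_wpM2l (sqr_ge0 L) h4.
  move: h1 h5 h6; rewrite -/g -/gP.
  move: (sq (gP - g)) (sq gP) (sq g) (sq (P *m x)) (sq x) (sq x0) (L ^+ 2).
  move=> u1 u2 u3 u4 u5 u6 u7; lra.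
have Qd : gamma^-1 * dot (0 + eta *: (gP - P *m gP)) (J *m (0 + eta *: (gP - P *m gP)))
    <= 2 * l2 * sq g + 4 * sq x + 4 * sq x0.
  rewrite add0r.
  have Pd : P *m (eta *: (gP - P *m gP)) = 0 by rewrite -scalemxAr (perpP mix) scaler0.
  have h1 : gamma^-1 * dot (eta *: (gP - P *m gP)) (J *m (eta *: (gP - P *m gP))) <=
      eta ^+ 2 / (gamma * mu) * sq gP.
    have gV : 0 <= gamma^-1 by rewrite invr_ge0 ltW.
    apply: le_trans (ler_wpM2l gV (J_upp mix Pd)) _.
    rewrite sqZ; have c0 : 0 <= eta ^+ 2 / (gamma * mu).
      by rewrite divr_ge0 ?sqr_ge0 // ltW.
    have := ler_wpM2l c0 (sq_perp mix gP).
    by rewrite invfM; move: (sq (gP - P *m gP)) (eta ^+ 2) gamma^-1 mu^-1 (sq gP) => u1 u2 u3 u4 u5; lra.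
  apply: le_trans h1 _; apply: le_trans (ler_wpM2r (sq_ge0 _) et) _.
  apply: le_trans (ler_wpM2l (ltW l20) sgP) _.
  rewrite mulrDr mulrA [l2 * (L ^+ 2 * _)]mulrA (_ : l2 * L ^+ 2 = 1) ?mul1r; last by rewrite /l2; field.
  by move: (sq g) (sq x) (sq x0) => u1 u2 u3; lra.
have kx : kappa * sq (x - H0) <= 2 * sq x + 2 * sq H0.
  apply: le_trans (sqB2_le x H0); rewrite -[leRHS]mul1r.
  by apply: ler_wpM2r; [exact: sq_ge0 | exact: tracking_weight_le1].
rewrite /lyapunov; have su := sq_perp mix x.
have e2g := ler_wpM2r (sq_ge0 g) e2; have e2S := ler_wpM2r (sq_ge0 S) e2.
have lg0 := mulr_ge0 (ltW l20) (sq_ge0 g); have lS0 := mulr_ge0 (ltW l20) (sq_ge0 S).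
move: Qd kx su sx e2g e2S lg0 lS0; clear l20 e2 et eL8 sgP t0 t4 e0 g0 mu0 Ln0 L0 xE.
move: (sq (x - P *m x)) (gamma^-1 * _) (kappa * _) (sq x) (sq H0) (sq g) (sq S) (sq x0).
move: (eta ^+ 2) l2 => v1 v2 u1 u2 u3 u4 u5 u6 u7 u8; lra.
Qed.

End initial.

Section rate.
Context (R : realType) (L sigma Delta0 aX aF : R).
Hypotheses (L_gt0 : 0 < L) (sigma_gt0 : 0 < sigma) (Delta0_gt0 : 0 < Delta0)
  (aX_ge0 : 0 <= aX) (aF_ge0 : 0 <= aF).

Definition init_const : R := 20 * aX + 3 * L ^- 2 * aF + L ^- 2 * sigma ^+ 2.

Definition rate_const : R :=
  8 * Delta0 * Num.sqrt (L * sigma ^+ 2 / Delta0) + 52 * Delta0 * L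
  + L ^+ 2 * aX + 10 * L ^+ 2 * init_const.

Lemma init_const_ge0 : 0 <= init_const.
Proof.
have l0 : 0 <= L ^- 2 by rewrite invr_ge0 sqr_ge0.
apply: addr_ge0; last by rewrite mulr_ge0 ?sqr_ge0.
by apply: addr_ge0; rewrite !mulr_ge0.
Qed.

Lemma rate_const_gt0 : 0 < rate_const.
Proof.
have h1 : 0 <= 8 * Delta0 * Num.sqrt (L * sigma ^+ 2 / Delta0).
  by rewrite mulr_ge0 ?sqrtr_ge0 // mulr_ge0 // ltW.
have h2 : 0 < 52 * Delta0 * L by rewrite !mulr_gt0.
have h3 : 0 <= L ^+ 2 * aX by rewrite mulr_ge0 ?sqr_ge0.
have h4 : 0 <= 10 * L ^+ 2 * init_const.
  by rewrite mulr_ge0 ?init_const_ge0 // mulr_ge0 ?sqr_ge0.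
by rewrite /rate_const ltr_wpDr // ltr_wpDr // ltr_wpDl.
Qed.

(** The stepsize is at most the inverse of the square root in its denominator,
    which settles the variance terms, while its inverse contributes 16 L / t to
    the terms of order 1 / K. *)
Lemma rate_bound (n K t eta : R) : 1 <= n -> 1 <= K -> 0 < t -> t <= 1 ->
  n ^+ 3 / t ^+ 2 <= K ->
  eta = (Num.sqrt (L * sigma ^+ 2 * K / (n * Delta0)) + 16 * L / t)^-1 ->
  2 / (eta * n * K) * (n * Delta0 + eta / 2 * L ^+ 2 * (aX * n ^+ 2)
    + L * eta ^+ 2 * sigma ^+ 2 + 5 * eta * L ^+ 2 / t * (init_const * n ^+ 2))
  + 2 / (eta * n) * (2 * L * eta ^+ 2 * sigma ^+ 2
    + 2 * (5 * eta * L ^+ 2 / t) * eta ^+ 2 * (n * sigma ^+ 2))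
  <= rate_const / Num.sqrt (n * K).
Proof.
move=> n1 K1 t0 t1 Kn etaE.
have n0 : 0 < n by exact: lt_le_trans n1.
have K0 : 0 < K by exact: lt_le_trans K1.
set a := Num.sqrt (L * sigma ^+ 2 * K / (n * Delta0)) in etaE *.
set b := Num.sqrt (L * sigma ^+ 2 / Delta0).
set s := Num.sqrt (n * K).
have b0 : 0 < b by rewrite sqrtr_gt0 divr_gt0 // mulr_gt0 // exprn_gt0.
have s0 : 0 < s by rewrite sqrtr_gt0 mulr_gt0.
have a0 : 0 < a by rewrite sqrtr_gt0 divr_gt0 ?mulr_gt0 // exprn_gt0.
have b2 : b ^+ 2 = L * sigma ^+ 2 / Delta0.
  by rewrite sqr_sqrtr // divr_ge0 ?mulr_ge0 ?sqr_ge0 // ltW.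
have s2 : s ^+ 2 = n * K by rewrite sqr_sqrtr // mulr_ge0 // ltW.
have aE : a = K * b / s.
  apply/(@mulIf _ s); first exact: lt0r_neq0.
  rewrite mulfVK ?lt0r_neq0 //; apply/eqP.
  rewrite -(@eqrXn2 _ 2) // ?mulr_ge0 // ?ltW // exprMn s2 exprMn b2.
  rewrite sqr_sqrtr; last by rewrite divr_ge0 ?mulr_ge0 ?sqr_ge0 // ltW.
  by apply/eqP; field; rewrite !lt0r_neq0.
have [an0 bn0 sn0 nn0] : [/\ a != 0, b != 0, s != 0 & n != 0] by rewrite !lt0r_neq0.
have [Kn0 tn0 Dn0 Ln0] : [/\ K != 0, t != 0, Delta0 != 0 & L != 0] by rewrite !lt0r_neq0.
have Lt0 : 0 < 16 * L / t by rewrite divr_gt0 // mulr_gt0.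
have e0 : 0 < eta by rewrite etaE invr_gt0 addr_gt0.
have en0 : eta != 0 by exact: lt0r_neq0.
have eVE : eta^-1 = K * b / s + 16 * L / t by rewrite etaE invrK aE.
have ea : eta <= s / (K * b).
  rewrite etaE -[leRHS]invrK invf_div -aE lef_pV2 ?posrE ?addr_gt0 //.
  by rewrite lerDl ltW.
set r := s^-1; have r0 : 0 < r by rewrite invr_gt0.
(* The threshold on K enters through this inequality only. *)
have nK : n / (t * K) <= r.
  rewrite /r -[s^-1]div1r ler_pdivlMr // mulrAC ler_pdivrMr ?mulr_gt0 // mul1r.
  rewrite ler_pdivrMr ?exprn_gt0 // in Kn.
  have : (n * s) ^+ 2 <= (t * K) ^+ 2.
    rewrite !exprMn s2 (_ : n ^+ 2 * (n * K) = n ^+ 3 * K); last by ring.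
    rewrite (_ : t ^+ 2 * K ^+ 2 = K * t ^+ 2 * K); last by ring.
    by rewrite ler_pM2r.
  by rewrite ler_pXn2r ?nnegrE ?mulr_ge0 // ltW.
have tK1 : (t * K)^-1 <= r.
  apply: le_trans nK; rewrite -[leLHS]mul1r; apply: ler_wpM2r => //.
  by rewrite invr_ge0 mulr_ge0 // ltW.
have nK1 : n / K <= r.
  apply: le_trans nK; rewrite ler_pM2l // lef_pV2 ?posrE ?mulr_gt0 //.
  by rewrite -[leRHS]mul1r ler_pM2r.
have Lsb : L * sigma ^+ 2 = Delta0 * b ^+ 2 by rewrite b2; field.
have en : L * sigma ^+ 2 * (eta / n) <= Delta0 * b * r.
  have h : eta / n <= s / (K * b) / n by apply: ler_wpM2r ea; rewrite invr_ge0 ltW.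
  have Ls0 : 0 <= L * sigma ^+ 2 by rewrite mulr_ge0 ?sqr_ge0 // ltW.
  apply: le_trans (ler_wpM2l Ls0 h) _; rewrite Lsb.
  rewrite (_ : Delta0 * b ^+ 2 * (s / (K * b) / n) = Delta0 * b * (s ^+ 2 / (n * K) / s)).
    by rewrite s2 mulfV ?mul1r // mulf_neq0.
  by field; rewrite Kn0 bn0 nn0 sn0.
have e2 : L ^+ 2 * sigma ^+ 2 / t * eta ^+ 2 <= L * Delta0 * r.
  have h : eta ^+ 2 <= (s / (K * b)) ^+ 2.
    by rewrite !expr2; apply: ler_pM => //; exact: ltW.
  have c0 : 0 <= L ^+ 2 * sigma ^+ 2 / t.
    by rewrite divr_ge0 ?mulr_ge0 ?sqr_ge0 // ltW.
  apply: le_trans (ler_wpM2l c0 h) _.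
  have -> : L ^+ 2 * sigma ^+ 2 / t * (s / (K * b)) ^+ 2 = L * Delta0 * (n / (t * K)).
    rewrite expr_div_n s2 (_ : L ^+ 2 * sigma ^+ 2 = L * (L * sigma ^+ 2)); last by ring.
    by rewrite Lsb; field; rewrite Kn0 bn0 tn0.
  by rewrite ler_pM2l // mulr_gt0.
have KV : K^-1 <= 1 by rewrite invf_le1.
have -> : 2 / (eta * n * K) * (n * Delta0 + eta / 2 * L ^+ 2 * (aX * n ^+ 2)
    + L * eta ^+ 2 * sigma ^+ 2 + 5 * eta * L ^+ 2 / t * (init_const * n ^+ 2))
  + 2 / (eta * n) * (2 * L * eta ^+ 2 * sigma ^+ 2
    + 2 * (5 * eta * L ^+ 2 / t) * eta ^+ 2 * (n * sigma ^+ 2)) =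
  2 * Delta0 * (eta^-1 / K) + L ^+ 2 * aX * (n / K)
  + 2 * (L * sigma ^+ 2 * (eta / n)) * K^-1
  + 10 * L ^+ 2 * init_const * (n / (t * K))
  + 4 * (L * sigma ^+ 2 * (eta / n)) + 20 * (L ^+ 2 * sigma ^+ 2 / t * eta ^+ 2).
  by move: init_const => c; field; rewrite Kn0 tn0 nn0 en0.
have -> : eta^-1 / K = b * r + 16 * L * (t * K)^-1.
  by rewrite eVE /r; field; rewrite Kn0 tn0 sn0.
have h1 := ler_wpM2l (ltW (mulr_gt0 Delta0_gt0 L_gt0)) tK1.
have h2 := ler_wpM2l (mulr_ge0 (sqr_ge0 L) aX_ge0) nK1.
have Y0 : 0 <= L * sigma ^+ 2 * (eta / n).
  by rewrite !mulr_ge0 ?sqr_ge0 ?invr_ge0 // ltW.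
have h3 := ler_wpM2l Y0 KV.
have h4 := ler_wpM2l (mulr_ge0 (sqr_ge0 L) init_const_ge0) nK.
rewrite /rate_const -/b.
move: en e2 h1 h2 h3 h4; rewrite -/r.
move: (L * sigma ^+ 2 * (eta / n)) (L ^+ 2 * sigma ^+ 2 / t * eta ^+ 2) => u1 u2.
move: ((t * K)^-1) (n / K) (n / (t * K)) (K^-1) (L ^+ 2) init_const => u3 u4 u5 u6 u7 u8.
lra.
Qed.

End rate.

(** * Pulling out measurable factors *)

Section sub_algebra.
Context (d : measure_display) (T : measurableType d).
Implicit Types (G : set (set T)).

(** Phrased through the measurable type generated by G, so that the closure
    properties of measurable functions apply; see [mwrtP]. *)
Definition mwrt (d' : measure_display) (T' : measurableType d') G (X : T -> T') : Prop :=
  measurable_fun [set: g_sigma_algebraType G] (X : g_sigma_algebraType G -> T').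

Lemma measurable_sub G A : sub_sigma_algebra_of G ->
  measurable (A : set (g_sigma_algebraType G)) = G A.
Proof. by move=> [sG _]; rewrite /measurable /= sigma_algebra_id. Qed.

Lemma mwrtP (d' : measure_display) (T' : measurableType d') G (X : T -> T') :
  sub_sigma_algebra_of G -> mwrt G X <-> measurable_wrt G X.
Proof.
move=> sG; split=> [mX B mB|mX _ B mB].
  have := mX measurableT B mB.
  by rewrite setTI measurable_sub.
by rewrite setTI measurable_sub //; exact: mX.
Qed.

Lemma mwrt_sub (d' : measure_display) (T' : measurableType d') G G' (X : T -> T') :
  sub_sigma_algebra_of G -> sub_sigma_algebra_of G' -> G `<=` G' ->
  mwrt G X -> mwrt G' X.
Proof.
move=> sG sG' GG' /(mwrtP _ sG) mX; apply/(mwrtP _ sG') => B mB.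
exact/GG'/mX.
Qed.

Lemma mwrt_measurable (d' : measure_display) (T' : measurableType d') G (X : T -> T') :
  sub_sigma_algebra_of G -> mwrt G X -> measurable_fun setT X.
Proof.
by move=> sG /(mwrtP _ sG) mX _ B mB; rewrite setTI; apply: sG.2; exact: mX.
Qed.

End sub_algebra.

Section centred.
Import HBNNSimple.
Context (R : realType) (d : measure_display) (T : measurableType d)
  (P : probability T R).
Implicit Types (G H : set (set T)) (X Y : T -> R).
Local Open Scope ereal_scope.

(** Expresses that E[Y | G] = 0. *)
Definition centred G Y : Prop :=
  P.-integrable setT (EFin \o Y) /\ forall A, G A -> \int[P]_(x in A) (Y x)%:E = 0.

Lemma integral_indicM A Y : measurable A ->
  \int[P]_x (\1_A x * Y x)%:E = \int[P]_(x in A) (Y x)%:E.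
Proof.
move=> mA; rewrite [RHS]integral_mkcond; apply: eq_integral => x _.
rewrite patchE indicE; case: ifPn => xA; first by rewrite mul1r.
by rewrite mul0r.
Qed.

Lemma centred_simple G Y (h : {nnsfun (g_sigma_algebraType G) >-> R}) :
  sub_sigma_algebra_of G -> centred G Y -> \int[P]_x (h x * Y x)%:E = 0.
Proof.
move=> sG [iY cY].
have GA y : G (h @^-1` [set y]).
  by rewrite -(measurable_sub _ sG); exact: measurable_sfunP.
have mA y : measurable (h @^-1` [set y] : set T) by exact: sG.2.
have fin := fimfunP h.
rewrite (eq_integral (fun x => \sum_(y <- fset_set (range h))
    (y%:E * (\1_(h @^-1` [set y] : set T) x * Y x)%:E))); last first.
  move=> x _; rewrite {1}(fimfunE h x) fsbig_finite //= mulr_suml sumEFin.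
  by congr EFin; apply: eq_bigr => y _; rewrite mulrA.
have iA y : P.-integrable setT (fun x => (\1_(h @^-1` [set y] : set T) x * Y x)%:E).
  apply: (le_integrable _ _ _ iY) => //.
    apply/measurable_EFinP; apply: measurable_funM.
      exact: measurable_indic.
    by apply/measurable_EFinP; exact: measurable_int iY.
  move=> x _ /=; rewrite lee_fin normrM indicE ler_piMl //.
  by case: (_ \in _); rewrite ?normr1 ?normr0.
rewrite integral_sum //; last by move=> y; exact: integrableZl.
apply: big1_seq => y _; rewrite integralZl // integral_indicM // cY ?mule0 //.
Qed.

(** Indicators are the definition and simple functions follow by linearity; a
    nonnegative X is approximated by simple functions under the dominating
    function |X Y|, and a general X is split into its positive and negative
    parts. *)
Lemma centred_pull_out G X Y : sub_sigma_algebra_of G -> centred G Y -> mwrt G X ->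
  P.-integrable setT (fun x => (X x * Y x)%:E) -> \int[P]_x (X x * Y x)%:E = 0.
Proof.
move=> sG cY mX iXY.
have mX' := mwrt_measurable sG mX.
have mY : measurable_fun setT Y.
  by apply/measurable_EFinP; exact: measurable_int (cY.1).
have ge0 X1 : mwrt G X1 -> (forall x, 0 <= X1 x)%R -> (forall x, X1 x <= `|X x|)%R ->
    \int[P]_x (X1 x * Y x)%:E = 0 /\ P.-integrable setT (fun x => (X1 x * Y x)%:E).
  move=> mX1 X10 X1X.
  have mX1E : measurable_fun [set: g_sigma_algebraType G] (EFin \o X1).
    exact/measurable_EFinP.
  pose h := nnsfun_approx measurableT mX1E.
  have mh n : measurable_fun setT (h n : T -> R).
    by apply: (mwrt_measurable sG); exact: measurable_funP.
  have hX n x : (h n x <= X1 x)%R.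
    rewrite -lee_fin /h nnsfun_approxE; apply: le_approx => //.
    by move=> z _ /=; rewrite lee_fin.
  have [] := @dominated_convergence _ _ R P setT measurableT
     (fun n x => (h n x * Y x)%:E) (fun x => (X1 x * Y x)%:E)
     (fun x => `|(X x * Y x)%:E|).
  - by move=> n; apply/measurable_EFinP; apply: measurable_funM.
  - apply/measurable_EFinP; apply: measurable_funM => //.
    exact: mwrt_measurable sG mX1.
  - apply: aeW => x _.
    under eq_fun do rewrite EFinM.
    rewrite EFinM; apply: cvgeZr => //.
    apply: (@cvg_nnsfun_approx _ (g_sigma_algebraType G)) => // z _.
    by rewrite /= lee_fin.
  - exact: integrable_abse.
  - apply: aeW => x n _ /=; rewrite lee_fin !normrM ler_wpM2r //.
    by rewrite ger0_norm // (le_trans (hX n x)).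
  move=> iX1 _; under eq_fun do rewrite centred_simple //.
  by move=> lim0; split=> //; rewrite -(cvg_lim _ lim0) // lim_cst.
have [p0 pi] : \int[P]_x ((X^\+)%R x * Y x)%:E = 0 /\
    P.-integrable setT (fun x => ((X^\+)%R x * Y x)%:E).
  apply: ge0 => [|x|x]; first exact: measurable_funrpos mX.
    exact: funrpos_ge0.
  by rewrite /funrpos ge_max normr_ge0 ler_norm.
have [q0 qi] : \int[P]_x ((X^\-)%R x * Y x)%:E = 0 /\
    P.-integrable setT (fun x => ((X^\-)%R x * Y x)%:E).
  apply: ge0 => [|x|x]; first exact: measurable_funrneg mX.
    exact: funrneg_ge0.
  by rewrite /funrneg ge_max normr_ge0 -normrN ler_norm.
rewrite (eq_integral (fun x => ((X^\+)%R x * Y x)%:E - ((X^\-)%R x * Y x)%:E)).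
  by rewrite integralB_EFin // p0 q0 sube0.
move=> x _; rewrite -EFinB -mulrBl; congr (_ * _)%:E.
by have /(congr1 (fun f => f x)) := esym (funrposBneg X).
Qed.

End centred.

(** * Conditional independence of samples *)

Section conditional_independence.
Context (R : realType) (d : measure_display) (T : measurableType d)
  (P : probability T R).
Implicit Types (G H : set (set T)) (X Y : T -> R).
Local Open Scope ereal_scope.

(** The event X < 0 belongs to G, so the integral of X over it vanishes. *)
Lemma ae_ge0 G X : sub_sigma_algebra_of G -> mwrt G X ->
  (forall A, G A -> 0 <= \int[P]_(x in A) (X x)%:E) -> {ae P, forall x, (0 <= X x)%R}.
Proof.
move=> sG mX X0; have mX' := mwrt_measurable sG mX.
pose A := X @^-1` `]-oo, 0%R[.
have GA : G A by move/(mwrtP _ sG) : mX; apply.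
have mA : measurable A by exact: sG.2.
have neg x : A x -> (X x < 0)%R by rewrite /A /= in_itv.
have intA : \int[P]_(x in A) `|(X x)%:E| = 0.
  apply/le_anti; rewrite integral_ge0 // andbT.
  have := X0 A GA; rewrite (eq_integral (fun x => - `|(X x)%:E|)).
    by rewrite integral_ge0N // oppe_ge0.
  by move=> x; rewrite inE => /neg Xx; rewrite abse_EFin ltr0_norm // EFinN oppeK.
have mXA : measurable_fun A (EFin \o X).
  by apply/measurable_EFinP; apply: measurable_funS mX'.
have /(ae_eq_integral_abs P mA mXA) := intA.
apply: filterS => x XA; rewrite leNgt; apply/negP => Xx.
have Ax : A x by rewrite /A /= in_itv.
by have := XA Ax; rewrite /= => -[] X0'; rewrite X0' ltxx in Xx.
Qed.

(** The events over which Y has integral 0 are closed under complements and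
    countable disjoint unions, hence Dynkin's lemma applies. *)
Lemma centred_generated H Y : setI_closed H -> H setT -> H `<=` measurable ->
  P.-integrable setT (EFin \o Y) ->
  (forall A, H A -> \int[P]_(x in A) (Y x)%:E = 0) -> centred P <<s H>> Y.
Proof.
move=> HI HT Hm iY Y0; split=> //.
have sub : <<s H>> `<=` measurable.
  by apply: smallest_sub => //; exact: sigma_algebra_measurable.
have iYA A : measurable A -> P.-integrable A (EFin \o Y).
  by move=> mA; apply: integrableS iY.
apply: (@dynkin_induction _ (g_sigma_algebraType H) H
  (fun A : set T => \int[P]_(x in A) (Y x)%:E = 0)) => //.
- exact: Y0.
- move=> A /sub mA A0; have := Y0 _ HT; rewrite -(setUv A) integral_setU //.
  + by rewrite A0 add0e.
  + exact: measurableC.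
  + by rewrite setUv; exact: measurable_int iY.
  + by apply/disj_set2P; exact: setICr.
- move=> F mF tF F0; rewrite integral_bigcup //.
  + by rewrite eseries0 // => k _ _; rewrite F0.
  + by move=> k; exact: (sub _ (mF k)).
  + by apply: iYA; apply: bigcup_measurable => k _; exact: (sub _ (mF k)).
Qed.

Lemma integrable_bounded_mul X Y : measurable_fun setT X ->
  (forall x, `|X x| <= 1)%R -> P.-integrable setT (EFin \o Y) ->
  P.-integrable setT (fun x => (X x * Y x)%:E).
Proof.
move=> mX X1 iY; apply: (le_integrable _ _ _ iY) => //.
  apply/measurable_EFinP; apply: measurable_funM => //.
  by apply/measurable_EFinP; exact: measurable_int iY.
by move=> x _ /=; rewrite lee_fin normrM ler_piMl.
Qed.

Lemma integrable_bounded X : measurable_fun setT X ->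
  (forall x, `|X x| <= 1)%R -> P.-integrable setT (EFin \o X).
Proof.
move=> mX X1; have := integrable_bounded_mul mX X1 (finite_measure_integrable_cst P 1%R measurableT).
by apply: eq_integrable => // x _ /=; rewrite mulr1.
Qed.

Lemma centredB G X Z : P.-integrable setT (EFin \o X) ->
  P.-integrable setT (EFin \o Z) -> G `<=` measurable ->
  (forall A, G A -> \int[P]_(x in A) (X x)%:E = \int[P]_(x in A) (Z x)%:E) ->
  centred P G (fun x => X x - Z x)%R.
Proof.
move=> iX iZ Gm XZ; split=> [|A GA].
  by apply: eq_integrable (integrableB measurableT iX iZ).
have mA := Gm _ GA.
rewrite integralB_EFin //; [|exact: integrableS iX|exact: integrableS iZ].
by rewrite XZ // subee // integrable_fin_num //; exact: integrableS iZ.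
Qed.

Lemma cond_exp_mwrt G X Z : sub_sigma_algebra_of G ->
  cond_exp P G (EFin \o X) (EFin \o Z) -> mwrt G Z.
Proof. by move=> sG [mZ _]; apply/measurable_EFinP; apply/(mwrtP _ sG). Qed.

(** Truncating a version of P(E | G) to [0, 1] changes it on a null set only, and
    makes its products with integrable functions integrable. *)
Lemma cond_prob_bounded G E Z : sub_sigma_algebra_of G -> measurable E ->
  cond_exp P G (fun x => (\1_E x)%:E) (fun x => (Z x)%:E) ->
  exists Z' : T -> R, [/\ mwrt G Z', forall x, (0 <= Z' x <= 1)%R,
    {ae P, forall x, Z x = Z' x} & centred P G (fun x => \1_E x - Z' x)%R].
Proof.
move=> sG mE ZE; have mZ := cond_exp_mwrt sG ZE; have {ZE} [_ ZE] := ZE.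
have mZT := mwrt_measurable sG mZ.
have Z0 : {ae P, forall x, (0 <= Z x)%R}.
  apply: (ae_ge0 sG mZ) => A GA; rewrite -ZE //.
  by apply: integral_ge0 => x _; rewrite lee_fin.
pose Z1 x := Num.max 0%R (Z x).
have mZ1 : mwrt G Z1 by apply: measurable_maxr => //; exact: measurable_cst.
have mZ1T := mwrt_measurable sG mZ1.
have ZZ1 : {ae P, forall x, Z x = Z1 x}.
  by apply: filterS Z0 => x; rewrite /Z1 => /max_idPr ->.
have Z1E A : G A -> \int[P]_(x in A) (Z1 x)%:E = P (E `&` A).
  move=> GA; have mA := sG.2 _ GA.
  rewrite -(integral_indic P mA mE) ZE //; apply: ae_eq_integral => //.
  - by apply/measurable_EFinP; exact: measurable_funTS.
  - by apply/measurable_EFinP; exact: measurable_funTS.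
  - by apply: filterS ZZ1 => x -> _.
have iZ1 : P.-integrable setT (EFin \o Z1).
  apply/integrableP; split; first exact/measurable_EFinP.
  rewrite (eq_integral (EFin \o Z1)); last first.
    by move=> x _; rewrite gee0_abs // lee_fin /Z1 le_max lexx.
  rewrite Z1E; first by rewrite (le_lt_trans (probability_le1 P _)) ?ltry //; exact: measurableI.
  by have [[G0 GC _] _] := sG; rewrite -(setD0 setT); exact: GC.
have Z1le : {ae P, forall x, (0 <= 1 - Z1 x)%R}.
  apply: (ae_ge0 sG); first by apply: measurable_funB => //; exact: measurable_cst.
  move=> A GA; have mA := sG.2 _ GA.
  rewrite (eq_integral (fun x => (cst 1%R x)%:E - (Z1 x)%:E)) //.
  rewrite integralB_EFin //; last 2 first.
  - exact: finite_measure_integrable_cst.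
  - exact: integrableS iZ1.
  rewrite (eq_integral (cst 1)) // integral_cst // mul1e Z1E // sube_ge0 ?fin_num_measure //; last exact: measurableI.
  by apply: le_measure; rewrite ?inE //; exact: measurableI.
pose Z2 x := Num.min 1%R (Z1 x).
have mZ2 : mwrt G Z2 by apply: measurable_minr => //; exact: measurable_cst.
have mZ2T := mwrt_measurable sG mZ2.
have Z12 : {ae P, forall x, Z1 x = Z2 x}.
  by apply: filterS Z1le => x; rewrite subr_ge0 /Z2 => /min_idPr ->.
have Z2b x : (0 <= Z2 x <= 1)%R.
  by rewrite /Z2 ge_min lexx /= le_min ler01 /Z1 le_max lexx.
exists Z2; split => //.
  by apply: filterS2 ZZ1 Z12 => x -> ->.
have Z2n x : (`|Z2 x| <= 1)%R by have /andP[h1 h2] := Z2b x; rewrite ger0_norm.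
apply: centredB => //.
- apply: integrable_bounded => // x.
  by rewrite indicE; case: (_ \in _); rewrite ?normr1 ?normr0.
- exact: integrable_bounded.
- exact: sG.2.
move=> A GA; have mA := sG.2 _ GA.
rewrite ZE //; apply: ae_eq_integral => //.
- by apply/measurable_EFinP; exact: measurable_funTS.
- by apply/measurable_EFinP; exact: measurable_funTS.
- by apply: filterS2 ZZ1 Z12 => x -> -> _.
Qed.

Lemma integralB0_eq A U V : measurable A ->
  P.-integrable A (EFin \o U) -> P.-integrable A (EFin \o V) ->
  \int[P]_(x in A) (U x - V x)%:E = 0 ->
  \int[P]_(x in A) (U x)%:E = \int[P]_(x in A) (V x)%:E.
Proof.
move=> mA iU iV; rewrite integralB_EFin //.
have := integrable_fin_num mA iU; have := integrable_fin_num mA iV.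
move=> /fineK <- /fineK <-; rewrite -EFinB => -[] /eqP.
by rewrite subr_eq0 => /eqP ->.
Qed.

Lemma pull_out_eq G X U V : sub_sigma_algebra_of G -> mwrt G X ->
  (forall x, `|X x| <= 1)%R ->
  P.-integrable setT (EFin \o U) -> P.-integrable setT (EFin \o V) ->
  centred P G (fun x => U x - V x)%R ->
  \int[P]_x (X x * U x)%:E = \int[P]_x (X x * V x)%:E.
Proof.
move=> sG mX X1 iU iV cUV; have mXT := mwrt_measurable sG mX.
have iXU := integrable_bounded_mul mXT X1 iU.
have iXV := integrable_bounded_mul mXT X1 iV.
apply: integralB0_eq => //.
under eq_integral do rewrite -mulrBr.
apply: (centred_pull_out sG cUV mX).
exact: integrable_bounded_mul cUV.1.
Qed.

Section join.
Context (d' : measure_display) (T' : measurableType d').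
Implicit Types (xi : T -> T').

Definition join_gen G xi : set (set T) :=
  [set C | exists2 A, G A & exists2 B, measurable B & C = A `&` xi @^-1` B].

(** The sigma-algebra generated by G and the random variable xi. *)
Definition join_sigma G xi := <<s join_gen G xi>>.

Variables (G : set (set T)) (xi : T -> T').
Hypotheses (sG : sub_sigma_algebra_of G) (mxi : measurable_fun setT xi).

Lemma sub_setT : G setT.
Proof. by have [[G0 GC _] _] := sG; rewrite -(setD0 setT); exact: GC. Qed.

Lemma sub_setI A B : G A -> G B -> G (A `&` B).
Proof.
by rewrite -!(measurable_sub _ sG) => mA mB; exact: measurableI.
Qed.

Lemma join_gen_measurable : join_gen G xi `<=` measurable.
Proof.
move=> _ [A GA [B mB ->]]; apply: measurableI; first exact: sG.2.
by rewrite -[_ @^-1` _]setTI; exact: mxi.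
Qed.

Lemma join_gen_setI : setI_closed (join_gen G xi).
Proof.
move=> _ _ [A GA [B mB ->]] [A' GA' [B' mB' ->]].
exists (A `&` A'); first exact: sub_setI.
exists (B `&` B'); first exact: measurableI.
by rewrite preimage_setI setIACA.
Qed.

Lemma join_gen_sub A : G A -> join_gen G xi A.
Proof. by move=> GA; exists A => //; exists setT => //; rewrite preimage_setT setIT. Qed.

Lemma join_sigma_sub : sub_sigma_algebra_of (join_sigma G xi).
Proof.
split; first exact: smallest_sigma_algebra.
apply: smallest_sub; [exact: sigma_algebra_measurable | exact: join_gen_measurable].
Qed.

Lemma sub_join_sigma : G `<=` join_sigma G xi.
Proof. by move=> A GA; apply: sub_sigma_algebra; exact: join_gen_sub. Qed.

Lemma mwrt_join_sigma : mwrt (join_sigma G xi) xi.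
Proof.
apply/(mwrtP _ join_sigma_sub) => B mB; apply: sub_sigma_algebra.
by exists setT; [exact: sub_setT | exists B => //; rewrite setTI].
Qed.

Lemma centred_join_sigma Y : P.-integrable setT (EFin \o Y) ->
  (forall A B, G A -> measurable B -> \int[P]_(x in A `&` xi @^-1` B) (Y x)%:E = 0) ->
  centred P (join_sigma G xi) Y.
Proof.
move=> iY Y0; apply: centred_generated => //.
- exact: join_gen_setI.
- exact/join_gen_sub/sub_setT.
- exact: join_gen_measurable.
by move=> _ [A GA [B mB ->]]; exact: Y0.
Qed.

End join.

Section pairs.
Context (d' : measure_display) (Xi : measurableType d') (n : nat).
Variables (G : set (set T)) (xi : 'I_n -> T -> Xi).
Hypotheses (sG : sub_sigma_algebra_of G)
  (mxi : forall i, measurable_fun setT (xi i)) (ind : cond_indep P G xi).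

Let ev i (B : set Xi) : set T := xi i @^-1` B.

Let mev i B : measurable B -> measurable (ev i B).
Proof. by move=> mB; rewrite /ev -[_ @^-1` _]setTI; exact: mxi. Qed.

Let indic1 (A : set T) x : (`|\1_A x : R| <= 1)%R.
Proof. by rewrite indicE; case: (_ \in _); rewrite ?normr1 ?normr0. Qed.

Let iindic (A : set T) : measurable A -> P.-integrable setT (EFin \o (\1_A : T -> R)).
Proof. by move=> mA; apply: integrable_bounded => //; exact: measurable_indic. Qed.

Let mwrt_indic A : G A -> mwrt G (\1_A : T -> R).
Proof. by move=> GA; apply: measurable_indic; rewrite measurable_sub. Qed.

(** Given G, revealing xi_j does not alter the probability that xi_i is in B.
    The independence of the family is applied to B at i, to an arbitrary C at j,
    and to the whole space elsewhere, where the conditional probabilities are 1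
    almost surely. *)
Lemma cond_indep_pair i j B : i != j -> measurable B ->
  exists Z : T -> R, [/\ mwrt G Z, forall x, (0 <= Z x <= 1)%R &
    centred P (join_sigma G (xi j)) (fun x => \1_(xi i @^-1` B) x - Z x)%R].
Proof.
move=> ij mB; pose fam C k := if k == i then B else if k == j then C else setT.
have mfam C : measurable C -> forall k, measurable (fam C k).
  by move=> mC k; rewrite /fam; case: ifP => // _; case: ifP.
have [z zE _] := ind (mfam setT measurableT).
have := zE i; rewrite /fam eqxx => /(cond_prob_bounded sG (mev i mB)).
move=> [Z [mZ Z01 _ cZ]]; exists Z; split => //.
have mZT := mwrt_measurable sG mZ.
have b01 (U : T -> R) : (forall x, (0 <= U x <= 1)%R) -> forall x, (`|U x| <= 1)%R.
  by move=> U01 x; have /andP[h1 h2] := U01 x; rewrite ger0_norm.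
have iZ : P.-integrable setT (EFin \o Z) by apply: integrable_bounded => //; exact: b01.
have iE := iindic (mev i mB).
apply: centred_join_sigma => //.
  by apply: eq_integrable (integrableB measurableT iE iZ).
move=> A C GA mC; have mA := sG.2 _ GA; have mF := mev j mC.
have mAF : measurable (A `&` ev j C) by exact: measurableI.
rewrite integralB_EFin //; [|exact: integrableS iE|exact: integrableS iZ].
suff -> : \int[P]_(x in A `&` ev j C) (Z x)%:E =
    \int[P]_(x in A `&` ev j C) (\1_(ev i B) x)%:E.
  by rewrite subee // integrable_fin_num //; exact: integrableS iE.
have [z' z'E interE] := ind (mfam C mC).
have := z'E i; rewrite /fam eqxx => /(cond_prob_bounded sG (mev i mB)).
move=> [Zi [mZi Zi01 aeZi cZi]].
have := z'E j; rewrite /fam eqxx eq_sym (negPf ij) => /(cond_prob_bounded sG mF).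
move=> [Zj [mZj Zj01 aeZj cZj]].
have aez k : k != i -> k != j -> {ae P, forall x, z' k x = 1%R}.
  move=> ki kj; have := z'E k; rewrite /fam (negPf ki) (negPf kj).
  move=> /(cond_prob_bounded sG (mev k measurableT)) [Zk [mZk Zk01 aeZk cZk]].
  have : {ae P, forall x, (0 <= Zk x - 1)%R}.
    apply: (ae_ge0 sG); first by apply: measurable_funB => //; exact: measurable_cst.
    move=> A' GA'; have mA' := sG.2 _ GA'.
    have := cZk.2 _ GA'.
    rewrite (eq_integral (fun x => - (Zk x - 1)%:E)) => [|x _]; last first.
      rewrite /ev preimage_setT indicT; congr EFin.
      by rewrite opprB.
    have iZk : P.-integrable A' (EFin \o Zk).
      apply: (@integrableS _ _ _ P setT) => //.
      by apply: integrable_bounded; [exact: mwrt_measurable mZk | exact: b01].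
    have iZk1 : P.-integrable A' (fun x => (Zk x - 1)%:E).
      by apply: eq_integrable (integrableB mA' iZk (finite_measure_integrable_cst P 1%R mA')).
    rewrite integralN ?fin_num_adde_defl //; last first.
      by rewrite fin_numN; exact: integrable_neg_fin_num.
    by move=> /eqP; rewrite oppe_eq0 => /eqP ->.
  apply: filterS2 aeZk => x ->; have /andP[_] := Zk01 x.
  by rewrite subr_ge0 => h1 h2; apply/le_anti; rewrite h1 h2.
(* Only the factors at i and j are left in the product of the family. *)
have aeprod : {ae P, forall x, (\prod_k z' k x = Zi x * Zj x)%R}.
  have : {ae P, forall x, forall k, k != i -> k != j -> z' k x = 1%R}.
    apply: filter_forall => k; have [->|ki] := eqVneq k i; first exact: aeW.
    by have [->|kj] := eqVneq k j; [exact: aeW | apply: filterS (aez k ki kj)].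
  apply: filterS3 aeZi aeZj => x Zix Zjx zk.
  rewrite (bigD1 i) //= (bigD1 j) //= 1?eq_sym // big1 ?mulr1 ?Zix ?Zjx // => k.
  by move=> /andP[]; exact: zk.
have iZi : P.-integrable setT (EFin \o Zi).
  by apply: integrable_bounded; [exact: mwrt_measurable mZi | exact: b01].
have iZj : P.-integrable setT (EFin \o Zj).
  by apply: integrable_bounded; [exact: mwrt_measurable mZj | exact: b01].
have bM (U V : T -> R) : (forall x, `|U x| <= 1)%R -> (forall x, `|V x| <= 1)%R ->
    forall x, (`|U x * V x| <= 1)%R.
  by move=> U1 V1 x; rewrite normrM -[leRHS]mulr1 ler_pM.
have mA1 := mwrt_indic GA.
have step1 : \int[P]_(x in A `&` ev j C) (Z x)%:E =
    \int[P]_x ((\1_A x * Z x) * Zj x)%:E.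
  rewrite -integral_indicM // -(@pull_out_eq G (fun x => \1_A x * Z x)%R (\1_(ev j C)) Zj) //.
  - by apply: eq_integral => x _; rewrite indicI /= mulrAC.
  - exact: measurable_funM.
  - by apply: bM => //; exact: b01.
  - exact: iindic.
have step2 : \int[P]_x ((\1_A x * Z x) * Zj x)%:E =
    \int[P]_x ((\1_A x * Zj x) * Zi x)%:E.
  rewrite -(@pull_out_eq G (fun x => \1_A x * Zj x)%R Z Zi) //.
  - by apply: eq_integral => x _; rewrite mulrAC.
  - exact: measurable_funM.
  - by apply: bM => //; exact: b01.
  - apply: centredB => //; first exact: sG.2.
    move=> A' GA'; have mA' := sG.2 _ GA'.
    have h (U : T -> R) : P.-integrable setT (EFin \o U) ->
        centred P G (fun x => \1_(ev i B) x - U x)%R ->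
        \int[P]_(x in A') (U x)%:E = \int[P]_(x in A') (\1_(ev i B) x)%:E.
      move=> iU [_ /(_ _ GA')] /integralB0_eq -> //;
        [exact: integrableS iE|exact: integrableS iU].
    by rewrite !h.
rewrite step1 step2.
have mprod : measurable_fun setT (fun x => \prod_k z' k x)%R.
  apply: (mwrt_measurable sG); apply/measurable_EFinP; apply/(mwrtP _ sG).
  exact: interE.1.
transitivity (\int[P]_(x in A) (\prod_k z' k x)%R%:E).
  rewrite -(integral_indicM P _ mA); apply: ae_eq_integral => //.
  - apply/measurable_EFinP; apply: measurable_funM; last exact: mwrt_measurable mZi.
    by apply: measurable_funM; [exact: measurable_indic | exact: mwrt_measurable mZj].
  - by apply/measurable_EFinP; apply: measurable_funM => //; exact: measurable_indic.
  - by apply: filterS aeprod => x -> _; rewrite [(Zi x * _)%R]mulrC mulrA.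
rewrite -interE.2 // -(integral_indicM P _ mA) -(integral_indicM P _ mAF).
apply: eq_integral => x _.
congr EFin.
rewrite -[LHS]/((\1_A \* \1_(\bigcap_k (xi k @^-1` fam C k)))%R x) -indicI.
rewrite -[RHS]/((\1_(A `&` ev j C) \* \1_(ev i B))%R x) -indicI -setIA; congr (\1_(A `&` _) x).
apply/seteqP; split => y.
  move=> h; split; first by have := h j Logic.I; rewrite /fam eqxx eq_sym (negPf ij).
  by have := h i Logic.I; rewrite /fam eqxx.
move=> [hj hi] k _; rewrite /fam /=; case: eqP => [->//|_].
by case: eqP => [->|].
Qed.

(** It suffices that Yj remains centred when xi_i is revealed.  Over an event
    that is the intersection of A in G with xi_i in B, the indicator of the
    latter may be replaced by its probability given G, as revealing xi_j does
    not alter it ([cond_indep_pair]); that probability is measurable with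
    respect to G and is pulled out. *)
Lemma cond_indep_uncorrelated i j (Yi Yj : T -> R) : i != j ->
  mwrt (join_sigma G (xi i)) Yi -> mwrt (join_sigma G (xi j)) Yj ->
  centred P G Yj -> P.-integrable setT (fun x => (Yi x * Yj x)%:E) ->
  \int[P]_x (Yi x * Yj x)%:E = 0.
Proof.
move=> ij mYi mYj cYj iYij.
have sGi := join_sigma_sub sG (mxi i); have sGj := join_sigma_sub sG (mxi j).
suff cYj' : centred P (join_sigma G (xi i)) Yj by exact: centred_pull_out cYj' mYi iYij.
apply: centred_join_sigma => //; first exact: cYj.1.
move=> A B GA mB; have mA := sG.2 _ GA; have mE := mev i mB.
have [Z [mZ Z01 cZ]] := cond_indep_pair ij mB.
have Z1 x : (`|Z x| <= 1)%R by have /andP[h1 h2] := Z01 x; rewrite ger0_norm.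
have mZT := mwrt_measurable sG mZ.
have mAE : measurable (A `&` xi i @^-1` B) by exact: measurableI.
have iY := cYj.1.
have mAT : measurable_fun setT (\1_A : T -> R) by exact: measurable_indic.
have iAY := integrable_bounded_mul mAT (indic1 A) iY.
have mAY : mwrt (join_sigma G (xi j)) (fun x => \1_A x * Yj x)%R.
  apply: measurable_funM => //.
  exact: mwrt_sub sGj (@sub_join_sigma _ _ G (xi j)) (mwrt_indic GA).
have iE := integrable_bounded_mul (measurable_indic mE) (indic1 _) iAY.
have iZ := integrable_bounded_mul mZT Z1 iAY.
rewrite -integral_indicM //.
transitivity (\int[P]_x (\1_(xi i @^-1` B) x * (\1_A x * Yj x))%:E).
  by apply: eq_integral => x _; rewrite indicI /= mulrCA mulrA.
transitivity (\int[P]_x (Z x * (\1_A x * Yj x))%:E).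
  have eYZ x : (\1_(xi i @^-1` B) x * (\1_A x * Yj x) - Z x * (\1_A x * Yj x) =
      \1_A x * Yj x * (\1_(xi i @^-1` B) x - Z x))%R by rewrite -mulrBl mulrC.
  apply: integralB0_eq => //; under eq_integral do rewrite eYZ.
  apply: (centred_pull_out sGj cZ mAY).
  by apply: eq_integrable (integrableB measurableT iE iZ) => // x _ /=; rewrite -EFinB eYZ.
under eq_integral do rewrite mulrA.
apply: (centred_pull_out sG cYj); first by apply: measurable_funM => //; exact: mwrt_indic.
by apply: eq_integrable iZ => // x _; rewrite mulrA.
Qed.

End pairs.
End conditional_independence.

(** * Random vectors and Borel sets *)

Section borel_rV.
Context (R : realType) (p : nat).

Lemma continuous_borel_rV (h : 'rV[R]_p -> R) :
  continuous h -> measurable_fun setT (h : borel_rV R p -> R).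
Proof.
move=> ch; apply: (measurability _ (RGenOInfty.measurableE R)).
move=> _ [_ [a ->] <-]; rewrite setTI; apply: sub_sigma_algebra.
by move/continuousP: ch; apply; exact: interval_open.
Qed.

Definition rat_box (q : 'rV[rat]_p) (k : nat) : set 'rV[R]_p :=
  [set y | forall j, `|y 0 j - ratr (q 0 j)| < k.+1%:R^-1].

(** The boxes with rational centre and radius 1 / (k + 1) are countably many, so
    that the Borel sets are generated by the coordinates. *)
Lemma open_rat_box (U : set 'rV[R]_p) : open U ->
  U = \bigcup_(qk in [set qk : 'rV[rat]_p * nat | rat_box qk.1 qk.2 `<=` U])
        rat_box qk.1 qk.2.
Proof.
move=> oU; apply/seteqP; split => [x Ux|x [qk /= sub]]; last exact: sub.
have /nbhs_ballP[e /= e0 xeU] := open_nbhs_nbhs (conj oU Ux).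
have [k ke] : exists k, 2 * k.+1%:R^-1 < e.
  have [k] := ltr_add_invr (divr_gt0 e0 (ltr0n R 2)).
  rewrite add0r => ke; exists k.
  by move: ke; rewrite ltr_pdivlMr // mulrC.
have k0 : 0 < k.+1%:R^-1 :> R by rewrite invr_gt0.
move: k0 ke; set c := k.+1%:R^-1 => k0 ke.
have approx j : exists a : rat, `|x 0 j - ratr a| < c.
  have lt_c : x 0 j - c < x 0 j + c by rewrite ltrBlDr -addrA ltrDl addr_gt0.
  have [a] := rat_in_itvoo lt_c.
  rewrite in_itv /= => /andP[h1 h2]; exists a.
  by rewrite ltr_distlC h1 h2.
have [a aP] := choice approx.
exists (\row_j a j, k) => /= [y yb|j]; last by rewrite mxE.
apply: xeU; split => // i j; rewrite ord1 /ball /=.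
apply: le_lt_trans ke.
have := aP j; have := yb j; rewrite mxE => h1 h2.
have -> : x 0 j - y 0 j = (x 0 j - ratr (a j)) - (y 0 j - ratr (a j)) by ring.
by apply: le_trans (ler_normB _ _) _; rewrite mulr2n mulrDl mul1r lerD // ltW.
Qed.

Context (d : measure_display) (T : measurableType d).

Lemma measurable_rV (X : T -> 'rV[R]_p) :
  (forall j, measurable_fun setT (fun w => X w 0 j)) ->
  measurable_fun setT (X : T -> borel_rV R p).
Proof.
move=> mX; apply: (@measurability _ _ T (borel_rV R p) setT X (@open 'rV[R]_p)) => //.
move=> _ [U oU <-]; rewrite setTI.
rewrite (open_rat_box oU) preimage_bigcup bigcup_mkcond.
apply: countable_bigcupT_measurable; first exact: countableP.
move=> [q k]; case: ifP => // _.
have -> : X @^-1` rat_box q k =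
    \bigcap_(j : 'I_p) ((fun w => X w 0 j) @^-1` ball (ratr (q 0 j) : R) (k.+1%:R^-1)).
  apply/seteqP; split => w /= h j; first by move=> _; rewrite /ball /= distrC; exact: h.
  by have := h j Logic.I; rewrite /ball /= distrC.
apply: fin_bigcap_measurable => [|j _]; first exact: finite_finset.
rewrite -[X in measurable X]setTI; apply: mX => //.
by apply: open_measurable; exact: ball_open.
Qed.

Lemma measurable_rV_coord (X : T -> 'rV[R]_p) j :
  measurable_fun setT (X : T -> borel_rV R p) -> measurable_fun setT (fun w => X w 0 j).
Proof.
move=> mX; have mc : measurable_fun setT ((fun v : 'rV[R]_p => v 0 j) : borel_rV R p -> R).
  by apply: continuous_borel_rV; exact: coord_continuous.
exact: measurableT_comp mc mX.
Qed.

End borel_rV.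

(** * Expectation of square integrable matrices *)

Section expectation.
Context (R : realType) (d : measure_display) (T : measurableType d)
  (P : probability T R).
Implicit Types (G : set (set T)) (X Y : T -> R).

Definition intg X : Prop := P.-integrable setT (EFin \o X).

Definition Ex X : R := \int[P]_x X x.

Lemma ExE X : intg X -> (\int[P]_x (X x)%:E = (Ex X)%:E)%E.
Proof. by move=> iX; rewrite /Ex /Rintegral fineK // integrable_fin_num. Qed.

Lemma intgD X Y : intg X -> intg Y -> intg (fun x => X x + Y x).
Proof. by move=> iX iY; apply: eq_integrable (integrableD measurableT iX iY). Qed.

Lemma intgZ a X : intg X -> intg (fun x => a * X x).
Proof. by move=> iX; apply: eq_integrable (integrableZl measurableT a iX). Qed.

Lemma intgB X Y : intg X -> intg Y -> intg (fun x => X x - Y x).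
Proof. by move=> iX iY; apply: eq_integrable (integrableB measurableT iX iY). Qed.

Lemma intg_cst a : intg (fun=> a).
Proof. exact: finite_measure_integrable_cst. Qed.

Lemma intg_sum (I : Type) (s : seq I) (X : I -> T -> R) :
  (forall i, intg (X i)) -> intg (fun x => \sum_(i <- s) X i x).
Proof.
move=> iX; elim: s => [|i s IH].
  by apply: eq_integrable (intg_cst 0) => // x _ /=; rewrite big_nil.
by apply: eq_integrable (intgD (iX i) IH) => // x _ /=; rewrite big_cons.
Qed.

Lemma ExD X Y : intg X -> intg Y -> Ex (fun x => X x + Y x) = Ex X + Ex Y.
Proof. by move=> iX iY; rewrite /Ex RintegralD. Qed.

Lemma ExB X Y : intg X -> intg Y -> Ex (fun x => X x - Y x) = Ex X - Ex Y.
Proof. by move=> iX iY; rewrite /Ex RintegralB. Qed.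

Lemma ExZ a X : intg X -> Ex (fun x => a * X x) = a * Ex X.
Proof. by move=> iX; rewrite /Ex RintegralZl. Qed.

Lemma Ex_cst a : Ex (fun=> a) = a.
Proof.
by have := expectation_cst P a; rewrite unlock /Ex /Rintegral => ->.
Qed.

Lemma Ex_sum (I : Type) (s : seq I) (X : I -> T -> R) :
  (forall i, intg (X i)) -> Ex (fun x => \sum_(i <- s) X i x) = \sum_(i <- s) Ex (X i).
Proof.
move=> iX; elim: s => [|i s IH].
  rewrite big_nil -[RHS](Ex_cst 0); congr Ex.
  by apply/funext => x; rewrite big_nil.
rewrite big_cons -IH -ExD //; last exact: intg_sum.
by congr Ex; apply/funext => x; rewrite big_cons.
Qed.

Lemma le_Ex X Y : intg X -> intg Y -> (forall x, X x <= Y x) -> Ex X <= Ex Y.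
Proof. by move=> iX iY XY; apply: le_Rintegral. Qed.

Lemma le_intg X Y : measurable_fun setT X -> (forall x, `|X x| <= Y x) ->
  intg Y -> intg X.
Proof.
move=> mX XY iY; apply: (le_integrable _ _ _ iY) => //; first exact/measurable_EFinP.
by move=> x _ /=; rewrite lee_fin (le_trans (XY x)) // ler_norm.
Qed.

Definition sqi G X : Prop := mwrt G X /\ intg (fun x => X x ^+ 2).

(** The product is dominated by X^2 + Y^2. *)
Lemma intgM G G' X Y : sub_sigma_algebra_of G -> sub_sigma_algebra_of G' ->
  sqi G X -> sqi G' Y -> intg (fun x => X x * Y x).
Proof.
move=> sG sG' [mX iX] [mY iY].
apply: (le_intg _ _ (intgD iX iY)).
  by apply: measurable_funM; [exact: mwrt_measurable mX | exact: mwrt_measurable mY].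
move=> x; rewrite normrM -[X x ^+ 2]real_normK ?num_real // -[Y x ^+ 2]real_normK ?num_real //.
have := sqr_ge0 (`|X x| - `|Y x|); have := mulr_ge0 (normr_ge0 (X x)) (normr_ge0 (Y x)).
move: `|X x| `|Y x| => a b; rewrite sqrrB !expr2; lra.
Qed.

Lemma sqi_cst G a : sqi G (fun=> a).
Proof. by split; [exact: measurable_cst | exact: intg_cst]. Qed.

Section closure.
Variable G : set (set T).
Hypothesis sG : sub_sigma_algebra_of G.

Lemma sqiD X Y : sqi G X -> sqi G Y -> sqi G (fun x => X x + Y x).
Proof.
move=> sX sY; split; first exact: measurable_funD sX.1 sY.1.
have iXY := intgM sG sG sX sY.
apply: eq_integrable (intgD (intgD sX.2 (intgZ 2 iXY)) sY.2) => // x _ /=.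
by congr EFin; ring.
Qed.

Lemma sqiZ a X : sqi G X -> sqi G (fun x => a * X x).
Proof.
move=> [mX iX]; split; first by apply: measurable_funM mX; exact: measurable_cst.
by apply: eq_integrable (intgZ (a ^+ 2) iX) => // x _ /=; rewrite exprMn.
Qed.

Lemma sqi_sum (I : Type) (s : seq I) (X : I -> T -> R) :
  (forall i, sqi G (X i)) -> sqi G (fun x => \sum_(i <- s) X i x).
Proof.
move=> sX; elim: s => [|i s IH].
  by under eq_fun do rewrite big_nil; exact: sqi_cst.
by under eq_fun do rewrite big_cons; exact: sqiD.
Qed.

Lemma sqi_dominated X Y : mwrt G X -> (forall x, X x ^+ 2 <= Y x) -> intg Y -> sqi G X.
Proof.
move=> mX XY iY; split=> //; apply: le_intg iY => [|x].
  by apply: measurable_funX; exact: mwrt_measurable mX.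
by rewrite ger0_norm ?sqr_ge0.
Qed.

Definition L2 m n (A : T -> 'M[R]_(m, n)) : Prop := forall i j, sqi G (fun x => A x i j).

Context (m n : nat).
Implicit Types A B : T -> 'M[R]_(m, n).

Lemma L2_cst (M : 'M[R]_(m, n)) : L2 (fun=> M).
Proof. by move=> i j; exact: sqi_cst. Qed.

Lemma L2D A B : L2 A -> L2 B -> L2 (fun x => A x + B x).
Proof. by move=> lA lB i j; under eq_fun do rewrite mxE; exact: sqiD. Qed.

Lemma L2Z a A : L2 A -> L2 (fun x => a *: A x).
Proof. by move=> lA i j; under eq_fun do rewrite mxE; exact: sqiZ. Qed.

Lemma L2N A : L2 A -> L2 (fun x => - A x).
Proof. by move=> lA; under eq_fun do rewrite -scaleN1r; exact: L2Z. Qed.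

Lemma L2B A B : L2 A -> L2 B -> L2 (fun x => A x - B x).
Proof. by move=> lA lB; apply: L2D lA (L2N lB). Qed.

Lemma L2_mulmx l (M : 'M[R]_(l, m)) A : L2 A -> L2 (fun x => M *m A x).
Proof.
move=> lA i j; under eq_fun do rewrite mxE.
by apply: sqi_sum => k; exact: sqiZ.
Qed.

End closure.

Lemma L2_sub G G' m n (A : T -> 'M[R]_(m, n)) : sub_sigma_algebra_of G ->
  sub_sigma_algebra_of G' -> G `<=` G' -> L2 G A -> L2 G' A.
Proof.
move=> sG sG' GG' lA i j; split; last exact: (lA i j).2.
exact: mwrt_sub sG' GG' (lA i j).1.
Qed.

Lemma intg_dot G G' m n (A B : T -> 'M[R]_(m, n)) : sub_sigma_algebra_of G ->
  sub_sigma_algebra_of G' -> L2 G A -> L2 G' B -> intg (fun x => dot (A x) (B x)).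
Proof.
move=> sG sG' lA lB; under eq_fun do rewrite dotE.
by do 2!apply: intg_sum => ?; exact: intgM (lA _ _) (lB _ _).
Qed.

Lemma Ex_dot G G' m n (A B : T -> 'M[R]_(m, n)) : sub_sigma_algebra_of G ->
  sub_sigma_algebra_of G' -> L2 G A -> L2 G' B ->
  Ex (fun x => dot (A x) (B x)) = \sum_i \sum_j Ex (fun x => A x i j * B x i j).
Proof.
move=> sG sG' lA lB; under eq_fun do rewrite dotE.
rewrite Ex_sum => [|i]; last by apply: intg_sum => j; exact: intgM (lA _ _) (lB _ _).
apply: eq_bigr => i _; rewrite Ex_sum // => j; exact: intgM (lA _ _) (lB _ _).
Qed.

Lemma Ex_dot_centred G G' m n (A B : T -> 'M[R]_(m, n)) : sub_sigma_algebra_of G ->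
  sub_sigma_algebra_of G' -> L2 G A -> L2 G' B ->
  (forall i j, centred P G (fun x => B x i j)) -> Ex (fun x => dot (A x) (B x)) = 0.
Proof.
move=> sG sG' lA lB cB; rewrite (Ex_dot sG sG') //.
apply: big1 => i _; apply: big1 => j _.
have iAB := intgM sG sG' (lA i j) (lB i j).
have := ExE iAB; rewrite (centred_pull_out sG (cB i j) (lA i j).1 iAB).
by case.
Qed.

(** A conditional expectation has the same integral as the function itself. *)
Lemma Ex_sqdist_le G p (X m : T -> 'rV[R]_p) (b : T -> R) :
  (forall j, measurable_fun setT (fun w => X w 0 j - m w 0 j)) ->
  cond_sqdist_le P G X m b -> intg b -> (forall w, 0 <= b w) -> sub_sigma_algebra_of G ->
  intg (fun w => sq (X w - m w)) /\ Ex (fun w => sq (X w - m w)) <= Ex b.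
Proof.
move=> mXm [V [mV VE] Vb] ib b0 sG.
have msq : measurable_fun setT (fun w => sq (X w - m w)).
  under eq_fun do rewrite dotE.
  apply: measurable_sum => i; apply: measurable_sum => j; rewrite ord1.
  by apply: measurable_funM; under eq_fun do rewrite !mxE; exact: mXm.
have mVT : measurable_fun setT V.
  exact: mwrt_measurable sG (proj2 (mwrtP _ sG) mV).
have le_b : (\int[P]_w (sq (X w - m w))%:E <= \int[P]_w (b w)%:E)%E.
  have -> : (\int[P]_w (sq (X w - m w))%:E = \int[P]_w V w)%E.
    rewrite -VE; last by have [[G0 GC _] _] := sG; rewrite -(setD0 setT); exact: GC.
    by apply: eq_integral => w _; rewrite frob_sqr.
  apply: (@le_trans _ _ (\int[P]_w (V^\+ w))%E).
    by rewrite integralE geeDl // oppe_le0 integral_ge0.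
  apply: ae_ge0_le_integral => //.
  - exact: measurable_funepos.
  - by move=> w _; rewrite lee_fin.
  - exact: measurable_int ib.
  - apply: filterS Vb => w Vw _; rewrite funeposE ge_max Vw.
    by rewrite lee_fin b0.
have isq : intg (fun w => sq (X w - m w)).
  apply/integrableP; split; first exact/measurable_EFinP.
  rewrite (eq_integral (fun w => (sq (X w - m w))%:E)); last first.
    by move=> w _; rewrite gee0_abs // lee_fin sq_ge0.
  by apply: le_lt_trans le_b _; rewrite (ExE ib) ltry.
split=> //; move: le_b; rewrite (ExE ib) (ExE isq) lee_fin //.
Qed.

End expectation.

(** * Noise of the gradients and of the compression *)

Lemma sq_entry_le (R : realType) m n (A : 'M[R]_(m, n)) i j : A i j ^+ 2 <= sq A.
Proof.
rewrite dotE (bigD1 i) //= (bigD1 j) //= -expr2 -addrA lerDl.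
by rewrite addr_ge0 //; do ?apply: sumr_ge0 => ? _; rewrite -?expr2 ?sqr_ge0.
Qed.

Section gradient_measurability.
Context (R : realType) (n p : nat) (L : R) (f : 'I_n -> 'rV[R]_p -> R).
Hypotheses (L_gt0 : 0 < L) (sm : smooth L f).

Lemma grad_coord_continuous i j : continuous (fun v : 'rV[R]_p => grad (f i) v 0 j).
Proof.
move=> v U /nbhs_ballP[e /= e0 eU].
pose c : R := (L * p.+1%:R).
have c0 : 0 < c by rewrite mulr_gt0.
apply/(@nbhs_ballP _ 'rV[R]_p); exists (e / c); first exact: divr_gt0.
move=> u [_ vu]; apply: eU; rewrite /ball /=.
rewrite -(ltr_pXn2r (_ : 0 < 2)%N) ?nnegrE ?normr_ge0 ?ltW // real_normK ?num_real //.
have -> : grad (f i) v 0 j - grad (f i) u 0 j = (grad (f i) v - grad (f i) u) 0 j.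
  by rewrite !mxE.
apply: le_lt_trans (sq_entry_le _ _ _) _.
apply: le_lt_trans (sq_grad_lip L_gt0 (sm.2 i) v u) _.
have -> : e ^+ 2 = L ^+ 2 * (p.+1%:R ^+ 2 * (e / c) ^+ 2).
  have q0 : p.+1%:R != 0 :> R by rewrite pnatr_eq0.
  by move: q0; rewrite /c; move: (p.+1%:R) => q q0; field; rewrite q0 lt0r_neq0.
rewrite ltr_pM2l ?exprn_gt0 //.
apply: (@le_lt_trans _ _ (p%:R * (e / c) ^+ 2)).
  rewrite dotE big_ord1 mulr_natl -[X in _ *+ X]card_ord -sumr_const.
  apply: ler_sum => k _; rewrite -expr2 -[leLHS]real_normK ?num_real // !expr2.
  have /ltW vuk : `|(v - u) 0 k| < e / c by rewrite !mxE; exact: vu.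
  by apply: ler_pM.
rewrite ltr_pM2r ?exprn_gt0 ?divr_gt0 // -natrX ltr_nat.
by rewrite (leq_trans (ltnSn p)) // -{1}[p.+1]muln1 leq_mul.
Qed.

Context (d : measure_display) (T : measurableType d) (Pr : probability T R).

(** A Lipschitz gradient is continuous and grows at most linearly. *)
Lemma L2_grad_rows G (x : T -> 'M[R]_(n, p)) : sub_sigma_algebra_of G ->
  L2 Pr G x -> L2 Pr G (fun w => grad_rows f (x w)).
Proof.
move=> sG lx i j; apply: (@sqi_dominated _ _ _ _ _ sG _ (fun w => 2 * sq (grad_rows f 0) +
    2 * L ^+ 2 * sq (x w))).
- have mrow : measurable_fun [set: g_sigma_algebraType G]
      ((fun w => row i (x w)) : g_sigma_algebraType G -> borel_rV R p).
    by apply: measurable_rV => k; under eq_fun do rewrite mxE; exact: (lx i k).1.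
  rewrite /mwrt; under eq_fun do rewrite mxE.
  exact: measurableT_comp (continuous_borel_rV (@grad_coord_continuous i j)) mrow.
- move=> w; apply: le_trans (sq_entry_le _ _ _) _.
  have := sqD2_le (grad_rows f (x w) - grad_rows f 0) (grad_rows f 0); rewrite subrK.
  have := sq_grad_rows_lip L_gt0 sm (x w) 0; rewrite subr0.
  by move: (sq (x w)) (sq (grad_rows f 0)) => a b; lra.
by apply: intgD; [exact: intg_cst | apply: intgZ; exact: (intg_dot sG sG lx lx)].
Qed.

End gradient_measurability.

Section gradient_noise.
Context (R : realType) (n p : nat) (L : R) (f : 'I_n -> 'rV[R]_p -> R).
Context (d d' : measure_display) (T : measurableType d) (Pr : probability T R)
  (Xi : measurableType d').
Variables (sgrad : 'I_n -> Xi -> 'rV[R]_p -> 'rV[R]_p) (sigma : R)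
  (G : set (set T)) (x : T -> 'M[R]_(n, p)) (xi : 'I_n -> T -> Xi).
Hypotheses (n_gt0 : (0 < n)%N) (L_gt0 : 0 < L) (sm : smooth L f)
  (sG : sub_sigma_algebra_of G) (lx : L2 Pr G x)
  (mxi : forall i, measurable_fun setT (xi i))
  (msg : forall i, measurable_fun setT
     (fun u : Xi * borel_rV R p => sgrad i u.1 u.2 : borel_rV R p))
  (ind : cond_indep Pr G xi)
  (unb : forall i, cond_mean Pr G (fun w => sgrad i (xi i w) (row i (x w)))
     (fun w => grad (f i) (row i (x w))))
  (var : forall i, cond_sqdist_le Pr G (fun w => sgrad i (xi i w) (row i (x w)))
     (fun w => grad (f i) (row i (x w))) (fun=> sigma ^+ 2)).

Definition grad_noise (w : T) : 'M[R]_(n, p) :=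
  \matrix_(i, j) sgrad i (xi i w) (row i (x w)) 0 j - grad_rows f (x w).
Local Notation S := grad_noise.

Let lg : L2 Pr G (fun w => grad_rows f (x w)).
Proof. exact: (L2_grad_rows L_gt0 sm sG lx). Qed.

Lemma grad_noise_mwrt G' i j : sub_sigma_algebra_of G' -> G `<=` G' -> mwrt G' (xi i) ->
  mwrt G' (fun w => S w i j).
Proof.
move=> sG' GG' mx; rewrite /mwrt; under eq_fun do rewrite mxE [X in X + _]mxE [X in _ + X]mxE.
apply: measurable_funB; last exact: (mwrt_sub sG sG' GG' (lg i j).1).
have mrow : measurable_fun [set: g_sigma_algebraType G']
    ((fun w => row i (x w)) : g_sigma_algebraType G' -> borel_rV R p).
  apply: measurable_rV => k; under eq_fun do rewrite mxE.
  exact: (mwrt_sub sG sG' GG' (lx i k).1).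
apply: (@measurable_rV_coord _ _ _ (g_sigma_algebraType G')
  (fun w => sgrad i (xi i w) (row i (x w))) j).
exact: measurableT_comp (msg i) (measurable_fun_pair mx mrow).
Qed.

Let sq_row_noise i : intg Pr (fun w => sq (row i (S w))) /\
  Ex Pr (fun w => sq (row i (S w))) <= sigma ^+ 2.
Proof.
have rowE w : row i (S w) = sgrad i (xi i w) (row i (x w)) - grad (f i) (row i (x w)).
  by apply/rowP => j; rewrite !mxE.
have sGi := join_sigma_sub sG (mxi i).
have mS j : measurable_fun setT (fun w => S w i j).
  apply: (mwrt_measurable sGi); apply: grad_noise_mwrt sGi _ _.
    exact: sub_join_sigma.
  exact: mwrt_join_sigma.
have mX j : measurable_fun setT (fun w =>
    sgrad i (xi i w) (row i (x w)) 0 j - grad (f i) (row i (x w)) 0 j).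
  by have := mS j; congr (measurable_fun _ _); apply/funext => w; rewrite !mxE.
have := Ex_sqdist_le mX (var i) (intg_cst _ _) (fun=> sqr_ge0 _) sG.
rewrite Ex_cst (_ : (fun w => sq (sgrad i (xi i w) (row i (x w)) - _)) =
  (fun w => sq (row i (S w)))) //.
by apply/funext => w; rewrite rowE.
Qed.

Lemma grad_noise_L2 G' : sub_sigma_algebra_of G' -> G `<=` G' ->
  (forall i, mwrt G' (xi i)) -> L2 Pr G' S.
Proof.
move=> sG' GG' mx i j.
apply: (@sqi_dominated _ _ _ _ _ sG' _ (fun w => sq (row i (S w)))).
- exact: grad_noise_mwrt.
- move=> w; have := sq_entry_le (row i (S w)) 0 j; rewrite mxE; apply.
- exact: (sq_row_noise i).1.
Qed.

Let sM : sub_sigma_algebra_of (@measurable _ T).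
Proof. by split=> //; exact: sigma_algebra_measurable. Qed.

Let lS : L2 Pr measurable S.
Proof.
apply: (grad_noise_L2 sM); first exact: sG.2.
move=> i; apply/(mwrtP _ sM) => B mB.
by rewrite -[_ @^-1` _]setTI; exact: mxi.
Qed.

Lemma grad_noise_centred i j : centred Pr G (fun w => S w i j).
Proof.
have [iX [_ XE]] := unb i j.
have im : intg Pr (fun w => grad (f i) (row i (x w)) 0 j).
  have l := lg i j; have := intgM sG sG l (sqi_cst Pr G 1).
  by apply: eq_integrable => // w _ /=; rewrite mulr1 mxE.
have := centredB iX im sG.2 XE.
by congr centred; apply/funext => w; rewrite !mxE.
Qed.

Lemma Ex_dot_grad_noise G' (A : T -> 'M[R]_(n, p)) : sub_sigma_algebra_of G' ->
  L2 Pr G' S -> L2 Pr G A -> Ex Pr (fun w => dot (A w) (S w)) = 0.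
Proof.
by move=> sG' lS' lA; apply: (Ex_dot_centred sG sG' lA lS'); exact: grad_noise_centred.
Qed.

Lemma Ex_sq_grad_noise : Ex Pr (fun w => sq (S w)) <= n%:R * sigma ^+ 2.
Proof.
under eq_fun do rewrite dot_row.
rewrite Ex_sum; last by move=> i; exact: (sq_row_noise i).1.
rewrite mulr_natl -[X in _ *+ X]card_ord -sumr_const.
by apply: ler_sum => i _; exact: (sq_row_noise i).2.
Qed.

(** The samples of different agents are conditionally independent, hence their
    noises are uncorrelated and averaging divides the variance by n. *)
Lemma Ex_sq_avg_grad_noise : Ex Pr (fun w => sq (avg_mx R n *m S w)) <= sigma ^+ 2.
Proof.
have lrow i : L2 Pr measurable (fun w => row i (S w)).
  by move=> k j; under eq_fun do rewrite mxE; exact: lS.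
have uncor i k : i != k -> Ex Pr (fun w => dot (row i (S w)) (row k (S w))) = 0.
  move=> ik; under eq_fun do rewrite dotE big_ord1.
  have iS j : intg Pr (fun w => row i (S w) 0 j * row k (S w) 0 j).
    exact: (intgM sM sM (lrow i 0 j) (lrow k 0 j)).
  rewrite Ex_sum //; apply: big1 => j _; apply/EFin_inj; rewrite -ExE //.
  have mj l : mwrt (join_sigma G (xi l)) (fun w => S w l j).
    apply: grad_noise_mwrt (join_sigma_sub sG (mxi l)) _ _.
      exact: sub_join_sigma.
    exact: mwrt_join_sigma.
  rewrite -[RHS](cond_indep_uncorrelated sG mxi ind ik (mj i) (mj k) (grad_noise_centred k j)).
    by apply: eq_integral => w _; rewrite !mxE.
  exact: (intgM sM sM (lS i j) (lS k j)).
have expand w : sq (avg_mx R n *m S w) =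
    n%:R^-1 * \sum_i \sum_k dot (row i (S w)) (row k (S w)).
  rewrite sq_avg_mx // /avg_row sqZ mulrA expr2 mulrA mulfV ?pnatr_eq0 -?lt0n // mul1r.
  congr (_ * _); rewrite (big_morph _ (dotDr _) (dot0r _)) /=.
  apply: eq_bigr => i _; rewrite dotC (big_morph _ (dotDr _) (dot0r _)) /=.
  by apply: eq_bigr => k _.
under eq_fun do rewrite expand.
have iik i k : intg Pr (fun w => dot (row i (S w)) (row k (S w))).
  exact: (intg_dot sM sM (lrow i) (lrow k)).
rewrite ExZ; last by do 2!apply: intg_sum => ?.
rewrite ler_pdivrMl ?ltr0n // Ex_sum; last by move=> i; apply: intg_sum.
rewrite mulr_natl -[X in _ *+ X]card_ord -sumr_const; apply: ler_sum => i _.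
rewrite Ex_sum // (bigD1 i) //= big1 ?addr0; first exact: (sq_row_noise i).2.
by move=> k ki; apply: uncor; rewrite eq_sym.
Qed.

End gradient_noise.

Section compression_noise.
Context (R : realType) (n p : nat).
Context (d d' : measure_display) (T : measurableType d) (Pr : probability T R)
  (Z : measurableType d').
Variables (comp : Z -> 'rV[R]_p -> 'rV[R]_p) (C : R)
  (G : set (set T)) (h : T -> 'M[R]_(n, p)) (zeta : 'I_n -> T -> Z).
Hypotheses (C_ge0 : 0 <= C) (sG : sub_sigma_algebra_of G) (lh : L2 Pr G h)
  (mcomp : measurable_fun setT
     (fun u : Z * borel_rV R p => comp u.1 u.2 : borel_rV R p))
  (unb : forall i, cond_mean Pr G (fun w => comp (zeta i w) (row i (h w)))
     (fun w => row i (h w)))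
  (var : forall i, cond_sqdist_le Pr G (fun w => comp (zeta i w) (row i (h w)))
     (fun w => row i (h w)) (fun w => C * frob (row i (h w)) ^+ 2)).
Variable G' : set (set T).
Hypotheses (sG' : sub_sigma_algebra_of G') (GG' : G `<=` G')
  (mz : forall i, mwrt G' (zeta i)).

Definition comp_noise (w : T) : 'M[R]_(n, p) :=
  \matrix_(i, j) comp (zeta i w) (row i (h w)) 0 j - h w.
Local Notation E := comp_noise.

Lemma comp_noise_mwrt i j : mwrt G' (fun w => E w i j).
Proof.
rewrite /mwrt; under eq_fun do rewrite mxE [X in X + _]mxE [X in _ + X]mxE.
apply: measurable_funB; last exact: (mwrt_sub sG sG' GG' (lh i j).1).
have mrow : measurable_fun [set: g_sigma_algebraType G']
    ((fun w => row i (h w)) : g_sigma_algebraType G' -> borel_rV R p).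
  apply: measurable_rV => k; under eq_fun do rewrite mxE.
  exact: (mwrt_sub sG sG' GG' (lh i k).1).
apply: (@measurable_rV_coord _ _ _ (g_sigma_algebraType G')
  (fun w => comp (zeta i w) (row i (h w))) j).
exact: measurableT_comp mcomp (measurable_fun_pair (mz i) mrow).
Qed.

Let sq_row_noise i : intg Pr (fun w => sq (row i (E w))) /\
  Ex Pr (fun w => sq (row i (E w))) <= C * Ex Pr (fun w => sq (row i (h w))).
Proof.
have rowE w : row i (E w) = comp (zeta i w) (row i (h w)) - row i (h w).
  by apply/rowP => j; rewrite !mxE.
have mE j := mwrt_measurable sG' (comp_noise_mwrt i j).
have lrow : L2 Pr G (fun w => row i (h w)).
  by move=> k j; under eq_fun do rewrite mxE; exact: lh.
have ih : intg Pr (fun w => sq (row i (h w))) by exact: (intg_dot sG sG lrow lrow).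
have ib : intg Pr (fun w => C * frob (row i (h w)) ^+ 2).
  by under eq_fun do rewrite frob_sqr; exact: intgZ.
have b0 w : 0 <= C * frob (row i (h w)) ^+ 2 by rewrite mulr_ge0 ?sqr_ge0.
have mX j : measurable_fun setT
    (fun w => comp (zeta i w) (row i (h w)) 0 j - row i (h w) 0 j).
  by have := mE j; congr (measurable_fun _ _); apply/funext => w; rewrite !mxE.
have := Ex_sqdist_le mX (var i) ib b0 sG.
have -> : (fun w => sq (comp (zeta i w) (row i (h w)) - row i (h w))) =
  (fun w => sq (row i (E w))) by apply/funext => w; rewrite rowE.
have -> : (fun w => C * frob (row i (h w)) ^+ 2) = (fun w => C * sq (row i (h w))).
  by apply/funext => w; rewrite frob_sqr.
by rewrite ExZ.
Qed.

Lemma comp_noise_L2 : L2 Pr G' E.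
Proof.
move=> i j.
apply: (@sqi_dominated _ _ _ _ _ sG' _ (fun w => sq (row i (E w)))).
- exact: comp_noise_mwrt.
- move=> w; have := sq_entry_le (row i (E w)) 0 j; rewrite mxE; apply.
- exact: (sq_row_noise i).1.
Qed.

Lemma Ex_dot_comp_noise (A : T -> 'M[R]_(n, p)) :
  L2 Pr G A -> Ex Pr (fun w => dot (A w) (E w)) = 0.
Proof.
move=> lA; apply: (Ex_dot_centred sG sG' lA comp_noise_L2) => i j.
have [iX [_ XE]] := unb i j.
have im : intg Pr (fun w => row i (h w) 0 j).
  have := intgM sG sG (lh i j) (sqi_cst Pr G 1).
  by apply: eq_integrable => // w _ /=; rewrite mulr1 mxE.
have := centredB iX im sG.2 XE.
by congr centred; apply/funext => w; rewrite !mxE.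
Qed.

Lemma Ex_sq_comp_noise : Ex Pr (fun w => sq (E w)) <= C * Ex Pr (fun w => sq (h w)).
Proof.
have lrow i : L2 Pr G (fun w => row i (h w)).
  by move=> k j; under eq_fun do rewrite mxE; exact: lh.
have -> : (fun w => sq (h w)) = (fun w => \sum_i sq (row i (h w))).
  by apply/funext => w; rewrite dot_row.
have -> : (fun w => sq (E w)) = (fun w => \sum_i sq (row i (E w))).
  by apply/funext => w; rewrite dot_row.
rewrite !Ex_sum; last 2 first.
- by move=> i; exact: (intg_dot sG sG (lrow i) (lrow i)).
- by move=> i; exact: (sq_row_noise i).1.
by rewrite mulr_sumr; apply: ler_sum => i _; exact: (sq_row_noise i).2.
Qed.

End compression_noise.

(** * The potential along a run *)

Section coefficients.
Context (R : realType) (n p : nat) (L : R) (f : 'I_n -> 'rV[R]_p -> R).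
Context (d : measure_display) (T : measurableType d) (Pr : probability T R).
Hypotheses (L_gt0 : 0 < L) (sm : smooth L f).
Variables (G : set (set T)) (B : 'M[R]_n) (mu alpha gamma C eta : R)
  (x D H S : T -> 'M[R]_(n, p)).
Hypothesis (s : sub_sigma_algebra_of G).
Local Notation P := (avg_mx R n).

(** Follows the syntax of the matrix expression: unification with the closure
    lemmas would unfold the operations. *)
Ltac L2_tac := cbv beta; lazymatch goal with
  | |- L2 _ _ (fun w => @?a w + @?b w) => refine (@L2D _ _ _ _ _ s _ _ a b _ _); L2_tac
  | |- L2 _ _ (fun w => - @?a w) => refine (@L2N _ _ _ _ _ _ _ a _); L2_tac
  | |- L2 _ _ (fun w => ?c *: @?a w) => refine (@L2Z _ _ _ _ _ _ _ c a _); L2_tac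
  | |- L2 _ _ (fun w => ?M *m @?a w) => refine (@L2_mulmx _ _ _ _ _ s _ _ _ M a _); L2_tac
  | |- L2 _ _ (fun w => grad_rows _ (@?a w)) => refine (L2_grad_rows L_gt0 sm s (x := a) _); L2_tac
  | |- _ => assumption
  end.

Lemma grad_coef_L2 : L2 Pr G x -> L2 Pr G (fun w => grad_coef f mu gamma L eta (x w)).
Proof. by move=> lx; rewrite /grad_coef /grad_noise_coef; L2_tac. Qed.

Lemma comp_coef_L2 : L2 Pr G x -> L2 Pr G D -> L2 Pr G H -> L2 Pr G S ->
  L2 Pr G (fun w => comp_coef f B mu alpha gamma C L eta (x w) (D w) (H w) (S w)).
Proof. by move=> lx lD lH lS; rewrite /comp_coef /comp_noise_coef; L2_tac. Qed.

End coefficients.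

Section run.
Context (R : realType) (n p : nat) (dXi dZ : measure_display)
  (Xi : measurableType dXi) (Z : measurableType dZ).
Variables (f : 'I_n -> 'rV[R]_p -> R)
  (sgrad : 'I_n -> Xi -> 'rV[R]_p -> 'rV[R]_p)
  (comp : Z -> 'rV[R]_p -> 'rV[R]_p) (W J : 'M[R]_n)
  (mu alpha gamma C L eta sigma : R)
  (xm1 H0 : 'M[R]_(n, p)) (r : randomness R n Xi Z).
Local Notation P := (avg_mx R n).
Local Notation B := (2^-1 *: (1%:M - W)).
Hypotheses (n_gt0 : (0 < n)%N) (mix : mixing P B J mu)
  (tun : tuning mu alpha gamma C L eta) (sm : smooth L f)
  (Hsg : stoch_grad f sgrad comp W alpha gamma (fun=> eta) xm1 H0 r sigma)
  (Huc : unbiased_compressor sgrad comp W alpha gamma (fun=> eta) xm1 H0 r C).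
Local Notation T := (Omega r).
Local Notation Pr := (Pr r).
Local Notation M := (gamma *: B).

Let L_gt0 : 0 < L. Proof. by case: tun. Qed.
Let eta_gt0 : 0 < eta. Proof. by case: tun. Qed.
Let C_ge0 : 0 <= C. Proof. by apply/ltW; case: tun. Qed.

Let st k (w : T) := run_state sgrad comp W alpha gamma (fun=> eta) xm1 H0 k w.
Let pt k (w : T) := run_point sgrad comp W alpha gamma (fun=> eta) xm1 H0 k w.
Let x k w := st_x (st k w).
Let D k w := st_D (st k w).
Let H k w := st_H (st k w).
Let h k (w : T) := run_comp_input sgrad comp W alpha gamma (fun=> eta) xm1 H0 k w.
(* S l is the noise of the gradients at the l-th point, counted from x_{-1}. *)
Let S l (w : T) := grad_noise f sgrad (pt l) (fun i w => sample i l w) w.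
Let e k (w : T) := comp_noise comp (h k) (fun i w => seed i k w) w.
Let y k w := x k w - eta *: (grad_rows f (x k w) + S k.+1 w) - D k w.

Lemma sgrad_rowsE l w : sgrad_rows sgrad (fun i l => sample i l w) l (pt l w) =
  grad_rows f (pt l w) + S l w.
Proof. by rewrite /S /grad_noise addrC subrK. Qed.

Lemma comp_inputE k w : h k w = y k w - H k w.
Proof.
have key s k' (v : state R n p) : comp_input sgrad (fun=> eta) s k' v =
    st_x v - eta *: sgrad_rows sgrad s k'.+1 (st_x v) - st_D v - st_H v.
  by case: v.
by rewrite /h /run_comp_input key /y -(sgrad_rowsE k.+1).
Qed.

(** One iteration in terms of the compression noise: H_k + Q_k = y_k + e_k. *)
Lemma stepE k w : st k.+1 w = State (y k w - M *m (y k w + e k w))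
  (D k w + M *m (y k w + e k w)) (H k w + alpha *: (y k w - H k w + e k w)).
Proof.
have hE : y k w = H k w + h k w by rewrite comp_inputE addrC subrK.
have eE : comp_rows comp (fun i l => seed i l w) k (h k w) = h k w + e k w.
  by rewrite /e /comp_noise addrC subrK.
have MW (A : 'M[R]_(n, p)) : (gamma / 2) *: ((1%:M - W) *m A) = M *m A.
  by rewrite -!scalemxAl scalerA.
have -> : st k.+1 w = cedas_step sgrad comp W alpha gamma (fun=> eta)
    (fun i l => sample i l w) (fun i l => seed i l w) k (st k w) by [].
have hst : comp_input sgrad (fun=> eta) (fun i l => sample i l w) k (st k w) = h k w by [].
have xE := sgrad_rowsE k.+1 w.
rewrite (_ : pt k.+1 w = x k w) // in xE.
rewrite -[y k w - H k w]comp_inputE -eE.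
have -> : y k w + e k w = H k w + comp_rows comp (fun i l => seed i l w) k (h k w).
  by rewrite hE -(addrA (H k w)) eE.
move: hst xE; rewrite /y /x /D /H; case: (st k w) => x' D' H' /= -> ->.
by rewrite MW; congr State; rewrite opprD addrA.
Qed.

(** The columns of I - W sum to zero. *)
Lemma P_D k w : P *m D k w = 0.
Proof.
elim: k => [|k IH]; first by rewrite /D /= mulmx0.
by rewrite /D stepE /= mulmxDr IH -scalemxAl -scalemxAr mulmxA (PB mix) mul0mx scaler0 addr0.
Qed.

(** ** Integrability of the iterates *)

Let sS k : sub_sigma_algebra_of (before_sample r k).
Proof. exact: before_sample_sub. Qed.
Let sC k : sub_sigma_algebra_of (before_comp r k).
Proof. exact: before_comp_sub. Qed.

Let mwrt_sample0 i : mwrt (before_sample r 1) (sample (r := r) i 0).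
Proof. by apply/(mwrtP _ (sS 1)); exact: sample0_measurable. Qed.
Let mwrt_sample i k : mwrt (before_comp r k) (sample (r := r) i k.+1).
Proof. by apply/(mwrtP _ (sC k)); exact: sample_measurable. Qed.
Let mwrt_seed i k : mwrt (before_sample r k.+2) (seed (r := r) i k).
Proof. by apply/(mwrtP _ (sS k.+2)); exact: seed_measurable. Qed.

Let msample i l : measurable_fun setT (sample (r := r) i l).
Proof.
case: l => [|l]; first exact: (mwrt_measurable (sS 1) (mwrt_sample0 i)).
exact: (mwrt_measurable (sC l) (@mwrt_sample i l)).
Qed.

Let var l i := proj2 (proj2 (Hsg.2 l) i).
Let unb l i := proj1 (proj2 (Hsg.2 l) i).

Let S_L2 l G : sub_sigma_algebra_of G -> before_sample r l `<=` G ->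
  (forall i, mwrt G (sample (r := r) i l)) -> L2 Pr (before_sample r l) (pt l) ->
  L2 Pr G (S l).
Proof.
move=> sG lG mG lx.
exact: (grad_noise_L2 L_gt0 sm (sS l) lx (fun i => msample i l) Hsg.1 (var l) sG lG mG).
Qed.

(** Square integrability has to be propagated along the run, since the variance of
    the compression noise is controlled by the size of the compressed matrix
    only. *)
Let iterates_L2 k : [/\ L2 Pr (before_sample r k.+1) (x k),
  L2 Pr (before_sample r k.+1) (D k) & L2 Pr (before_sample r k.+1) (H k)].
Proof.
elim: k => [|k [lx lD lH]].
  split; try exact: L2_cst.
  have l0 : L2 Pr (before_sample r 0) (pt 0) by exact: L2_cst.
  have lS := S_L2 (sS 1) (@before_sample_01 _ _ _ _ _ _ r) mwrt_sample0 l0.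
  rewrite (_ : x 0 = fun w => xm1 - eta *: (grad_rows f xm1 + S 0 w)).
    apply: (L2B (sS 1)); first exact: L2_cst.
    by apply: L2Z; apply: (L2D (sS 1)) => //; exact: L2_cst.
  apply/funext => w; rewrite /x /st /run_state /=.
  by have := sgrad_rowsE 0 w; rewrite /pt /run_point /= => ->.
have sub1 := @sample_comp_sub _ _ _ _ _ _ r k.
have sub2 := @comp_sample_sub _ _ _ _ _ _ r k.
have lS := S_L2 (sC k) sub1 (fun i => @mwrt_sample i k) lx.
have lg := L2_grad_rows L_gt0 sm (sS k.+1) lx.
have up := L2_sub (sS k.+1) (sC k) sub1.
have ly : L2 Pr (before_comp r k) (y k).
  apply: (L2B (sC k)); last exact: up.
  apply: (L2B (sC k)); first exact: up.
  by apply: L2Z; apply: (L2D (sC k)) => //; exact: up.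
have lh : L2 Pr (before_comp r k) (h k).
  rewrite (_ : h k = fun w => y k w - H k w); last by apply/funext => w; exact: comp_inputE.
  by apply: (L2B (sC k)) => //; exact: up.
have le : L2 Pr (before_sample r k.+2) (e k).
  apply: (comp_noise_L2 C_ge0 (sC k) lh Huc.1 _ (sS k.+2) sub2 (fun i => @mwrt_seed i k)).
  by move=> i; exact: ((Huc.2 i k).2).2.
have up2 := L2_sub (sC k) (sS k.+2) sub2.
have lM : L2 Pr (before_sample r k.+2) (fun w => M *m (y k w + e k w)).
  by apply: (L2_mulmx (sS k.+2)); apply: (L2D (sS k.+2)) => //; exact: up2.
split.
- rewrite (_ : x k.+1 = fun w => y k w - M *m (y k w + e k w)); last first.
    by apply/funext => w; rewrite /x stepE.
  by apply: (L2B (sS k.+2)) => //; exact: up2.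
- rewrite (_ : D k.+1 = fun w => D k w + M *m (y k w + e k w)); last first.
    by apply/funext => w; rewrite /D stepE.
  by apply: (L2D (sS k.+2)) => //; exact/up2/up.
- rewrite (_ : H k.+1 = fun w => H k w + alpha *: (y k w - H k w + e k w)); last first.
    by apply/funext => w; rewrite /H stepE.
  apply: (L2D (sS k.+2)); first exact/up2/up.
  apply: L2Z; apply: (L2D (sS k.+2)) => //.
  by apply: (L2B (sS k.+2)); [exact: up2 | exact/up2/up].
Qed.

(** ** Expectation of the noise terms *)

Let pt_L2 l : L2 Pr (before_sample r l) (pt l).
Proof. by case: l => [|l]; [exact: L2_cst | case: (iterates_L2 l)]. Qed.

(** The past up to and including the l-th samples. *)
Let next l := if l is k.+1 then before_comp r k else before_sample r 1.

Let s_next l : sub_sigma_algebra_of (next l).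
Proof. by case: l => [|k]; [exact: sS | exact: sC]. Qed.

Let S_L2n l : L2 Pr (next l) (S l).
Proof.
case: l => [|k].
  exact: (S_L2 (sS 1) (@before_sample_01 _ _ _ _ _ _ r) mwrt_sample0 (pt_L2 0)).
exact: (S_L2 (sC k) (@sample_comp_sub _ _ _ _ _ _ r k) (fun i => @mwrt_sample i k) (pt_L2 k.+1)).
Qed.

Lemma Ex_S_dot l A : L2 Pr (before_sample r l) A ->
  intg Pr (fun w => dot (A w) (S l w)) /\ Ex Pr (fun w => dot (A w) (S l w)) = 0.
Proof.
move=> lA; split; first exact: (intg_dot (sS l) (s_next l) lA (@S_L2n l)).
exact: (Ex_dot_grad_noise L_gt0 sm (sS l) (@pt_L2 l) (unb l) (s_next l) (@S_L2n l) lA).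
Qed.

Lemma Ex_S_sq l : intg Pr (fun w => sq (S l w)) /\
  Ex Pr (fun w => sq (S l w)) <= n%:R * sigma ^+ 2.
Proof.
split; first exact: (intg_dot (s_next l) (s_next l) (@S_L2n l) (@S_L2n l)).
exact: (Ex_sq_grad_noise L_gt0 sm (sS l) (@pt_L2 l) (fun i => msample i l) Hsg.1 (var l)).
Qed.

Lemma Ex_PS_sq l : intg Pr (fun w => sq (P *m S l w)) /\
  Ex Pr (fun w => sq (P *m S l w)) <= sigma ^+ 2.
Proof.
have lPS := L2_mulmx (s_next l) P (@S_L2n l).
split; first exact: (intg_dot (s_next l) (s_next l) lPS lPS).
exact: (Ex_sq_avg_grad_noise n_gt0 L_gt0 sm (sS l) (@pt_L2 l)
  (fun i => msample i l) Hsg.1 (Hsg.2 l).1 (unb l) (var l)).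
Qed.

Let lup k (A : T -> 'M[R]_(n, p)) : L2 Pr (before_sample r k.+1) A -> L2 Pr (before_comp r k) A.
Proof. exact: (L2_sub (sS k.+1) (sC k) (@sample_comp_sub _ _ _ _ _ _ r k)). Qed.

Let y_L2 k : L2 Pr (before_comp r k) (y k).
Proof.
have [lx lD lH] := iterates_L2 k.
have lg := L2_grad_rows L_gt0 sm (sS k.+1) lx.
apply: (L2B (sC k)); last exact: lup.
apply: (L2B (sC k)); first exact: lup.
by apply: L2Z; apply: (L2D (sC k)); [exact: lup | exact: (@S_L2n k.+1)].
Qed.

Let h_L2 k : L2 Pr (before_comp r k) (h k).
Proof.
rewrite (_ : h k = fun w => y k w - H k w); last by apply/funext => w; exact: comp_inputE.
by have [_ _ lH] := iterates_L2 k; apply: (L2B (sC k)); [exact: y_L2 | exact: lup].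
Qed.

Let e_L2 k : L2 Pr (before_sample r k.+2) (e k).
Proof.
apply: (comp_noise_L2 C_ge0 (sC k) (@h_L2 k) Huc.1 _ (sS k.+2)
  (@comp_sample_sub _ _ _ _ _ _ r k) (fun i => @mwrt_seed i k)).
by move=> i; exact: ((Huc.2 i k).2).2.
Qed.

Lemma Ex_e_dot k A : L2 Pr (before_comp r k) A ->
  intg Pr (fun w => dot (A w) (e k w)) /\ Ex Pr (fun w => dot (A w) (e k w)) = 0.
Proof.
move=> lA; split; first exact: (intg_dot (sC k) (sS k.+2) lA (@e_L2 k)).
apply: (Ex_dot_comp_noise C_ge0 (sC k) (@h_L2 k) Huc.1 _ _ (sS k.+2)
  (@comp_sample_sub _ _ _ _ _ _ r k) (fun i => @mwrt_seed i k) lA).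
- by move=> i; exact: ((Huc.2 i k).2).1.
- by move=> i; exact: ((Huc.2 i k).2).2.
Qed.

Lemma Ex_e_sq k : intg Pr (fun w => sq (e k w) - C * sq (y k w - H k w)) /\
  Ex Pr (fun w => sq (e k w) - C * sq (y k w - H k w)) <= 0.
Proof.
have ie := intg_dot (sS k.+2) (sS k.+2) (@e_L2 k) (@e_L2 k).
have ih := intg_dot (sC k) (sC k) (@h_L2 k) (@h_L2 k).
have -> : (fun w => sq (e k w) - C * sq (y k w - H k w)) =
  (fun w => sq (e k w) - C * sq (h k w)) by apply/funext => w; rewrite comp_inputE.
split; first by apply: intgB => //; exact: intgZ.
rewrite ExB // ?ExZ //; last exact: intgZ.
rewrite subr_le0.
apply: (Ex_sq_comp_noise C_ge0 (sC k) (@h_L2 k) Huc.1 _ (sS k.+2)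
  (@comp_sample_sub _ _ _ _ _ _ r k) (fun i => @mwrt_seed i k)).
by move=> i; exact: ((Huc.2 i k).2).2.
Qed.

Local Notation w0 := (potential_weight mu gamma L eta).
Local Notation cw := (comp_weight mu alpha gamma C L eta).

Let step_noise k w : R :=
  2 * L * eta ^+ 2 * sq (P *m S k.+1 w) + 2 * w0 * eta ^+ 2 * sq (S k.+1 w)
  + cw * (sq (e k w) - C * sq (y k w - H k w))
  + dot (comp_coef f B mu alpha gamma C L eta (x k w) (D k w) (H k w) (S k.+1 w)) (e k w)
  + dot (grad_coef f mu gamma L eta (x k w)) (S k.+1 w).

Let grad_coef_L2k k : L2 Pr (before_sample r k.+1) (fun w => grad_coef f mu gamma L eta (x k w)).
Proof. by have [lx _ _] := iterates_L2 k; exact: (grad_coef_L2 L_gt0 sm mu gamma eta (sS k.+1) lx). Qed.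

Let comp_coef_L2k k : L2 Pr (before_comp r k)
  (fun w => comp_coef f B mu alpha gamma C L eta (x k w) (D k w) (H k w) (S k.+1 w)).
Proof.
have [lx lD lH] := iterates_L2 k.
exact: (comp_coef_L2 L_gt0 sm B mu alpha gamma C eta (sC k) (lup lx) (lup lD) (lup lH) (@S_L2n k.+1)).
Qed.

Lemma potential_weight_ge0 : 0 <= w0.
Proof. exact/ltW/(potential_weight_gt0 mix tun). Qed.

(** The linear terms have mean zero and the compression term has nonpositive mean,
    so that only the variances of the gradient noise remain. *)
Lemma Ex_step_noise k : intg Pr (step_noise k) /\ Ex Pr (step_noise k) <=
  2 * L * eta ^+ 2 * sigma ^+ 2 + 2 * w0 * eta ^+ 2 * (n%:R * sigma ^+ 2).
Proof.
have [i1 e1] := Ex_PS_sq k.+1; have [i2 e2] := Ex_S_sq k.+1; have [i3 e3] := Ex_e_sq k.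
have [i4 e4] := Ex_e_dot (@comp_coef_L2k k).
have [i5 e5] := Ex_S_dot (@grad_coef_L2k k).
have j1 := intgZ (2 * L * eta ^+ 2) i1; have j2 := intgZ (2 * w0 * eta ^+ 2) i2.
have j3 := intgZ cw i3.
have j12 := intgD j1 j2; have j123 := intgD j12 j3; have j1234 := intgD j123 i4.
split; first exact: intgD j1234 i5.
rewrite (ExD j1234 i5) (ExD j123 i4) (ExD j12 j3) (ExD j1 j2) e4 e5 !addr0 !ExZ //.
have c1 : 0 <= 2 * L * eta ^+ 2 by rewrite mulr_ge0 ?sqr_ge0 // mulr_ge0 // ltW.
have c2 : 0 <= 2 * w0 * eta ^+ 2.
  by rewrite mulr_ge0 ?sqr_ge0 // mulr_ge0 // potential_weight_ge0.
have c3 : 0 <= cw.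
  case: tun => g0 _ a0 _ _ _ _ _ _ _ _; rewrite /comp_weight mulr_ge0 ?potential_weight_ge0 //.
  have k0 := ltW (tracking_weight_gt0 tun).
  by apply: addr_ge0; [exact: mulr_ge0 (ltW g0) | exact: mulr_ge0 (mulr_ge0 _ k0) (sqr_ge0 _)].
have h1 := ler_wpM2l c1 e1; have h2 := ler_wpM2l c2 e2.
have h3 := mulr_ge0_le0 c3 e3.
by rewrite -[leRHS]addr0; apply: lerD => //; exact: lerD.
Qed.

Let sq_grad_at k w := sq (P *m grad_rows f (P *m x k w)).

Let pot k w := potential f J mu alpha gamma C L eta (x k w) (D k w) (H k w).

Lemma run_potential_step k w : pot k.+1 w <= pot k w - eta / 2 * sq_grad_at k w + step_noise k w.
Proof.
have := potential_step n_gt0 mix tun sm (H k w) (e k w) (P_D k w)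
  (erefl : y k w = x k w - eta *: (grad_rows f (x k w) + S k.+1 w) - D k w).
have assoc (a1 a2 a3 a4 a5 a6 a7 : R) : a1 - a2 + a3 + a4 + a5 + a6 + a7 =
  a1 - a2 + (a3 + a4 + a5 + a6 + a7) by rewrite !addrA.
rewrite assoc; apply: le_trans; rewrite /pot.
by rewrite [x k.+1 w]/(st_x (st k.+1 w)) [D k.+1 w]/(st_D (st k.+1 w))
  [H k.+1 w]/(st_H (st k.+1 w)) stepE.
Qed.

Lemma potential_telescope K w :
  pot K w + eta / 2 * \sum_(k < K) sq_grad_at k w <= pot 0 w + \sum_(k < K) step_noise k w.
Proof.
elim: K => [|K IH]; first by rewrite !big_ord0 mulr0.
rewrite !big_ord_recr /=; move: (run_potential_step K w) IH.
move: (pot K.+1 w) (pot K w) (pot 0 w) (sq_grad_at K w) (step_noise K w) => u1 u2 u3 u4 u5.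
move: (\sum_(i < K) sq_grad_at i w) (\sum_(i < K) step_noise i w) => u6 u7; lra.
Qed.

Variable finf : R.
Hypothesis f_ge : forall v, finf <= avg_fun f v.

(** The noise of the step from x_{-1} to x_0, a plain stochastic gradient step
    in which nothing is compressed. *)
Let init_noise w : R :=
  L * eta ^+ 2 * sq (P *m S 0 w) + w0 * L ^- 2 * sq (S 0 w)
  + dot (- (eta *: (P *m grad_rows f (P *m xm1))) + (2 * L * eta ^+ 2) *: (P *m grad_rows f xm1))
      (S 0 w).

Let init_det : R := eta / 2 * L ^+ 2 * sq xm1
  + w0 * (18 * sq xm1 + 2 * sq H0 + 3 * L ^- 2 * sq (grad_rows f xm1)).

Let eta_L_le : eta * L <= 64^-1.
Proof.
apply: le_trans (tun_eta_le tun) _; rewrite ler_pdivrMr //.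
by apply: le_trans (t_le mix tun) _; rewrite (_ : 64^-1 * 16 = 4^-1) //; field.
Qed.

Lemma initial_potential_le w : pot 0 w <= n%:R * avg_fun f (avg_row xm1) + init_det + init_noise w.
Proof.
have xE : x 0 w = xm1 - eta *: (grad_rows f xm1 + S 0 w).
  rewrite /x /st /run_state /=.
  by have := sgrad_rowsE 0 w; rewrite /pt /run_point /= => ->.
have Pdiff : P *m (x 0 w - xm1) = - (eta *: (P *m (grad_rows f xm1 + S 0 w))).
  by rewrite xE addrAC subrr add0r mulmxN -scalemxAr.
have h1 := avg_descent n_gt0 mix tun sm Pdiff.
have h2 := ler_wpM2l potential_weight_ge0 (lyapunov_init mix tun sm H0 xE).
have h3 := ler_wpM2l (mulr_ge0 (divr_ge0 (ltW eta_gt0) (ler0n _ 2)) (sqr_ge0 L)) (sq_perp mix xm1).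
have eL := eta_L_le.
have h4 := ler_wpM2r (sq_ge0 (P *m grad_rows f xm1)) (ler_wpM2l (ltW eta_gt0) eL).
have h5 := mulr_ge0 (ltW eta_gt0) (sq_ge0 (P *m grad_rows f xm1)).
have h6 := mulr_ge0 (ltW eta_gt0) (sq_ge0 (P *m grad_rows f (P *m xm1))).
rewrite /pot /potential /init_det /init_noise (_ : D 0 w = 0) // (_ : H 0 w = H0) //.
move: (x 0 w) (S 0 w) xE Pdiff h1 h2 => x1 s0 _ _.
rewrite (sq_avgD n_gt0) [dot (_ + _ *: _) s0]dotDl [dot (- _) s0]dotNl !(dotZl _ _ s0); move: h3 h4 h5 h6; clear eL.
move: (lyapunov _ _ _ _ _ _ _ _ _) (w0) (L ^- 2).
move: (sq (P *m s0)) (sq s0) (sq (xm1 - P *m xm1)) (sq xm1) (sq H0).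
move: (sq (grad_rows f xm1)) (sq (P *m grad_rows f xm1)) (sq (P *m grad_rows f (P *m xm1))).
move: (dot (P *m grad_rows f (P *m xm1)) s0) (dot (P *m grad_rows f xm1) s0).
move: (n%:R * avg_fun f (avg_row x1)) (n%:R * avg_fun f (avg_row xm1)).
move=> v1 v2 v3 v4 v5 v6 v7 v8 v9 v10 v11 v12 v13 v14 v15.
lra.
Qed.

Let sq_grad_intg k : intg Pr (sq_grad_at k).
Proof.
have [lx _ _] := iterates_L2 k; have s := sS k.+1.
have lg := L2_mulmx s P (L2_grad_rows L_gt0 sm s (L2_mulmx s P lx)).
exact: (intg_dot s s lg lg).
Qed.

Lemma Ex_init_noise : intg Pr init_noise /\
  Ex Pr init_noise <= L * eta ^+ 2 * sigma ^+ 2 + w0 * L ^- 2 * (n%:R * sigma ^+ 2).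
Proof.
have [i1 e1] := Ex_PS_sq 0; have [i2 e2] := Ex_S_sq 0.
have [i3 e3] := Ex_S_dot (l := 0) (L2_cst Pr (before_sample r 0)
  (- (eta *: (P *m grad_rows f (P *m xm1))) + (2 * L * eta ^+ 2) *: (P *m grad_rows f xm1))).
have j1 := intgZ (L * eta ^+ 2) i1; have j2 := intgZ (w0 * L ^- 2) i2.
have j12 := intgD j1 j2; split; first exact: intgD j12 i3.
rewrite (ExD j12 i3) (ExD j1 j2) e3 addr0 !ExZ //; apply: lerD; apply: ler_wpM2l => //.
  by rewrite mulr_ge0 ?sqr_ge0 // ltW.
by rewrite mulr_ge0 ?potential_weight_ge0 // invr_ge0 sqr_ge0.
Qed.

Let descent_const := n%:R * (avg_fun f (avg_row xm1) - finf) + init_det.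

Lemma sum_sq_grad_le K : eta / 2 * \sum_(k < K) Ex Pr (sq_grad_at k) <=
  descent_const + (L * eta ^+ 2 * sigma ^+ 2 + w0 * L ^- 2 * (n%:R * sigma ^+ 2))
  + K%:R * (2 * L * eta ^+ 2 * sigma ^+ 2 + 2 * w0 * eta ^+ 2 * (n%:R * sigma ^+ 2)).
Proof.
have isum := @intg_sum _ _ _ Pr _ (index_enum 'I_K) _ (fun k : 'I_K => sq_grad_intg k).
have inoise := @intg_sum _ _ _ Pr _ (index_enum 'I_K) _ (fun k : 'I_K => (Ex_step_noise k).1).
have [i0 e0] := Ex_init_noise; have ic := intg_cst Pr descent_const.
have path w : eta / 2 * \sum_(k < K) sq_grad_at k w <=
    descent_const + init_noise w + \sum_(k < K) step_noise k w.
  have h1 := potential_telescope K w; have h2 := initial_potential_le w.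
  have h3 : n%:R * finf <= pot K w.
    rewrite -[leLHS]addr0; apply: lerD; first by rewrite ler_wpM2l.
    by rewrite mulr_ge0 ?potential_weight_ge0 // (lyapunov_ge0 mix tun) // P_D.
  move: h1 h2 h3; rewrite /descent_const mulrBr.
  move: (pot K w) (pot 0 w) (init_noise w) init_det => u1 u2 u3 u4.
  move: (\sum_(i < K) sq_grad_at i w) (\sum_(i < K) step_noise i w) => u6 u7.
  move: (n%:R * avg_fun f (avg_row xm1)) (n%:R * finf) (eta / 2 * u6) => u8 u9 u10; lra.
rewrite -(Ex_sum (P := Pr)) // -ExZ //.
apply: le_trans (le_Ex (intgZ _ isum) (intgD (intgD ic i0) inoise) path) _.
rewrite (ExD (intgD ic i0) inoise) (ExD ic i0) Ex_cst.
apply: lerD; first by rewrite lerD2l.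
rewrite Ex_sum; last by move=> k; exact: (Ex_step_noise k).1.
rewrite mulr_natl -[X in _ *+ X]card_ord -sumr_const; apply: ler_sum => k _.
exact: (Ex_step_noise k).2.
Qed.

(** All rows of P x_k equal the average, so sq (P grad F(P x_k)) is n times the
    squared norm of the gradient of f at the average. *)
Lemma avg_sq_grad_le K : (0 < K)%N ->
  (avg_sq_grad f sgrad comp W alpha gamma (fun=> eta) xm1 H0 r K <=
  (2 / (eta * n%:R * K%:R) * (descent_const
    + (L * eta ^+ 2 * sigma ^+ 2 + w0 * L ^- 2 * (n%:R * sigma ^+ 2)))
  + 2 / (eta * n%:R) * (2 * L * eta ^+ 2 * sigma ^+ 2
    + 2 * w0 * eta ^+ 2 * (n%:R * sigma ^+ 2)))%:E)%E.
Proof.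
move=> K0.
have nn0 : n%:R != 0 :> R by rewrite pnatr_eq0 -lt0n.
have frobE k w : frob (grad (avg_fun f) (avg_row (x k w))) ^+ 2 = n%:R^-1 * sq_grad_at k w.
  rewrite frob_sqr (grad_avg_fun sm) /sq_grad_at sq_avg_mx // mulKf //.
have -> : avg_sq_grad f sgrad comp W alpha gamma (fun=> eta) xm1 H0 r K =
    (K%:R^-1 * (n%:R^-1 * \sum_(k < K) Ex Pr (sq_grad_at k)))%:E.
  rewrite /avg_sq_grad EFinM mulr_sumr -sumEFin; congr (_ * _)%E.
  apply: eq_bigr => k _; rewrite unlock -ExZ // -ExE; last exact: intgZ.
  by apply: eq_integral => w _; rewrite -frobE.
rewrite lee_fin.
have K0' : 0 < K%:R :> R by rewrite ltr0n.
have n0' : 0 < n%:R :> R by rewrite ltr0n.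
have c0 : 0 <= 2 / (eta * n%:R * K%:R) by rewrite divr_ge0 // !mulr_ge0 // ltW.
have := ler_wpM2l c0 (sum_sq_grad_le K); rewrite mulrDr.
move: (descent_const + _) (2 * L * eta ^+ 2 * sigma ^+ 2 + _) (\sum_(k < K) _) => u v s.
by congr (_ <= _); field; rewrite !lt0r_neq0.
Qed.

End run.

(** * The transient time *)

Section horizon.
Context (R : realType) (L sigma Delta0 q alpha gamma C lam2 : R) (n K : nat).
Hypotheses (L_gt0 : 0 < L) (q_ge : 600 <= q) (C_gt0 : 0 < C) (lam2_lt1 : lam2 < 1)
  (alphaE : alpha = (4 * (C + 1))^-1) (gammaE : gamma = alpha ^+ 2 * (1 - lam2) / (q * C))
  (gamma_le : gamma <= 2^-1) (gamma_alpha : gamma <= alpha / 2).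
Local Notation mu := ((1 - lam2) / 2).
Local Notation eta := (cedas_eta L sigma Delta0 gamma lam2 n K).

Let alpha_gt0 : 0 < alpha.
Proof. by rewrite alphaE invr_gt0 mulr_gt0 // addr_gt0. Qed.

Let mu_gt0 : 0 < mu. Proof. by rewrite divr_gt0 // subr_gt0. Qed.

Let q_gt0 : 0 < q. Proof. by apply: lt_le_trans q_ge; rewrite ltr0n. Qed.

Let gamma_gt0 : 0 < gamma.
Proof. by rewrite gammaE divr_gt0 ?mulr_gt0 ?exprn_gt0 // subr_gt0. Qed.

Lemma cedas_etaE : eta =
  (Num.sqrt (L * sigma ^+ 2 * K%:R / (n%:R * Delta0)) + 16 * L / (gamma * mu))^-1.
Proof.
rewrite /cedas_eta; congr (_ + _)^-1; field.
by rewrite !lt0r_neq0 ?subr_gt0.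
Qed.

(** The lower bound 600 on q is twice the constant in the condition on gamma C
    of [tuning], because 1 - lambda_2 = 2 mu. *)
Lemma cedas_tuning : tuning mu alpha gamma C L eta.
Proof.
have t0 : 0 < gamma * mu by rewrite mulr_gt0.
have s0 : 0 <= Num.sqrt (L * sigma ^+ 2 * K%:R / (n%:R * Delta0)) by exact: sqrtr_ge0.
have Lt0 : 0 < 16 * L / (gamma * mu) by rewrite divr_gt0 // mulr_gt0.
have eta_gt0 : 0 < eta by rewrite cedas_etaE invr_gt0 ltr_wpDl.
split=> //.
- rewrite alphaE lef_pV2 ?posrE ?mulr_gt0 ?addr_gt0 //; move: C_gt0; lra.
- rewrite alphaE invfM -mulrA -[leRHS]mulr1 ler_pM2l // ler_pdivrMl ?addr_gt0 //.
  by rewrite mulr1 lerDl.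
- have -> : gamma * C = alpha ^+ 2 * (1 - lam2) / q.
    by rewrite gammaE; field; rewrite !lt0r_neq0.
  have a0 : 0 <= alpha ^+ 2 * (1 - lam2) by rewrite mulr_ge0 ?sqr_ge0 // subr_ge0 ltW.
  have -> : alpha ^+ 2 * mu / 300 = alpha ^+ 2 * (1 - lam2) / 600 by field.
  by apply: (ler_wpM2l a0); rewrite lef_pV2 ?posrE ?ltr0n.
- have h : eta <= (16 * L / (gamma * mu))^-1.
    by rewrite cedas_etaE lef_pV2 ?posrE ?ltr_wpDl // lerDr.
  rewrite -ler_pdivlMr //; apply: le_trans h _.
  by rewrite invf_div invfM mulrA.
Qed.

(** The powers of C + 1 are turned into powers of C by
    C + 1 <= C (1 + 1 / c0). *)
Lemma inv_time_le (c0 : R) : 0 < c0 -> c0 <= C ->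
  (gamma * mu) ^- 2 <= (32 * q) ^+ 2 * (1 + c0^-1) ^+ 4 * C ^+ 6 / (1 - lam2) ^+ 4.
Proof.
move=> c00 c0C.
have d0 : 0 < 1 - lam2 by rewrite subr_gt0.
have -> : (gamma * mu) ^- 2 = (32 * q) ^+ 2 * C ^+ 2 * (C + 1) ^+ 4 / (1 - lam2) ^+ 4.
  rewrite gammaE alphaE; field; rewrite !lt0r_neq0 // addr_gt0 //.
have h : (C + 1) ^+ 4 <= (C * (1 + c0^-1)) ^+ 4.
  have C1 : 0 <= C + 1 by rewrite addr_ge0 // ltW.
  have Cc : 0 <= C * (1 + c0^-1) by rewrite mulr_ge0 ?addr_ge0 ?invr_ge0 // ltW.
  rewrite ler_pXn2r ?nnegrE //.
  by rewrite mulrDr mulr1 lerD2l ler_pdivlMr // mul1r.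
rewrite ler_pM2r ?invr_gt0 ?exprn_gt0 //.
have c : 0 <= (32 * q) ^+ 2 * C ^+ 2 by rewrite mulr_ge0 ?sqr_ge0.
apply: le_trans (ler_wpM2l c h) _.
by rewrite le_eqVlt; apply/orP; left; apply/eqP; ring.
Qed.

End horizon.

Lemma transient_const_gt0 (R : realType) (c0 q : R) : 0 < c0 -> 600 <= q ->
  0 < 2 * ((32 * q) ^+ 2 * (1 + c0^-1) ^+ 4).
Proof.
move=> c00 q600; have q0 : 0 < q by apply: lt_le_trans q600; rewrite ltr0n.
have c1 : 0 < 1 + c0^-1 by rewrite addr_gt0 // invr_gt0.
by rewrite mulr_gt0 // mulr_gt0 ?exprn_gt0 // mulr_gt0.
Qed.

Section transient.
Context (R : realType) (L sigma Delta0 aX aF c0 q : R).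
Hypotheses (L_gt0 : 0 < L) (sigma_gt0 : 0 < sigma) (Delta0_gt0 : 0 < Delta0)
  (aX_ge0 : 0 <= aX) (aF_ge0 : 0 <= aF) (c0_gt0 : 0 < c0) (q_ge : 600 <= q).
Context (n p : nat) (link : rel 'I_n) (W : 'M[R]_n) (lam : seq R)
  (f : 'I_n -> 'rV[R]_p -> R) (dXi dZ : measure_display)
  (Xi : measurableType dXi) (Z : measurableType dZ)
  (sgrad : 'I_n -> Xi -> 'rV[R]_p -> 'rV[R]_p)
  (comp : Z -> 'rV[R]_p -> 'rV[R]_p) (C alpha gamma : R) (xm1 H0 : 'M[R]_(n, p)).
Hypotheses (n_ge2 : (2 <= n)%N) (net : network link W lam) (sm : smooth L f)
  (f_bd : has_lbound (range (avg_fun f)))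
  (fE : avg_fun f (avg_row xm1) - inf (range (avg_fun f)) = Delta0)
  (x_le : sq xm1 <= aX * n%:R ^+ 2) (H_le : sq H0 <= aX * n%:R ^+ 2)
  (g_le : sq (grad_rows f xm1) <= aF * n%:R ^+ 2) (C_ge : c0 <= C)
  (alphaE : alpha = (4 * (C + 1))^-1)
  (gammaE : gamma = alpha ^+ 2 * (1 - lam`_1) / (q * C))
  (gamma_le : gamma <= 2^-1) (gamma_alpha : gamma <= alpha / 2).
Local Notation mu := ((1 - lam`_1) / 2).
Local Notation eta K := (cedas_eta L sigma Delta0 gamma lam`_1 n K).

Let n_gt0 : (0 < n)%N. Proof. exact: leq_trans n_ge2. Qed.
Let C_gt0 : 0 < C. Proof. exact: lt_le_trans C_ge. Qed.

Let tun K : tuning mu alpha gamma C L (eta K).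
Proof.
exact: (cedas_tuning sigma Delta0 n K L_gt0 q_ge C_gt0 (lam_second net)
  alphaE gammaE gamma_le gamma_alpha).
Qed.

Lemma cedas_rate K (r : randomness R n Xi Z) : (0 < K)%N ->
  n%:R ^+ 3 / (gamma * mu) ^+ 2 <= K%:R ->
  stoch_grad f sgrad comp W alpha gamma (fun=> eta K) xm1 H0 r sigma ->
  unbiased_compressor sgrad comp W alpha gamma (fun=> eta K) xm1 H0 r C ->
  (avg_sq_grad f sgrad comp W alpha gamma (fun=> eta K) xm1 H0 r K <=
   (rate_const L sigma Delta0 aX aF / Num.sqrt (n * K)%:R)%:E)%E.
Proof.
move=> K_gt0 Kn hsg hcomp.
have [J mix] := mixing_exists n_ge2 net.
have f_ge v : inf (range (avg_fun f)) <= avg_fun f v by apply: ge_inf => //; exists v.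
apply: le_trans (avg_sq_grad_le n_gt0 mix (tun K) sm hsg hcomp f_ge K_gt0) _.
rewrite lee_fin natrM.
have n1 : 1 <= n%:R :> R by rewrite ler1n.
have K1 : 1 <= K%:R :> R by rewrite ler1n.
have t0 := t_gt0 mix (tun K).
have t1 : gamma * mu <= 1 by apply: le_trans (t_le mix (tun K)) _; lra.
have e0 := tun_eta_gt0 (tun K).
have etaE := cedas_etaE L sigma Delta0 n K q_ge C_gt0 (lam_second net) alphaE gammaE.
apply: le_trans (rate_bound L_gt0 sigma_gt0 Delta0_gt0 aX_ge0 aF_ge0 n1 K1 t0 t1 Kn etaE).
rewrite lerD2r.
apply: ler_wpM2l; first by rewrite divr_ge0 // !mulr_ge0 // ltW.
rewrite fE /potential_weight; move: e0; move: (eta K) => e e0.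
set w := 5 * e * L ^+ 2 / (gamma * mu).
have w0 : 0 <= w := divr_ge0 (mulr_ge0 (mulr_ge0 (ler0n _ 5) (ltW e0)) (sqr_ge0 L)) (ltW t0).
have l0 : 0 <= L ^- 2 by rewrite invr_ge0 sqr_ge0.
have nn : n%:R <= n%:R ^+ 2 :> R by rewrite expr2 -[leLHS]mulr1 ler_wpM2l.
have h1 := ler_wpM2l (mulr_ge0 (divr_ge0 (ltW e0) (ler0n _ 2)) (sqr_ge0 L)) x_le.
have h2 := ler_wpM2l l0 g_le.
have h3 := ler_wpM2l l0 (ler_wpM2r (sqr_ge0 sigma) nn).
have h4 : 18 * sq xm1 + 2 * sq H0 + 3 * L ^- 2 * sq (grad_rows f xm1)
    + L ^- 2 * (n%:R * sigma ^+ 2) <= init_const L sigma aX aF * n%:R ^+ 2.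
  rewrite /init_const; move: x_le H_le h2 h3.
  move: (sq xm1) (sq H0) (sq (grad_rows f xm1)) (L ^- 2) (n%:R ^+ 2) (n%:R * sigma ^+ 2) (sigma ^+ 2).
  move=> u1 u2 u3 u4 u5 u6 u7; lra.
have := ler_wpM2l w0 h4; move: h1.
move: (init_const _ _ _ _ * _) (sq xm1) (sq H0) (sq (grad_rows f xm1)) (L ^- 2).
move: (n%:R ^+ 2) (n%:R * Delta0) (n%:R * sigma ^+ 2) (L * e ^+ 2 * sigma ^+ 2) => u1 u2 u3 u4.
move=> u5 u6 u7 u8 u9; lra.
Qed.

(** Rounding the threshold n^3 / t^2, which is at least 1, at most doubles it. *)
Lemma cedas_transient (run : nat -> randomness R n Xi Z) :
  (forall K, (0 < K)%N ->
    stoch_grad f sgrad comp W alpha gamma (fun=> eta K) xm1 H0 (run K) sigma /\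
    unbiased_compressor sgrad comp W alpha gamma (fun=> eta K) xm1 H0 (run K) C) ->
  (transient_time (rate_const L sigma Delta0 aX aF) n (fun K =>
     avg_sq_grad f sgrad comp W alpha gamma (fun=> eta K) xm1 H0 (run K) K)
   <= (2 * ((32 * q) ^+ 2 * (1 + c0^-1) ^+ 4)
       * (n%:R ^+ 3 * C ^+ 6 / (1 - lam`_1) ^+ 4))%:E)%E.
Proof.
move=> Hrun; have [J mix] := mixing_exists n_ge2 net.
have t0 := t_gt0 mix (tun 0).
have t1 : gamma * mu <= 1 by apply: le_trans (t_le mix (tun 0)) _; lra.
set v := n%:R ^+ 3 / (gamma * mu) ^+ 2.
have v1 : 1 <= v.
  rewrite ler_pdivlMr ?exprn_gt0 // mul1r.
  by apply: (@le_trans _ _ 1); [rewrite expr_le1 // ltW | rewrite -natrX ler1n expn_gt0 n_gt0].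
have /truncn_itv/andP[vK Kv] : 0 <= v by exact: le_trans v1.
have v_le : v <= (32 * q) ^+ 2 * (1 + c0^-1) ^+ 4 * (n%:R ^+ 3 * C ^+ 6 / (1 - lam`_1) ^+ 4).
  have := inv_time_le q_ge C_gt0 (lam_second net) alphaE gammaE c0_gt0 C_ge.
  move=> /(ler_wpM2l (exprn_ge0 3 (ler0n R n))).
  have comm (a m c d : R) : a * (m * c * d) = m * (a * c * d) by ring.
  by rewrite comm; apply: le_trans.
apply: (@le_trans _ _ ((Num.truncn v).+1%:R)%:E).
  apply: ereal_inf_lbound; exists (Num.truncn v).+1 => //; split=> // k Kk.
  have k0 : (0 < k)%N by exact: leq_trans Kk.
  have [hs hc] := Hrun k k0.
  apply: cedas_rate => //; apply: le_trans (ltW Kv) _.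
  by rewrite ler_nat.
rewrite lee_fin -natr1; apply: (le_trans (lerD vK v1)).
by rewrite -mulrA mulr_natl mulr2n; exact: lerD.
Qed.

End transient.

(* L, sigma, Delta0, the constants aX, aF, b, q of the O-assumptions and the
   lower bound c0 for C are fixed first; the hidden constants c and M may depend
   on them only. *)
Theorem corollary2 (R : realType) (L sigma Delta0 aX aF b q c0 : R)
    (L_gt0 : 0 < L) (sigma_gt0 : 0 < sigma) (Delta0_gt0 : 0 < Delta0)
    (q_gt0 : 0 < q) (c0_gt0 : 0 < c0) :
  exists c M : R, [/\ 0 < c, 0 < M &
    forall (n p : nat) (link : rel 'I_n) (W : 'M[R]_n) (lam : seq R)
      (f : 'I_n -> 'rV[R]_p -> R)
      (dXi dZ : measure_display)
      (Xi : measurableType dXi) (Z : measurableType dZ)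
      (sgrad : 'I_n -> Xi -> 'rV[R]_p -> 'rV[R]_p)
      (comp : Z -> 'rV[R]_p -> 'rV[R]_p) (C : R)
      (xm1 H0 : 'M[R]_(n, p))
      (run : nat -> randomness R n Xi Z),
    let lam2 := lam`_1 in
    let alpha := (4 * (C + 1))^-1 in
    let gamma := alpha ^+ 2 * (1 - lam2) / (15872 * C) in
    let eta K : nat -> R := fun=> cedas_eta L sigma Delta0 gamma lam2 n K in
    (2 <= n)%N ->
    network link W lam ->
    smooth L f ->
    has_lbound (range (avg_fun f)) ->
    avg_fun f (avg_row xm1) - inf (range (avg_fun f)) = Delta0 ->
    frob xm1 ^+ 2 <= aX * n%:R ^+ 2 ->
    frob H0 ^+ 2 <= aX * n%:R ^+ 2 ->
    frob (grad_rows f xm1) ^+ 2 <= aF * n%:R ^+ 2 ->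
    (1 - lam2)^-1 <= b * n%:R `^ q ->
    c0 <= C ->
    [/\ gamma <= 2^-1, gamma <= alpha ^+ 2 * (1 - lam2) / (15872 * C)
      & gamma <= alpha / 2] ->
    (forall K, (0 < K)%N ->
       stoch_grad f sgrad comp W alpha gamma (eta K) xm1 H0 (run K) sigma /\
       unbiased_compressor sgrad comp W alpha gamma (eta K) xm1 H0 (run K) C) ->
    (transient_time c n (fun K =>
       avg_sq_grad f sgrad comp W alpha gamma (eta K) xm1 H0 (run K) K)
     <= (M * (n%:R ^+ 3 * C ^+ 6 / (1 - lam2) ^+ 4))%:E)%E].
Proof.
have q600 : 600 <= 15872 :> R by rewrite ler_nat.
exists (rate_const L sigma Delta0 `|aX| `|aF|), (2 * ((32 * 15872) ^+ 2 * (1 + c0^-1) ^+ 4)).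
split.
- exact: rate_const_gt0.
- exact: transient_const_gt0.
move=> n p link W lam f dXi dZ Xi Z sgrad comp C xm1 H0 run lam2 alpha gamma eta n_ge2 net sm.
rewrite !frob_sqr => f_bd fE x_le H_le g_le _ C_ge [gamma_le _ gamma_alpha] Hrun.
have abs_le (a u : R) : u <= a * n%:R ^+ 2 -> u <= `|a| * n%:R ^+ 2.
  by move/le_trans; apply; rewrite ler_wpM2r ?sqr_ge0 ?ler_norm.
exact: (cedas_transient L_gt0 sigma_gt0 Delta0_gt0 (normr_ge0 aX) (normr_ge0 aF) c0_gt0 q600
  n_ge2 net sm f_bd fE (abs_le _ _ x_le) (abs_le _ _ H_le) (abs_le _ _ g_le) C_ge erefl erefl
  gamma_le gamma_alpha Hrun).
Qed.
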